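(* Let $n\in\{1,2,3\}$, let $\Omega=\mathbb{R}^n$ or $\Omega=B_R:=\{x\in\mathbb{R}^n:|x|<R\}$ for some $R>0$, let $\lambda,\gamma\in\mathbb{R}$, and let $q\in\mathbb{R}$ be such that $p:=2q+3\in(1,p_S)$. Let $C_1,C_2,C_3,C_4\ge0$ be fixed. Let $B$ be a compact set in $\mathbb{R}\setminus\{-1\}$ and let $B^*$ be a compact set in $\mathbb{R}$. For $\beta\in\mathbb{R}$ consider the problem $$\begin{aligned}-\Delta u+\lambda u+\gamma v&=|u|^{2q+2}u+\beta|v|^{q+2}|u|^{q}u&&\text{in }\Omega,\\-\Delta v+\lambda v+\gamma u&=|v|^{2q+2}v+\beta|u|^{q+2}|v|^{q}v&&\text{in }\Omega,\\ u=v&=0&&\text{on }\partial\Omega\ \text{ if }\partial\Omega\neq\emptyset.\end{aligned}\tag{P$_\beta$}$$ Then there exists a constant $C$ such that every classical radial solution $(u,v)\in\mathcal{K}$ of (P$_\beta$) with $\beta\in B$, and every classical radial solution $(u,v)\in\mathcal{K}^*$ of (P$_\beta$) with $\beta\in B^*$, satisfies $\|(u,v)\|_\infty\le C$.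
   Context: The critical Sobolev exponent is $p_S:=\frac{n+2}{n-2}$ if $n\ge3$ and $p_S:=\infty$ if $n\in\{1,2\}$. Solutions are real-valued; $\|\cdot\|_\infty$ is the sup norm on $\Omega$. Expressions such as $|u|^qu$ are understood as $0$ where $u=0$ (note $q>-1$). A solution $(u,v)$ is radial if both $u$ and $v$ are radially symmetric about the origin. Zero number: for an interval $J\subset\mathbb{R}$ and $w\in C(J,\mathbb{R})$, $$z_J(w):=\sup\{j:\ \exists\,x_1<x_2<\dots<x_{j+1}\text{ in }J\text{ with }w(x_i)\,w(x_{i+1})<0\text{ for }i=1,\dots,j\},\qquad \sup\emptyset:=0,$$ i.e. the number of sign changes of $w$ in $J$. If $w$ is continuous and radially symmetric on $\Omega$, $w(x)=\tilde w(|x|)$, then $z(w):=z_J(\tilde w)$, where $J=[0,\infty)$ if $\Omega=\mathbb{R}^n$ and $J=[0,R)$ if $\Omega=B_R$. The classes $\mathcal{K}$ and $\mathcal{K}^*$ are $$\mathcal{K}=\mathcal{K}(C_1,C_2,C_3,C_4):=\{(u,v):\ z(u)\le C_1,\ z(v)\le C_2,\ z(u-v)\le C_3,\ z(u+v)\le C_4\},$$ $$\mathcal{K}^*:=\{(u,v)\in\mathcal{K}:\ u\not\equiv v\text{ and }u\not\equiv-v\}.$$ *)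

(* Defs.v *)
From HB Require Import structures.
From mathcomp Require Import all_boot all_order all_algebra.
From mathcomp Require Import all_classical all_reals all_analysis.
Set Implicit Arguments.
Unset Strict Implicit.
Unset Printing Implicit Defensive.
Import Order.TTheory GRing.Theory Num.Theory.
Import numFieldNormedType.Exports.
Local Open Scope classical_set_scope.
Local Open Scope ring_scope.

(* The library norm on 'rV[R]_n is the max norm, so the Euclidean norm is
   defined separately; both norms induce the same topology. *)
Definition enorm (R : realType) (n : nat) (x : 'rV[R]_n) : R :=
  Num.sqrt (\sum_(i < n) x ord0 i ^+ 2).

Variant domain (R : realType) := WholeSpace | Ball of R.
Arguments WholeSpace {R}.

Definition valid_domain (R : realType) (D : domain R) : Prop :=
  match D with WholeSpace => True | Ball rho => 0 < rho end.

Definition domain_set (R : realType) (n : nat) (D : domain R) :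
    set 'rV[R]_n :=
  match D with
  | WholeSpace => setT
  | Ball rho => [set x | enorm x < rho]
  end.

Definition domain_radii (R : realType) (D : domain R) : set R :=
  match D with
  | WholeSpace => [set r | 0 <= r]
  | Ball rho => [set r | 0 <= r < rho]
  end.

Definition boundary (T : topologicalType) (A : set T) : set T :=
  closure A `\` interior A.

Definition critical_exponent (R : realType) (n : nat) : \bar R :=
  if (3 <= n)%N then ((n%:R + 2) / (n%:R - 2))%:E else +oo%E.

Definition partial_derivative (R : realType) (n : nat) (i : 'I_n)
    (u : 'rV[R]_n -> R) : 'rV[R]_n -> R :=
  'D_(delta_mx ord0 i : 'rV[R]_n) u.

Definition laplacian (R : realType) (n : nat) (u : 'rV[R]_n -> R)
    (x : 'rV[R]_n) : R :=
  \sum_(i < n) partial_derivative i (partial_derivative i u) x.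

(* C^k on A, where A is meant to be open. *)
Fixpoint is_Ck (R : realType) (n k : nat) (A : set 'rV[R]_n)
    (u : 'rV[R]_n -> R) : Prop :=
  (forall x, A x -> {for x, continuous u}) /\
  match k with
  | 0 => True
  | k'.+1 => forall i : 'I_n,
      (forall x, A x -> derivable u x (delta_mx ord0 i : 'rV[R]_n)) /\
      is_Ck k' A (partial_derivative i u)
  end.

(* Functions on the closure of a domain are represented by total functions on
   R^n, whose values outside that closure are irrelevant in everything below. *)
Definition radially_symmetric (R : realType) (n : nat) (A : set 'rV[R]_n)
    (w : 'rV[R]_n -> R) : Prop :=
  forall x y, A x -> A y -> enorm x = enorm y -> w x = w y.

(* Since powR is total with 0 `^ s in {0, 1}, the products |u|^s u below
   vanish where u = 0 for every real s. *)
Definition nonlinearity (R : realType) (q beta a b : R) : R :=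
  `|a| `^ (2 * q + 2) * a + beta * `|b| `^ (q + 2) * `|a| `^ q * a.

Definition classical_solution (R : realType) (n : nat) (D : domain R)
    (lambda gamma q beta : R) (u v : 'rV[R]_n -> R) : Prop :=
  let Omega := @domain_set R n D in
  [/\ is_Ck 2 Omega u /\ is_Ck 2 Omega v,
      {within closure Omega, continuous u} /\
      {within closure Omega, continuous v},
      forall x, Omega x ->
        - laplacian u x + lambda * u x + gamma * v x
          = nonlinearity q beta (u x) (v x),
      forall x, Omega x ->
        - laplacian v x + lambda * v x + gamma * u x
          = nonlinearity q beta (v x) (u x)
    & forall x, boundary Omega x -> u x = 0 /\ v x = 0].

Definition classical_radial_solution (R : realType) (n : nat) (D : domain R)
    (lambda gamma q beta : R) (u v : 'rV[R]_n -> R) : Prop :=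
  [/\ classical_solution D lambda gamma q beta u v,
      radially_symmetric (domain_set D) u
    & radially_symmetric (domain_set D) v].

(* The points x_1 < ... < x_{j+1} are x 0 < ... < x j.  The adjoined 0 encodes
   the convention sup(empty set) = 0, as ereal_sup set0 = -oo. *)
Definition zero_number_on (R : realType) (J : set R) (w : R -> R) : \bar R :=
  ereal_sup ([set 0%E] `|` [set (j%:R)%:E | j in [set j : nat |
    exists x : nat -> R,
      [/\ forall i, (i <= j)%N -> J (x i),
          forall i, (i < j)%N -> x i < x i.+1
        & forall i, (i < j)%N -> w (x i) * w (x i.+1) < 0]]]).

(* The profile r |-> w (r, 0, ..., 0), which satisfies
   w x = radial_profile w (enorm x) for radially symmetric w and 1 <= n. *)
Definition radial_profile (R : realType) (n : nat) (w : 'rV[R]_n -> R)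
    (r : R) : R :=
  w (\row_(i < n) if (i == 0 :> nat) then r else 0).

Definition zero_number (R : realType) (n : nat) (D : domain R)
    (w : 'rV[R]_n -> R) : \bar R :=
  zero_number_on (domain_radii D) (radial_profile w).

Definition class_K (R : realType) (n : nat) (D : domain R)
    (C1 C2 C3 C4 : R) (u v : 'rV[R]_n -> R) : Prop :=
  [/\ (zero_number D u <= C1%:E)%E,
      (zero_number D v <= C2%:E)%E,
      (zero_number D (u \- v)%R <= C3%:E)%E
    & (zero_number D (u \+ v)%R <= C4%:E)%E].

Definition class_Kstar (R : realType) (n : nat) (D : domain R)
    (C1 C2 C3 C4 : R) (u v : 'rV[R]_n -> R) : Prop :=
  [/\ class_K D C1 C2 C3 C4 u v,
      ~ (forall x, domain_set D x -> u x = v x)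
    & ~ (forall x, domain_set D x -> u x = - v x)].

Definition sup_norm (R : realType) (n : nat) (A : set 'rV[R]_n)
    (w : 'rV[R]_n -> R) : \bar R :=
  ereal_sup [set `|w x|%:E | x in A].

Definition pair_sup_norm (R : realType) (n : nat) (A : set 'rV[R]_n)
    (u v : 'rV[R]_n -> R) : \bar R :=
  maxe (sup_norm A u) (sup_norm A v).

(* Main.v *)
Require Import Defs.
From HB Require Import structures.
From mathcomp Require Import all_boot all_order all_algebra.
From mathcomp Require Import all_classical all_reals all_analysis.
From mathcomp Require Import ring lra.
Set Implicit Arguments.
Unset Strict Implicit.
Unset Printing Implicit Defensive.
Import Order.TTheory GRing.Theory Num.Theory.
Import numFieldNormedType.Exports.
Local Open Scope classical_set_scope.
Local Open Scope ring_scope.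

(** Write d = n - 1, p = 2q + 3, and f for the nonlinearity.  In the variable
    r = |x| a radial solution satisfies u'' + (d/r) u' = lambda u + gamma v - f,
    and the bound is proved by contradiction, by blowing up at a point where the
    solution is large.

    Blow-up.  If there is no bound, some sequence of solutions has size
    M_k -> oo at radii x_k.  On the length scale mu_k = M_k^-(q+1) the functions
    u_k / M_k, v_k / M_k are bounded and solve the same system up to terms of
    order mu_k^2.  They are passed to the limit pointwise along an ultrafilter
    on nat ([ultralimit_solves]): bounded sequences then always converge, and
    differentiability of the limit follows from the mean value theorem.  If
    x_k / mu_k stays bounded the functions are rescaled about the origin and
    the limit solves U'' + (d/s) U' = - f on (0,oo); otherwise they are rescaled
    about x_k, looking towards the origin, and the term with 1/s disappears.
    Since x_k maximizes u^2 + v^2 up to a smooth weight ([window_maximum]),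
    U U' + V V' vanishes at the end point s = 0 in the second case as well, so
    that a single Liouville theorem on the half-line covers both, and the
    boundary of the ball never enters the limit.

    Liouville theorem ([liouville]).  The bounds on the zero numbers survive in
    the limit, so U, V, U - V, U + V have constant sign near infinity, and by
    the symmetries of the system one may assume U >= V >= 0 there.  The
    Pohozaev function s^n E + n/(p+1) s^d (U U' + V V'), with E the energy, has
    derivative c s^d (U'^2 + V'^2), where c > 0 because p is subcritical.  It
    vanishes at 0, and it tends to 0 at infinity if U, V = O(s^(-1/(q+1))); in
    that case it is 0 everywhere, U and V are constant, hence zero.  The decay
    comes from Sturm comparison: if Y >= 0 and - Laplacian Y >= h Y, then
    h <= (pi/s)^2 somewhere in [s, 2s] unless Y vanishes there, and Y cannot
    drop by more than a factor 2 on [s, 2s], because s^(d/2) Y is concave when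
    n <= 3.  For beta > -1 this is applied to Y = U and h = c U^(2q+2).  For
    beta <= -1 it is applied to Y = U - V and h = U^(2q+2), and the subharmonic
    function V is controlled by the maximum principle, except when U = V on an
    interval.  In that case U = V everywhere, since U - V solves a linear
    equation with bounded coefficients, and then U = V is constant, and equal
    to zero unless beta = -1.

    Conclusion.  The limit is not zero, so beta_k -> -1 and (U, V) = (c, +-c)
    with c <> 0.  This is excluded if beta_k ranges over a compact set that
    avoids -1.  In the class K* the difference u_k -+ v_k is not identically
    zero and solves a linear equation whose potential is of order mu_k^-2 near
    the blow-up point; it changes sign as often as one likes ([oscillation]),
    against the bound on its zero number. *)

(** * Derivatives of real functions *)

Section Calculus.
Variable R : realType.
Implicit Types (f g : R -> R) (x y a b l : R).

Lemma is_derive1P f x l : is_derive x 1 f l <->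
  forall e, 0 < e -> exists2 d, 0 < d &
    forall h, `|h| < d -> `|f (x + h) - f x - l * h| <= e * `|h|.
Proof.
split=> [[df fl] e e0|H].
- have : (fun h => h^-1 *: ((f \o shift x) (h *: 1) - f x)) @ 0^' --> l.
    by rewrite -fl; exact: df.
  move=> /cvgrPdist_le /(_ e e0); rewrite near_withinE => /nbhs_ballP[d /= d0 dP].
  exists d => // h hd; have [->|h0] := eqVneq h 0.
    by rewrite addr0 subrr mulr0 subrr normr0 mulr0.
  have := dP h; rewrite /ball /= sub0r normrN => /(_ hd h0).
  rewrite /GRing.scale /= mulr1 (addrC h x) => H.
  have -> : f (x + h) - f x - l * h = - ((l - h^-1 * (f (x + h) - f x)) * h).
    by field.
  by rewrite normrN normrM ler_wpM2r.
- have C : (fun h => h^-1 *: ((f \o shift x) (h *: 1) - f x)) @ 0^' --> l.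
    apply/cvgrPdist_le => e e0; rewrite near_withinE; apply/nbhs_ballP.
    have [d d0 dP] := H e e0; exists d => //= h.
    rewrite /ball /= sub0r normrN /GRing.scale /= mulr1 (addrC h x) => hd h0.
    rewrite -(@ler_pM2r _ `|h|) ?normr_gt0// -normrM -normrN.
    have -> : - ((l - h^-1 * (f (x + h) - f x)) * h) = f (x + h) - f x - l * h.
      by field.
    exact: dP.
  by split; [apply/cvg_ex; exists l|exact: cvg_lim].
Qed.

Lemma is_derive1_ct f x l : is_derive x 1 f l ->
  forall e, 0 < e -> exists2 d, 0 < d & forall y, `|y - x| < d -> `|f y - f x| < e.
Proof.
move=> /is_derive1P /(_ 1 ltr01)[d d0 dP] e e0.
have k0 : 0 < 2 + `|l| by rewrite ltr_pwDl.
exists (Num.min d (e / (2 + `|l|))); first by rewrite lt_min d0 divr_gt0.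
move=> y; rewrite lt_min => /andP[/dP + yd].
rewrite subrKC mul1r => H.
have -> : f y - f x = (f y - f x - l * (y - x)) + l * (y - x) by ring.
apply: (le_lt_trans (ler_normD _ _)); rewrite normrM.
move: yd; rewrite ltr_pdivlMr// => yd.
have := normr_ge0 (y - x); nra.
Qed.

Lemma is_derive1_continuous f x l : is_derive x 1 f l -> {for x, continuous f}.
Proof.
move=> /is_derive1_ct H; apply/cvgrPdist_lt => e /H[d d0 dP].
apply/nbhs_ballP; exists d => //= y; rewrite /ball /= => xy.
by rewrite distrC; apply: dP; rewrite distrC.
Qed.

Lemma mvt f (df : R -> R) a b : a < b ->
  (forall x, a <= x <= b -> is_derive x 1 f (df x)) ->
  exists2 c, a < c < b & f b - f a = df c * (b - a).
Proof.
move=> ab H.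
have [x||c] := @MVT R f df a b ab; last by rewrite in_itv /= => ? ?; exists c.
- by rewrite in_itv /= => /andP[? ?]; apply: H; rewrite !ltW.
- apply: derivable_within_continuous => x; rewrite in_itv /= => /H.
  by case.
Qed.

Lemma der_ndecr f (df : R -> R) a b : a <= b ->
  (forall x, a <= x <= b -> is_derive x 1 f (df x)) ->
  (forall x, a < x < b -> 0 <= df x) -> f a <= f b.
Proof.
rewrite le_eqVlt => /predU1P[->//|ab] H H0.
have [c cab] := mvt ab H; rewrite -subr_ge0 => ->.
by rewrite mulr_ge0 ?H0// subr_ge0 ltW.
Qed.

Lemma der_nincr f (df : R -> R) a b : a <= b ->
  (forall x, a <= x <= b -> is_derive x 1 f (df x)) ->
  (forall x, a < x < b -> df x <= 0) -> f b <= f a.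
Proof.
rewrite le_eqVlt => /predU1P[->//|ab] H H0.
have [c cab] := mvt ab H; rewrite -subr_le0 => ->.
by rewrite mulr_le0_ge0 ?H0// subr_ge0 ltW.
Qed.

Lemma der_lip f (df : R -> R) a b k : a <= b ->
  (forall x, a <= x <= b -> is_derive x 1 f (df x)) ->
  (forall x, a < x < b -> `|df x| <= k) -> `|f b - f a| <= k * (b - a).
Proof.
rewrite le_eqVlt => /predU1P[->|ab] H H0.
  by rewrite !subrr normr0 mulr0.
have [c cab ->] := mvt ab H.
rewrite normrM (@ger0_norm _ (b - a)) ?subr_ge0; last exact: ltW.
by rewrite ler_wpM2r ?H0// subr_ge0 ltW.
Qed.

Lemma der_lip_itv f (df : R -> R) a b k x y :
  (forall z, a <= z <= b -> is_derive z 1 f (df z)) ->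
  (forall z, a <= z <= b -> `|df z| <= k) ->
  a <= x <= b -> a <= y <= b -> `|f x - f y| <= k * `|x - y|.
Proof.
move=> D K; wlog xy : x y / x <= y => [H xab yab|].
  by have [/H|/ltW/H] := leP x y; [exact|rewrite distrC (distrC y); exact].
move=> /andP[ax _] /andP[_ yb].
have sub z : x <= z <= y -> a <= z <= b.
  by move=> /andP[xz zy]; rewrite (le_trans ax xz) (le_trans zy yb).
rewrite distrC (distrC x) (@ger0_norm _ (y - x)) ?subr_ge0//.
apply: (der_lip xy (df := df)) => z; first by move=> /sub/D.
by move=> /andP[/ltW xz /ltW zy]; rewrite K// sub// xz.
Qed.

Lemma der_lip_ball f (df : R -> R) (s t k : R) :
  (forall z, `|z - s| <= `|t - s| -> is_derive z 1 f (df z)) ->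
  (forall z, `|z - s| <= `|t - s| -> `|df z| <= k) ->
  `|f t - f s| <= k * `|t - s|.
Proof.
move=> D K; apply: (@der_lip_itv f df (s - `|t - s|) (s + `|t - s|)).
- by move=> z; rewrite -ler_distl; exact: D.
- by move=> z; rewrite -ler_distl; exact: K.
- by rewrite -ler_distl.
- by rewrite -ler_distl subrr normr0.
Qed.

Lemma der_eq f x l l' : is_derive x 1 f l -> l = l' -> is_derive x 1 f l'.
Proof. by move=> H <-. Qed.

Lemma derD f g x l m : is_derive x 1 f l -> is_derive x 1 g m ->
  is_derive x 1 (fun t => f t + g t) (l + m).
Proof. by move=> *; exact: is_deriveD. Qed.

Lemma derB f g x l m : is_derive x 1 f l -> is_derive x 1 g m ->
  is_derive x 1 (fun t => f t - g t) (l - m).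
Proof. by move=> *; exact: is_deriveB. Qed.

Lemma derN f x l : is_derive x 1 f l -> is_derive x 1 (fun t => - f t) (- l).
Proof. by move=> *; exact: is_deriveN. Qed.

Lemma derM f g x l m : is_derive x 1 f l -> is_derive x 1 g m ->
  is_derive x 1 (fun t => f t * g t) (l * g x + f x * m).
Proof.
move=> fl gm; apply: (der_eq (@is_deriveM _ _ f g x 1 l m fl gm)).
by rewrite /GRing.scale /= addrC mulrC.
Qed.

Lemma derC x c : is_derive x 1 (fun=> c) (0 : R).
Proof. exact: is_derive_cst. Qed.

Lemma derI x : is_derive x 1 (fun t : R => t) (1 : R).
Proof. exact: is_derive_id. Qed.

Lemma derZ f x l c : is_derive x 1 f l -> is_derive x 1 (fun t => c * f t) (c * l).
Proof. by move=> *; exact: is_deriveZ. Qed.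

Lemma derX f x l n : is_derive x 1 f l ->
  is_derive x 1 (fun t => f t ^+ n) (n%:R * f x ^+ n.-1 * l).
Proof.
move=> H; elim: n => [|n IH].
  by rewrite !mul0r; apply: derC.
have -> : (fun t => f t ^+ n.+1) = (fun t => f t * f t ^+ n).
  by apply/funext => t; rewrite exprS.
apply: (der_eq (derM H IH)).
case: n IH => [|n] IH; first by rewrite /=; ring.
by rewrite /= !exprS -[n.+2%:R]natr1; ring.
Qed.

Lemma der_comp f g x l m : is_derive x 1 g m -> is_derive (g x) 1 f l ->
  is_derive x 1 (fun t => f (g t)) (l * m).
Proof.
move=> gm fl; apply: (der_eq (@is_derive1_comp R f g x l m fl gm)).
by [].
Qed.

(** Only the values near the point matter; this is how a relation that holds
    on an interval is differentiated. *)
Lemma der_near f g x l : (exists2 d, 0 < d & forall y, `|y - x| < d -> f y = g y) ->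
  is_derive x 1 f l -> is_derive x 1 g l.
Proof.
move=> [d d0 dP] /is_derive1P H; apply/is_derive1P => e /H[d' d'0 H'].
exists (Num.min d d'); first by rewrite lt_min d0.
move=> h; rewrite lt_min => /andP[h1 h2]; rewrite -!dP ?H'//.
  by rewrite subrr normr0.
by rewrite addrAC subrr add0r.
Qed.

Lemma der_uniq f x l m : is_derive x 1 f l -> is_derive x 1 f m -> l = m.
Proof. by move=> [_ <-] [_ <-]. Qed.

Lemma der_cst f a b : a <= b -> (forall x, a <= x <= b -> is_derive x 1 f 0) ->
  f a = f b.
Proof.
move=> ab H; apply/le_anti/andP; split.
  by apply: (der_ndecr ab H) => *; rewrite lexx.
by apply: (der_nincr ab H) => *; rewrite lexx.
Qed.

End Calculus.

(** * Powers and the nonlinearity *)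

Section Powers.
Variable R : realType.
Implicit Types (a b c x y s t m q beta : R).

Lemma powRS x s : 0 <= x -> -1 < s -> x `^ s * x = x `^ (s + 1).
Proof.
move=> x0 s1; rewrite -(@mulr_powRB1 _ x (s + 1))//; last by lra.
by rewrite addrK mulrC.
Qed.

(** The exponent s + 2 > 0 makes both sides vanish at x = 0, whatever 0 to
    the power s is. *)
Lemma powRS2 x s : -2 < s -> `|x| `^ (s + 2) = `|x| `^ s * x ^+ 2.
Proof.
move=> s2; rewrite powRD; last by apply/implyP => /eqP; lra.
by rewrite (powR_mulrn 2) // real_normK// num_real.
Qed.

Lemma ler_powRl s x y : 0 <= s -> 0 <= x -> x <= y -> x `^ s <= y `^ s.
Proof.
by move=> s0 x0 xy; apply: ge0_ler_powR => //; rewrite nnegrE// (le_trans x0).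
Qed.

Lemma ltr_powRl s x y : 0 < s -> 0 <= x -> x < y -> x `^ s < y `^ s.
Proof.
by move=> s0 x0 xy; apply: gt0_ltr_powR => //; rewrite nnegrE// (le_trans x0)// ltW.
Qed.

Lemma powR_small s e : 0 < s -> 0 < e -> exists2 d, 0 < d &
  forall x, 0 <= x -> x < d -> x `^ s < e.
Proof.
move=> s0 e0; exists (e `^ s^-1); first exact: powR_gt0.
move=> x x0 xd; have := ltr_powRl s0 x0 xd.
by rewrite -powRrM mulVf ?gt_eqF// powRr1// ltW.
Qed.

(** Differentiability at 0 uses s > 1: the quotient is |h|^(s-1) up to sign. *)
Lemma is_derive_normpow s x : 1 < s ->
  is_derive x 1 (fun t => `|t| `^ s) (s * (`|x| `^ (s - 2) * x)).
Proof.
move=> s1; have [x0|x0|->] := ltgtP x 0.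
- apply: (@der_near _ (fun t => (- t) `^ s)).
    exists (- x); first by rewrite oppr_gt0.
    move=> y yx; rewrite ltr0_norm//.
    by move: yx; rewrite ltr_norml; lra.
  apply: (der_eq (der_comp (derN (derI x)) (is_derive1_powR s _))).
    by rewrite oppr_gt0.
  rewrite ltr0_norm// (_ : s - 1 = s - 2 + 1); last by ring.
  rewrite -[(- x) `^ (s - 2 + 1)]powRS; [by ring|lra|lra].
- apply: (@der_near _ (fun t => t `^ s)).
    exists x => // y yx; rewrite gtr0_norm//.
    by move: yx; rewrite ltr_norml; lra.
  apply: (der_eq (is_derive1_powR s x0)).
  rewrite gtr0_norm// (_ : s - 1 = s - 2 + 1); last by ring.
  by rewrite powRS//; lra.
- rewrite !mulr0; apply/is_derive1P => e e0.
  have s10 : 0 < s - 1 by rewrite subr_gt0.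
  have [d d0 dP] := powR_small s10 e0.
  exists d; first exact: d0.
  move=> h hd; rewrite add0r mul0r subr0 normr0 powR0 ?subr0; last by lra.
  rewrite ger0_norm ?powR_ge0// -(@mulr_powRB1 _ `|h| s)//; last by lra.
  by rewrite mulrC ler_wpM2r// ltW// dP.
Qed.

Lemma is_derive_spow s x : 0 < s ->
  is_derive x 1 (fun t => `|t| `^ s * t) ((s + 1) * `|x| `^ s).
Proof.
move=> s0; have [x0|x0|->] := ltgtP x 0.
- apply: (@der_near _ (fun t => (- t) `^ s * t)).
    exists (- x); first by rewrite oppr_gt0.
    move=> y yx; rewrite ltr0_norm//.
    by move: yx; rewrite ltr_norml; lra.
  apply: (der_eq (derM (der_comp (derN (derI x)) (is_derive1_powR s _)) (derI x))).
    by rewrite oppr_gt0.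
  rewrite ltr0_norm// -[(- x) `^ s in RHS](@mulr_powRB1 _ (- x) s)//; last by lra.
  rewrite -[(- x) `^ s in LHS](@mulr_powRB1 _ (- x) s)//; last by lra.
  by ring.
- apply: (@der_near _ (fun t => t `^ s * t)).
    exists x => // y yx; rewrite gtr0_norm//.
    by move: yx; rewrite ltr_norml; lra.
  apply: (der_eq (derM (is_derive1_powR s x0) (derI x))).
  rewrite gtr0_norm// -[x `^ s in RHS](@mulr_powRB1 _ x s)//; last by lra.
  rewrite -[x `^ s in LHS](@mulr_powRB1 _ x s)//; last by lra.
  by ring.
- rewrite normr0 powR0 ?mulr0; last by lra.
  apply/is_derive1P => e e0.
  have [d d0 dP] := @powR_small s e s0 e0.
  exists d; first exact: d0.
  move=> h hd; rewrite add0r mul0r mulr0 !subr0 normrM ger0_norm ?powR_ge0//.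
  by rewrite ler_wpM2r// ltW// dP.
Qed.

Lemma continuous_normpow s : 0 < s -> continuous (fun t => `|t| `^ s).
Proof.
move=> s0 x; have [->|x0] := eqVneq x 0.
  apply/cvgrPdist_lt => e e0.
  have [d d0 dP] := @powR_small s e s0 e0.
  apply/nbhs_ballP; exists d => //= y; rewrite /ball /= sub0r normrN => yd.
  rewrite normr0 powR0; last by lra.
  by rewrite sub0r normrN (@ger0_norm _ (`|y| `^ s)) ?powR_ge0// dP.
apply: (@cvg_comp _ _ _ (fun t => `|t|) (fun t => t `^ s) _ (nbhs `|x|)).
  by apply: cvg_norm; exact: cvg_id.
have xp : 0 < `|x| by rewrite normr_gt0.
exact: (is_derive1_continuous (is_derive1_powR s xp)).
Qed.

Lemma continuous_spow s : -1 < s -> continuous (fun t => `|t| `^ s * t).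
Proof.
move=> s1 x; have [->|x0] := eqVneq x 0.
  apply/cvgrPdist_lt => e e0.
  have s10 : 0 < s + 1 by lra.
  have [d d0 dP] := powR_small s10 e0.
  apply/nbhs_ballP; exists d; first exact: d0.
  move=> y; rewrite /ball /= sub0r normrN => yd.
  rewrite mulr0 sub0r normrN normrM ger0_norm ?powR_ge0// powRS//.
  exact: dP.
apply: (@continuousM _ _ (fun t => `|t| `^ s) id); last exact: cvg_id.
apply: (@cvg_comp _ _ _ (fun t => `|t|) (fun t => t `^ s) _ (nbhs `|x|)).
  by apply: cvg_norm; exact: cvg_id.
have xp : 0 < `|x| by rewrite normr_gt0.
exact: (is_derive1_continuous (is_derive1_powR s xp)).
Qed.

End Powers.

Section Nonlinearity.
Variables (R : realType) (q : R).
Implicit Types (a b u v x m beta : R).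

Local Notation f := (nonlinearity q).

Lemma nonlinearityNl beta a b : f beta (- a) b = - f beta a b.
Proof. by rewrite /nonlinearity normrN; ring. Qed.

Lemma nonlinearityNr beta a b : f beta a (- b) = f beta a b.
Proof. by rewrite /nonlinearity normrN; ring. Qed.

Lemma nonlinearityE (hq : -1 < q) beta a b : 0 <= a -> 0 <= b ->
  f beta a b = a `^ (q + 1) * (a `^ (q + 2) + beta * b `^ (q + 2)).
Proof.
move=> a0 b0; rewrite /nonlinearity !ger0_norm//.
rewrite powRS//; last by lra.
have -> : 2 * q + 2 + 1 = (q + 1) + (q + 2) by ring.
rewrite powRD; last by apply/implyP => /eqP; lra.
by rewrite -mulrA powRS//; ring.
Qed.

Lemma nonlinearity_homog beta k a b : 0 < k ->
  f beta (k * a) (k * b) = k `^ (2 * q + 2) * k * f beta a b.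
Proof.
move=> k0; rewrite /nonlinearity !normrM !(gtr0_norm k0).
rewrite !powRM ?(ltW k0)//.
have -> : k `^ (2 * q + 2) = k `^ (q + 2) * k `^ q.
  rewrite -powRD; first by congr (_ `^ _); ring.
  by rewrite (gt_eqF k0) implybT.
by ring.
Qed.

Lemma norm_spow s a : -1 < s -> `| `|a| `^ s * a| = `|a| `^ (s + 1).
Proof. by move=> s1; rewrite normrM ger0_norm ?powR_ge0// powRS. Qed.

Lemma nonlinearity_bound (hq : -1 < q) beta a b m : `|a| <= m -> `|b| <= m ->
  `|f beta a b| <= (1 + `|beta|) * m `^ (2 * q + 3).
Proof.
move=> am bm; have m0 : 0 <= m by rewrite (le_trans _ am).
rewrite /nonlinearity -!mulrA (mulrDl 1 `|beta|) mul1r.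
apply: (le_trans (ler_normD _ _)); rewrite norm_spow; last by lra.
have -> : 2 * q + 2 + 1 = 2 * q + 3 by ring.
apply: lerD; first by apply: ler_powRl => //; lra.
rewrite normrM ler_wpM2l// normrM norm_spow// ger0_norm ?powR_ge0//.
have -> : 2 * q + 3 = (q + 2) + (q + 1) by ring.
rewrite (@powRD _ m); last by apply/implyP => /eqP; lra.
by apply: ler_pM; rewrite ?powR_ge0//; apply: ler_powRl => //; lra.
Qed.

Definition gpow a := `|a| `^ (2 * q + 2) * a.

Lemma gpow_mono (hq : -1 < q) a b : a <= b -> gpow a <= gpow b.
Proof.
move=> ab; apply: (der_ndecr (df := fun x => (2 * q + 2 + 1) * `|x| `^ (2 * q + 2)) ab).
  by move=> x _; apply: is_derive_spow; lra.
by move=> x _; rewrite mulr_ge0 ?powR_ge0//; lra.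
Qed.

Lemma gpow_lip (hq : -1 < q) a b m : `|a| <= m -> `|b| <= m ->
  `|gpow a - gpow b| <= (2 * q + 3) * m `^ (2 * q + 2) * `|a - b|.
Proof.
wlog ab : a b / b <= a.
  move=> H am bm; have [/H|/ltW/H] := leP b a; first exact.
  by rewrite distrC (distrC b a); apply.
move=> am bm; rewrite (@ger0_norm _ (a - b)) ?subr_ge0//.
apply: (der_lip (df := fun x => (2 * q + 2 + 1) * `|x| `^ (2 * q + 2)) ab).
  by move=> x _; apply: is_derive_spow; lra.
move=> x /andP[bx xa]; rewrite normrM (@ger0_norm _ (_ `^ _)) ?powR_ge0//.
rewrite ger0_norm; last by lra.
have -> : 2 * q + 2 + 1 = 2 * q + 3 by ring.
rewrite ler_wpM2l//; first by lra.
apply: ler_powRl => //; first by lra.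
by move: am bm; rewrite !ler_norml; lra.
Qed.

(** The coupling terms combine into a multiple of u - v whose coefficient
    stays bounded even for q < 0; hence u - v solves a linear equation although
    the system itself need not be Lipschitz. *)
Lemma nonlinearity_diff (hq : -1 < q) beta u v :
  f beta u v - f beta v u =
  gpow u - gpow v - beta * (`|u * v| `^ q * (u * v)) * (u - v).
Proof.
rewrite /nonlinearity /gpow -!mulrA (powRS2 u (s := q)) ?(powRS2 v (s := q)); [|lra|lra].
by rewrite normrM powRM//; ring.
Qed.

Lemma nonlinearity_diff_bound (hq : -1 < q) beta u v m : `|u| <= m -> `|v| <= m ->
  `|f beta u v - f beta v u| <=
  ((2 * q + 3) * m `^ (2 * q + 2) + `|beta| * (m * m) `^ (q + 1)) * `|u - v|.
Proof.
move=> um vm; rewrite (nonlinearity_diff hq).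
apply: (le_trans (ler_normB _ _)); rewrite mulrDl lerD ?(gpow_lip hq)//.
rewrite 2!normrM norm_spow// ler_wpM2r// ler_wpM2l//.
apply: ler_powRl => //; first by lra.
by rewrite normrM; apply: ler_pM.
Qed.

(** The nonlinearity is the gradient of this function, which is homogeneous of
    degree 2q + 4. *)
Definition potential beta a b :=
  (`|a| `^ (2 * q + 4) + `|b| `^ (2 * q + 4)) / (2 * q + 4)
  + beta / (q + 2) * (`|a| `^ (q + 2) * `|b| `^ (q + 2)).

Lemma is_derive_potential (hq : -1 < q) beta (U V : R -> R) x u1 v1 :
  is_derive x 1 U u1 -> is_derive x 1 V v1 ->
  is_derive x 1 (fun t => potential beta (U t) (V t))
    (f beta (U x) (V x) * u1 + f beta (V x) (U x) * v1).
Proof.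
move=> HU HV; rewrite /potential.
have dp s W w : 1 < s -> is_derive x 1 W w ->
    is_derive x 1 (fun t => `|W t| `^ s) (s * (`|W x| `^ (s - 2) * W x) * w).
  by move=> s1 H; exact: (der_comp H (is_derive_normpow _ s1)).
have h4 : 1 < 2 * q + 4 by lra.
have h2 : 1 < q + 2 by lra.
have D1 := derZ (2 * q + 4)^-1 (derD (dp _ _ _ h4 HU) (dp _ _ _ h4 HV)).
have D2 := derZ (beta / (q + 2)) (derM (dp _ _ _ h2 HU) (dp _ _ _ h2 HV)).
have -> : (fun t => (`|U t| `^ (2 * q + 4) + `|V t| `^ (2 * q + 4)) / (2 * q + 4)
  + beta / (q + 2) * (`|U t| `^ (q + 2) * `|V t| `^ (q + 2)))
  = (fun t => (2 * q + 4)^-1 * (`|U t| `^ (2 * q + 4) + `|V t| `^ (2 * q + 4))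
  + beta / (q + 2) * (`|U t| `^ (q + 2) * `|V t| `^ (q + 2))).
  by apply/funext => t; ring.
apply: (der_eq (derD D1 D2)).
rewrite /nonlinearity.
have -> : 2 * q + 4 - 2 = 2 * q + 2 by ring.
have -> : q + 2 - 2 = q by ring.
by field; apply/andP; split; lra.
Qed.

Lemma potential_euler (hq : -1 < q) beta a b :
  f beta a b * a + f beta b a * b = (2 * q + 4) * potential beta a b.
Proof.
rewrite /nonlinearity /potential.
have h s x : -2 < s -> `|x| `^ (s + 2) = `|x| `^ s * x * x.
  by move=> ?; rewrite powRS2//; ring.
have -> : 2 * q + 4 = 2 * q + 2 + 2 by ring.
rewrite !(h (2 * q + 2)); [|lra|lra].
rewrite !(h q); [|lra|lra].
by field; apply/andP; split; lra.
Qed.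

Lemma potential_bound (hq : -1 < q) beta a b m : `|a| <= m -> `|b| <= m ->
  `|potential beta a b| <= (1 + `|beta|) * m `^ (2 * q + 4).
Proof.
move=> am bm; have m0 : 0 <= m by rewrite (le_trans _ am).
have -> : potential beta a b =
    (f beta a b * a + f beta b a * b) / (2 * q + 4).
  by rewrite (potential_euler hq); field; lra.
rewrite normrM [X in _ * X]ger0_norm ?invr_ge0; last by lra.
rewrite ler_pdivrMr; last by lra.
apply: (le_trans (ler_normD _ _)); rewrite !normrM.
have -> : 2 * q + 4 = 2 * q + 3 + 1 by ring.
rewrite -(powRS m0); last by lra.
have h1 := ler_pM (normr_ge0 _) (normr_ge0 _) (nonlinearity_bound hq beta am bm) am.
have h2 := ler_pM (normr_ge0 _) (normr_ge0 _) (nonlinearity_bound hq beta bm am) bm.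
apply: (le_trans (lerD h1 h2)).
set K := _ * _ `^ _.
have -> : (1 + `|beta|) * (m `^ (2 * q + 3) * m) = K * m by rewrite /K; ring.
have K0 : 0 <= K * m by rewrite !mulr_ge0 ?addr_ge0 ?powR_ge0.
by nra.
Qed.

Lemma nonlinearity_continuous (hq : -1 < q) beta a b e : 0 < e -> exists2 d, 0 < d &
  forall beta' a' b', `|beta' - beta| < d -> `|a' - a| < d -> `|b' - b| < d ->
  `|f beta' a' b' - f beta a b| < e.
Proof.
move=> e0.
have C : {for (beta, (a, b)), continuous
    (fun z : R * (R * R) => f z.1 z.2.1 z.2.2)}.
  have c1 : {for (beta, (a, b)), continuous (fun z : R * (R * R) => z.1)}.
    exact: cvg_fst.
  have c2 : {for (beta, (a, b)), continuous (fun z : R * (R * R) => z.2.1)}.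
    by apply: cvg_comp; [exact: cvg_snd|exact: cvg_fst].
  have c3 : {for (beta, (a, b)), continuous (fun z : R * (R * R) => z.2.2)}.
    by apply: cvg_comp; [exact: cvg_snd|exact: cvg_snd].
  have -> : (fun z : R * (R * R) => f z.1 z.2.1 z.2.2) = (fun z =>
    (fun t => `|t| `^ (2 * q + 2) * t) z.2.1 + z.1 *
     ((fun t => `|t| `^ (q + 2)) z.2.2 * (fun t => `|t| `^ q * t) z.2.1)).
    by apply/funext => z; rewrite /nonlinearity; ring.
  have k1 : -1 < 2 * q + 2 by lra.
  have k2 : 0 < q + 2 by lra.
  have g1 := continuous_comp c2 (continuous_spow k1 (x := a)).
  have g2 := continuous_comp c3 (continuous_normpow k2 (x := b)).
  have g3 := continuous_comp c2 (continuous_spow hq (x := a)).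
  exact: (continuousD g1 (continuousM c1 (continuousM g2 g3))).
move/cvgrPdist_lt : C => /(_ e e0) /nbhs_ballP[d /= d0 dP].
exists d => // beta' a' b' h1 h2 h3; rewrite distrC.
by apply: (dP (beta', (a', b'))); do ?split; rewrite /ball /= distrC.
Qed.

End Nonlinearity.

(** * Uniqueness and Sturm comparison for second order equations *)

Section SecondOrder.
Variable R : realType.
Implicit Types (a b d k x : R).

(** Gronwall: y^2 + y1^2 is multiplied by at most exp (K |x - x0|). *)
Lemma ode_unique (y y1 y2 : R -> R) a b x0 k : 0 <= k -> a <= x0 <= b ->
  (forall x, a <= x <= b -> is_derive x 1 y (y1 x)) ->
  (forall x, a <= x <= b -> is_derive x 1 y1 (y2 x)) ->
  (forall x, a <= x <= b -> `|y2 x| <= k * (`|y x| + `|y1 x|)) ->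
  y x0 = 0 -> y1 x0 = 0 -> forall x, a <= x <= b -> y x = 0.
Proof.
move=> k0 /andP[ax0 x0b] D1 D2 H y0 y10.
pose e x := y x ^+ 2 + y1 x ^+ 2.
pose K : R := 1 + 3 * k.
have De x : a <= x <= b -> is_derive x 1 e (2 * y x * y1 x + 2 * y1 x * y2 x).
  move=> xab; apply: (der_eq (derD (derX 2 (D1 _ xab)) (derX 2 (D2 _ xab)))).
  by rewrite /= !expr1.
have bnd x : a <= x <= b -> `|2 * y x * y1 x + 2 * y1 x * y2 x| <= K * e x.
  move=> /H Hx; apply: (le_trans (ler_normD _ _)); rewrite !normrM normr_nat.
  rewrite /e -(real_normK (num_real (y x))) -(real_normK (num_real (y1 x))).
  have := normr_ge0 (y x); have := normr_ge0 (y1 x); move: Hx.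
  move: `|y x| `|y1 x| `|y2 x| => p q r Hr q0 p0.
  have h1 : 2 * q * r <= 2 * q * (k * (p + q)) by rewrite ler_wpM2l// mulr_ge0.
  have h2 : 2 * p * q <= p ^+ 2 + q ^+ 2 by have := sqr_ge0 (p - q); nra.
  have h3 : k * (2 * p * q) <= k * (p ^+ 2 + q ^+ 2) by rewrite ler_wpM2l.
  have h4 : 0 <= k * p ^+ 2 by rewrite mulr_ge0// sqr_ge0.
  by rewrite /K; nra.
have Dx (c x : R) : is_derive x 1 (fun t => expR (c * t)) (expR (c * x) * c).
  by apply: (der_eq (der_comp (derZ c (derI x)) (is_derive_expR _))); rewrite mulr1.
have De2 c x : a <= x <= b -> is_derive x 1 (fun t => e t * expR (c * t))
    ((2 * y x * y1 x + 2 * y1 x * y2 x + c * e x) * expR (c * x)).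
  by move=> xab; apply: (der_eq (derM (De _ xab) (Dx c x))); ring.
have e0 : e x0 = 0 by rewrite /e y0 y10 expr0n addr0.
have ege0 x : 0 <= e x by rewrite addr_ge0// sqr_ge0.
suff H0 x : a <= x <= b -> e x <= 0.
  move=> x xab; have /eqP : e x = 0 by apply/le_anti; rewrite H0//= ege0.
  by rewrite paddr_eq0 ?sqr_ge0// sqrf_eq0 => /andP[/eqP].
move=> /andP[ax xb]; have [xx0|x0x] := leP x x0.
- have : e x * expR (K * x) <= e x0 * expR (K * x0).
    apply: (der_ndecr xx0 (fun t tx => De2 K t _)) => t /andP[h1 h2].
      by rewrite (le_trans ax)//= (le_trans h2).
    rewrite mulr_ge0 ?expR_ge0//.
    have /bnd : a <= t <= b by rewrite (le_trans ax (ltW h1)) (le_trans (ltW h2)).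
    by rewrite ler_norml => /andP[]; lra.
  by rewrite e0 mul0r pmulr_lle0 ?expR_gt0.
- have : e x * expR (- K * x) <= e x0 * expR (- K * x0).
    apply: (der_nincr (ltW x0x) (fun t tx => De2 (- K) t _)) => t /andP[h1 h2].
      by rewrite (le_trans ax0)//= (le_trans h2).
    rewrite mulr_le0_ge0 ?expR_ge0//.
    have /bnd : a <= t <= b by rewrite (le_trans ax0 (ltW h1)) (le_trans (ltW h2)).
    by rewrite ler_norml => /andP[]; lra.
  by rewrite e0 mul0r pmulr_lle0 ?expR_gt0.
Qed.

Lemma radial_ode_unique (n : nat) (w w1 w2 : R -> R) a b x0 K : 0 < a ->
  a <= x0 <= b -> 0 <= K ->
  (forall t, a <= t <= b -> is_derive t 1 w (w1 t)) ->
  (forall t, a <= t <= b -> is_derive t 1 w1 (w2 t)) ->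
  (forall t, a <= t <= b -> `|w2 t + n%:R / t * w1 t| <= K * `|w t|) ->
  w x0 = 0 -> w1 x0 = 0 -> forall t, a <= t <= b -> w t = 0.
Proof.
move=> a0 x0ab K0 D1 D2 H; have na : 0 <= n%:R / a by rewrite divr_ge0// ltW.
apply: (ode_unique (addr_ge0 na K0) x0ab D1 D2) => t tab.
have t0 : 0 < t by case/andP: tab => [at_ _]; rewrite (lt_le_trans a0).
rewrite -(addrK (n%:R / t * w1 t) (w2 t)); apply: (le_trans (ler_normB _ _)).
rewrite mulrDl addrC; apply: lerD.
  rewrite normrM ger0_norm ?divr_ge0 ?(ltW t0)//; apply: ler_pM => //.
  - by rewrite divr_ge0// ltW.
  - by rewrite ler_wpM2l// lef_pV2 ?posrE//; case/andP: tab.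
  - by rewrite lerDr.
by apply: (le_trans (H _ tab)); rewrite ler_wpM2l// lerDl.
Qed.

(** With S = sin (k (x - a)), the Wronskian y' S - y S' is nonincreasing on
    [a, a + pi/k], while its values at the ends are - k y(a) <= 0 and
    k y(b) >= 0. *)
Lemma sturm (y y1 y2 h : R -> R) a k : 0 < k ->
  let b := a + pi / k in
  (forall x, a <= x <= b -> is_derive x 1 y (y1 x)) ->
  (forall x, a <= x <= b -> is_derive x 1 y1 (y2 x)) ->
  (forall x, a <= x <= b -> 0 <= y x) ->
  (forall x, a <= x <= b -> k ^+ 2 < h x) ->
  (forall x, a <= x <= b -> y2 x <= - (h x * y x)) ->
  forall x, a <= x <= b -> y x = 0.
Proof.
move=> k0 b D1 D2 y0 hk H.
have ab : a < b by rewrite ltrDl divr_gt0// pi_gt0.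
pose G x := y1 x * sin (k * (x - a)) - k * (y x * cos (k * (x - a))).
pose G1 x := (y2 x + k ^+ 2 * y x) * sin (k * (x - a)).
have DG x : a <= x <= b -> is_derive x 1 G (G1 x).
  move=> xab.
  have Da : is_derive x 1 (fun t : R => k * (t - a)) k.
    by apply: (der_eq (derZ k (derB (derI x) (derC x a)))); ring.
  have Ds := der_comp Da (is_derive_sin (k * (x - a))).
  have Dc := der_comp Da (is_derive_cos (k * (x - a))).
  apply: (der_eq (derB (derM (D2 _ xab) Ds) (derZ k (derM (D1 _ xab) Dc)))).
  by rewrite /G1; ring.
have sn x : a < x < b -> 0 < sin (k * (x - a)).
  move=> /andP[ax xb]; apply: sin_gt0_pi; apply/andP; split.
    by rewrite mulr_gt0// subr_gt0.
  by rewrite mulrC -ltr_pdivlMr// ltrBlDl.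
have G1le x : a < x < b -> G1 x <= 0.
  move=> xab; have /andP[ax xb] := xab.
  have xab' : a <= x <= b by rewrite !ltW.
  rewrite mulr_le0_ge0// ?(ltW (sn _ _))//.
  by have := H _ xab'; have := y0 _ xab'; have := hk _ xab'; nra.
have Gm u v : a <= u -> u <= v -> v <= b -> G v <= G u.
  move=> au uv vb; apply: (der_nincr uv (df := G1)) => x /andP[ux xv].
    by apply: DG; rewrite (le_trans au)//= (le_trans xv).
  by apply: G1le; rewrite (le_lt_trans au)//= (lt_le_trans xv).
have Ga : G a = - (k * y a).
  by rewrite /G subrr mulr0 sin0 cos0; ring.
have Gb : G b = k * y b.
  rewrite /G (_ : k * (b - a) = pi); last by rewrite /b; field; rewrite gt_eqF.
  by rewrite sinpi cospi; ring.
have [ya yb] : y a = 0 /\ y b = 0.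
  have aab : a <= a <= b by rewrite lexx ltW.
  have bab : a <= b <= b by rewrite lexx ltW.
  have := Gm a b (lexx _) (ltW ab) (lexx _).
  rewrite Ga Gb; have := y0 _ aab; have := y0 _ bab => h1 h2 h3.
  by split; nra.
have G0 x : a <= x <= b -> G x = 0.
  move=> /andP[ax xb]; apply/le_anti/andP; split.
    by have := Gm a x (lexx _) ax xb; rewrite Ga ya mulr0 oppr0.
  by have := Gm x b ax xb (lexx _); rewrite Gb yb mulr0.
move=> x /andP[]; rewrite le_eqVlt => /predU1P[<- _ //|ax].
rewrite le_eqVlt => /predU1P[-> //|xb].
have xab : a <= x <= b by rewrite !ltW.
have /(der_uniq (DG _ xab)) : is_derive x 1 G 0.
  apply: (der_near _ (derC x 0)).
  exists (Num.min (x - a) (b - x)); first by rewrite lt_min !subr_gt0 ax.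
  move=> t; rewrite lt_min !ltr_norml => /andP[h1 h2].
  by rewrite G0//; apply/andP; split; lra.
rewrite /G1 => /eqP; rewrite mulf_eq0 (gt_eqF (sn _ _)) ?ax ?xb// orbF => /eqP h0.
have := H _ xab; have := y0 _ xab; have := hk _ xab => h1 h2 h3.
by apply/le_anti/andP; split; nra.
Qed.

(** The substitution y = x^(d/2) Y removes the first order term of the radial
    Laplacian and adds the potential - (d/2) (d/2 - 1) / x^2, which is
    nonnegative for 0 <= d <= 2. *)
Section Radial.
Variables (d : R) (Y Y1 Y2 : R -> R).

Definition weighted x := x `^ (d / 2) * Y x.
Definition weighted1 x := x `^ (d / 2) * (Y1 x + d / 2 / x * Y x).
Definition weighted2 x := x `^ (d / 2) *
  (Y2 x + d / x * Y1 x + d / 2 * (d / 2 - 1) / x ^+ 2 * Y x).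

Lemma is_derive_weight x : 0 < x ->
  is_derive x 1 (fun t => t `^ (d / 2)) (x `^ (d / 2) * (d / 2 / x)).
Proof.
move=> x0; apply: (der_eq (is_derive1_powR _ x0)).
rewrite powRB ?powRr1 ?(ltW x0)//; first by field; rewrite gt_eqF.
by rewrite (gt_eqF x0) implybT.
Qed.

Lemma is_derive_weighted x : 0 < x -> is_derive x 1 Y (Y1 x) ->
  is_derive x 1 weighted (weighted1 x).
Proof.
move=> x0 D1; apply: (der_eq (derM (is_derive_weight x0) D1)).
by rewrite /weighted1; ring.
Qed.

Lemma is_derive_weighted1 x : 0 < x -> is_derive x 1 Y (Y1 x) ->
  is_derive x 1 Y1 (Y2 x) -> is_derive x 1 weighted1 (weighted2 x).
Proof.
move=> x0 D1 D2.
have Di : is_derive x 1 (fun t => t^-1) (- x ^- 2).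
  apply: (der_eq (is_deriveV (lt0r_neq0 x0) (derI x))).
  by rewrite /GRing.scale /= mulr1.
have := derM (is_derive_weight x0) (derD D2 (derM (derZ (d / 2) Di) D1)).
by move/der_eq; apply; rewrite /weighted2; field; rewrite gt_eqF.
Qed.

Lemma weighted2_le x h : 0 <= d <= 2 -> 0 < x -> 0 <= Y x ->
  Y2 x + d / x * Y1 x <= - (h * Y x) -> weighted2 x <= - (h * weighted x).
Proof.
move=> /andP[d0 d2] x0 Y0 H.
rewrite /weighted2 /weighted mulrCA -mulrN ler_pM2l ?powR_gt0//.
apply: (le_trans _ H); rewrite gerDl; apply: mulr_le0_ge0 => //.
by rewrite mulr_le0_ge0 ?invr_ge0 ?sqr_ge0//; nra.
Qed.

End Radial.

Lemma radial_sturm d (Y Y1 Y2 h : R -> R) a k : 0 <= d <= 2 -> 0 < a -> 0 < k ->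
  let b := a + pi / k in
  (forall x, a <= x <= b -> is_derive x 1 Y (Y1 x)) ->
  (forall x, a <= x <= b -> is_derive x 1 Y1 (Y2 x)) ->
  (forall x, a <= x <= b -> 0 <= Y x) ->
  (forall x, a <= x <= b -> k ^+ 2 < h x) ->
  (forall x, a <= x <= b -> Y2 x + d / x * Y1 x <= - (h x * Y x)) ->
  forall x, a <= x <= b -> Y x = 0.
Proof.
move=> dd a0 k0 b D1 D2 Y0 hk H x xab.
have p0 t : a <= t <= b -> 0 < t by move=> /andP[h1 _]; rewrite (lt_le_trans a0).
have := @sturm (weighted d Y) (weighted1 d Y Y1) (weighted2 d Y Y1 Y2) h a k k0.
move=> /(_ _ _ _ hk _ x xab) S.
have /eqP : weighted d Y x = 0.
  apply: S => t tab; have t0 := p0 _ tab.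
  - exact: is_derive_weighted (D1 _ tab).
  - exact: is_derive_weighted1 (D1 _ tab) (D2 _ tab).
  - by rewrite mulr_ge0 ?powR_ge0 ?Y0.
  - by apply: weighted2_le => //; [exact: Y0|exact: H].
by rewrite mulf_eq0 gt_eqF ?powR_gt0 ?p0//= => /eqP.
Qed.

(** x^(d/2) Y is nonnegative and concave on a half-line, hence nondecreasing. *)
Lemma radial_superharmonic_doubling d (Y Y1 Y2 : R -> R) a : 0 <= d <= 2 -> 0 < a ->
  (forall x, a <= x -> is_derive x 1 Y (Y1 x)) ->
  (forall x, a <= x -> is_derive x 1 Y1 (Y2 x)) ->
  (forall x, a <= x -> 0 <= Y x) ->
  (forall x, a <= x -> Y2 x + d / x * Y1 x <= 0) ->
  forall x z, a <= x -> x <= z <= 2 * x -> Y x <= 2 * Y z.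
Proof.
move=> dd a0 D1 D2 Y0 H x z ax /andP[xz z2].
have p0 t : a <= t -> 0 < t by move=> h1; rewrite (lt_le_trans a0).
have E1 t : a <= t -> is_derive t 1 (weighted d Y) (weighted1 d Y Y1 t).
  by move=> ta; apply: is_derive_weighted (D1 _ ta); exact: p0.
have E2 t : a <= t -> is_derive t 1 (weighted1 d Y Y1) (weighted2 d Y Y1 Y2 t).
  by move=> ta; apply: is_derive_weighted1 (D1 _ ta) (D2 _ ta); exact: p0.
have E3 t : a <= t -> weighted2 d Y Y1 Y2 t <= 0.
  move=> ta; rewrite -oppr0 -(mul0r (weighted d Y t)).
  by apply: weighted2_le; rewrite ?p0 ?Y0// mul0r oppr0 H.
have E0 t : a <= t -> 0 <= weighted d Y t.
  by move=> ta; rewrite mulr_ge0 ?powR_ge0 ?Y0.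
have az := le_trans ax xz.
have mono : weighted d Y x <= weighted d Y z.
  rewrite leNgt; apply/negP => lt.
  have xz' : x < z.
    by move: xz lt; rewrite le_eqVlt => /predU1P[->|//]; rewrite ltxx.
  have [c /andP[xc cz]] := mvt xz' (fun t h => E1 t (le_trans ax (proj1 (andP h)))).
  move=> Ec; have c1 : weighted1 d Y Y1 c < 0.
    by have := subr_gt0 x z; rewrite xz' => zx; nra.
  have ac : a <= c by rewrite (le_trans ax)// ltW.
  have dec t : c <= t -> weighted1 d Y Y1 t <= weighted1 d Y Y1 c.
    move=> ct; apply: (der_nincr ct (df := weighted2 d Y Y1 Y2)) => s /andP[cs _].
      by apply: E2; rewrite (le_trans ac).
    by apply: E3; rewrite (le_trans ac)// ltW.
  pose l := weighted1 d Y Y1 c.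
  pose w := z + (weighted d Y z + 1) / - l.
  have l0 : 0 < - l by rewrite oppr_gt0.
  have zw : z < w.
    by rewrite ltrDl divr_gt0// ltr_wpDl// E0.
  have aw := le_trans az (ltW zw).
  have [s /andP[zs sw] Es] := mvt zw (fun t h => E1 t (le_trans az (proj1 (andP h)))).
  have ws : w - z = (weighted d Y z + 1) / - l by rewrite /w; ring.
  have := dec s (ltW (lt_trans cz zs)); rewrite -/l => hs.
  have w0 := E0 _ aw.
  have : weighted1 d Y Y1 s * (w - z) <= l * (w - z).
    by rewrite ler_pM2r// subr_gt0.
  rewrite -Es ws (_ : l * _ = - (weighted d Y z + 1)); last first.
    by field; rewrite lt_eqF.
  by lra.
have x0 := p0 _ ax.
have w2 : z `^ (d / 2) <= 2 * x `^ (d / 2).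
  have z20 : 0 <= z by rewrite (le_trans _ xz)// ltW.
  have /andP[d0 d2] := dd.
  apply: (@le_trans _ _ ((2 * x) `^ (d / 2))); first by apply: ler_powRl => //; lra.
  rewrite powRM ?(ltW x0)// ler_pM2r ?powR_gt0//.
  by rewrite -[leRHS](@powRr1 _ 2)// ler_powR ?ler1n//; lra.
move: mono; rewrite /weighted => mono.
have xw : 0 < x `^ (d / 2) by rewrite powR_gt0.
rewrite -(ler_pM2l xw); apply: (le_trans mono).
by rewrite mulrA ler_wpM2r ?Y0// (mulrC _ 2).
Qed.

End SecondOrder.

(** * The Pohozaev identity and decaying solutions *)

Section Liouville.
Variables (R : realType) (q : R).
Implicit Types (beta s r C : R) (U V : R -> R) (d : nat).

Local Notation f := (nonlinearity q).
Local Notation al := ((q + 1)^-1).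

(** The system obtained in the limit of the blow-up, for radial functions in
    dimension d + 1 on the half-line. *)
Definition limit_system d beta (U V U1 V1 : R -> R) := forall s, 0 < s ->
  [/\ is_derive s 1 U (U1 s),
      is_derive s 1 U1 (- (d%:R / s) * U1 s - f beta (U s) (V s)),
      is_derive s 1 V (V1 s)
    & is_derive s 1 V1 (- (d%:R / s) * V1 s - f beta (V s) (U s))].

Lemma limit_system_swap d beta U V U1 V1 :
  limit_system d beta U V U1 V1 -> limit_system d beta V U V1 U1.
Proof. by move=> H s /H[]. Qed.

Lemma limit_system_oppl d beta U V U1 V1 : limit_system d beta U V U1 V1 ->
  limit_system d beta (fun s => - U s) V (fun s => - U1 s) V1.
Proof.
move=> H s /H[D1 D2 D3 D4]; split=> //; first exact: derN.
- by apply: (der_eq (derN D2)); rewrite nonlinearityNl; ring.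
- by apply: (der_eq D4); rewrite nonlinearityNr.
Qed.

Lemma limit_system_oppr d beta U V U1 V1 : limit_system d beta U V U1 V1 ->
  limit_system d beta U (fun s => - V s) U1 (fun s => - V1 s).
Proof.
by move=> /limit_system_swap /limit_system_oppl /limit_system_swap.
Qed.

Lemma is_derive_pow (d : nat) s : 0 < s ->
  is_derive s 1 (fun t => t ^+ d) (d%:R * s ^+ d / s).
Proof.
move=> s0; apply: (der_eq (derX d (derI s))).
case: d => [|d]; first by rewrite !mul0r.
by rewrite /= exprS; field; rewrite gt_eqF.
Qed.

Lemma is_derive_flux d (Y1 : R -> R) s z : 0 < s ->
  is_derive s 1 Y1 (- (d%:R / s) * Y1 s - z) ->
  is_derive s 1 (fun t => t ^+ d * Y1 t) (- (s ^+ d * z)).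
Proof.
move=> s0 D; apply: (der_eq (derM (is_derive_pow d s0) D)).
by field; rewrite gt_eqF.
Qed.

(** Interpolation on [s, 2s]: the mean value theorem bounds the derivative at
    one point of the interval, and the flux s^d Y1 varies little on it. *)
Lemma decay_derivative d (Y Y1 Z : R -> R) (a r1 C : R) : 0 <= a -> 0 < r1 -> 0 <= C ->
  (forall s, r1 <= s -> is_derive s 1 Y (Y1 s)) ->
  (forall s, r1 <= s -> is_derive s 1 Y1 (- (d%:R / s) * Y1 s - Z s)) ->
  (forall s, r1 <= s -> `|Y s| <= C * s `^ (- a)) ->
  (forall s, r1 <= s -> `|Z s| <= C * s `^ (- a) / s ^+ 2) ->
  forall s, r1 <= s -> `|Y1 s| <= 2 ^+ d * 3 * C * s `^ (- a) / s.
Proof.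
move=> a0 r10 C0 D1 D2 HY HZ s rs.
have s0 : 0 < s by rewrite (lt_le_trans r10).
have s2 : s < 2 * s by lra.
have wdec t : s <= t -> t `^ (- a) <= s `^ (- a).
  move=> st; have t0 := lt_le_trans s0 st.
  by rewrite !powRN lef_pV2 ?posrE ?powR_gt0// ler_powRl// ltW.
set w := s `^ (- a) in wdec *.
have w0 : 0 <= w by rewrite powR_ge0.
have [x /andP[sx xs] Ex] := mvt s2 (fun t h => D1 t (le_trans rs (proj1 (andP h)))).
have x0 := lt_trans s0 sx.
have h1 : `|Y1 x| * s <= 2 * C * w.
  have -> : `|Y1 x| * s = `|Y (2 * s) - Y s|.
    rewrite Ex normrM; congr (_ * _).
    by rewrite (_ : 2 * s - s = s) ?gtr0_norm//; ring.
  apply: (le_trans (ler_normB _ _)).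
  have := HY _ rs; have := HY _ (le_trans rs (ltW s2)).
  have := ler_wpM2l C0 (wdec _ (ltW s2)); rewrite -/w; lra.
have h2 : `|x ^+ d * Y1 x - s ^+ d * Y1 s| <=
    (2 * s) ^+ d * (C * w / s ^+ 2) * (x - s).
  apply: (@der_lip R (fun t => t ^+ d * Y1 t) (fun t => - (t ^+ d * Z t)) s x
    _ (ltW sx)) => t /andP[st tx].
    apply: is_derive_flux; first by rewrite (lt_le_trans s0).
    by apply: D2; rewrite (le_trans rs).
  have t0 := lt_trans s0 st.
  rewrite normrN normrM; apply: ler_pM => //.
    rewrite ger0_norm ?exprn_ge0 ?(ltW t0)// lerXn2r ?nnegrE ?mulr_ge0 ?(ltW t0)
      ?(ltW s0)//.
    by rewrite ltW// (lt_trans tx).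
  apply: (le_trans (HZ _ (le_trans rs (ltW st)))).
  apply: ler_pM; rewrite ?mulr_ge0 ?invr_ge0 ?powR_ge0 ?exprn_ge0 ?(ltW t0)//.
    by rewrite ler_wpM2l// wdec// ltW.
  by rewrite lef_pV2 ?posrE ?exprn_gt0// lerXn2r ?nnegrE// ltW.
have h3 : s ^+ d * `|Y1 s| <= (2 * s) ^+ d * `|Y1 x| + (2 * s) ^+ d * (C * w / s).
  have -> : s ^+ d * `|Y1 s| = `|s ^+ d * Y1 s|.
    by rewrite normrM ger0_norm// exprn_ge0// ltW.
  have -> : s ^+ d * Y1 s = x ^+ d * Y1 x - (x ^+ d * Y1 x - s ^+ d * Y1 s) by ring.
  apply: (le_trans (ler_normB _ _)); apply: lerD.
    rewrite normrM ler_wpM2r// ger0_norm ?exprn_ge0 ?(ltW x0)//.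
    by rewrite lerXn2r ?nnegrE ?mulr_ge0 ?(ltW x0) ?(ltW s0)// ltW.
  apply: (le_trans h2); rewrite -mulrA ler_wpM2l ?exprn_ge0 ?mulr_ge0 ?(ltW s0)//.
  rewrite (_ : C * w / s = C * w / s ^+ 2 * s); last by field; rewrite gt_eqF.
  by rewrite ler_wpM2l ?mulr_ge0 ?invr_ge0 ?exprn_ge0 ?(ltW s0)//; lra.
have sd : 0 < s ^+ d by rewrite exprn_gt0.
rewrite -(ler_pM2l sd); apply: (le_trans h3).
rewrite exprMn -mulrDr.
have h4 : `|Y1 x| <= 2 * C * w / s by rewrite ler_pdivlMr.
apply: (@le_trans _ _ (2 ^+ d * s ^+ d * (2 * C * w / s + C * w / s))).
  by rewrite ler_wpM2l ?lerD2r// mulr_ge0// ?exprn_ge0// ltW.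
by rewrite le_eqVlt; apply/orP; left; apply/eqP; field; rewrite gt_eqF.
Qed.

Definition energy beta (U V U1 V1 : R -> R) s :=
  (U1 s ^+ 2 + V1 s ^+ 2) / 2 + potential q beta (U s) (V s).

Definition pohozaev d beta (U V U1 V1 : R -> R) s :=
  s ^+ d.+1 * energy beta U V U1 V1 s
  + d.+1%:R / (2 * q + 4) * (s ^+ d * (U s * U1 s + V s * V1 s)).

(** Positivity of this constant is exactly subcriticality of p = 2q + 3 in
    dimension d + 1. *)
Definition pohozaev_const d : R := 1 - d.+1%:R / 2 + d.+1%:R / (2 * q + 4).

Lemma pohozaev_const_gt0 d : -1 < q -> (d%:R - 1) * (q + 1) < 2 ->
  0 < pohozaev_const d.
Proof.
move=> hq hd; rewrite /pohozaev_const.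
rewrite (_ : _ + _ = (2 - (d%:R - 1) * (q + 1)) / (2 * q + 4)); last first.
  by rewrite -natr1; field; lra.
by rewrite divr_gt0; lra.
Qed.

(** Homogeneity of the potential F turns the terms n F and
    n / (p+1) (U f1 + V f2) into opposite quantities, so that only the kinetic
    term is left. *)
Lemma is_derive_pohozaev d beta U V U1 V1 s : -1 < q ->
  limit_system d beta U V U1 V1 -> 0 < s ->
  is_derive s 1 (pohozaev d beta U V U1 V1)
    (pohozaev_const d * (s ^+ d * (U1 s ^+ 2 + V1 s ^+ 2))).
Proof.
move=> hq H s0; have [D1 D2 D3 D4] := H _ s0.
have DE := derD (derZ 2^-1 (derD (derX 2 D2) (derX 2 D4)))
  (is_derive_potential hq beta D1 D3).
have DQ := derD (derM D1 D2) (derM D3 D4).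
have D5 := derM (is_derive_pow d.+1 s0) DE.
have D6 := derZ (d.+1%:R / (2 * q + 4)) (derM (is_derive_pow d s0) DQ).
have -> : pohozaev d beta U V U1 V1 = fun s =>
  s ^+ d.+1 * (2^-1 * (U1 s ^+ 2 + V1 s ^+ 2) + potential q beta (U s) (V s))
  + d.+1%:R / (2 * q + 4) * (s ^+ d * (U s * U1 s + V s * V1 s)).
  by apply/funext => t; rewrite /pohozaev /energy; ring.
apply: (der_eq (derD D5 D6)).
have E := potential_euler hq beta (U s) (V s).
rewrite /pohozaev_const /= !expr1 -natr1.
move: E; set F := potential _ _ _ _; set f1 := f _ (U s) _; set f2 := f _ (V s) _.
move=> E; have {E} -> : F = (f1 * U s + f2 * V s) / (2 * q + 4).
  by rewrite E; field; lra.
by rewrite exprS; field; rewrite (gt_eqF s0) andbT; lra.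
Qed.

Lemma decay_of_small_potential x r A : -1 < q -> 0 <= x -> 0 < r -> 0 <= A ->
  x `^ (2 * q + 2) <= A / r ^+ 2 -> x <= A `^ (al / 2) * r `^ (- al).
Proof.
move=> hq x0 r0 A0 H.
have al0 : 0 < al by rewrite invr_gt0; lra.
have e1 : x = (x `^ (2 * q + 2)) `^ (al / 2).
  rewrite -powRrM (_ : _ * _ = 1) ?powRr1//.
  by field; lra.
rewrite {1}e1; apply: (@le_trans _ _ ((A / r ^+ 2) `^ (al / 2))).
  by apply: ler_powRl; rewrite ?powR_ge0//; lra.
rewrite powRM ?invr_ge0 ?exprn_ge0 ?(ltW r0)//.
rewrite -(powR_invn 2 (ltW r0)) -powRrM.
by rewrite (_ : - 2%:R * (al / 2) = - al)//; field; lra.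
Qed.

Lemma powR_decay_scale s C k e : -1 < q -> 0 <= C -> 0 < s ->
  e = - al * k -> (C * s `^ (- al)) `^ k = C `^ k * s `^ e.
Proof. by move=> hq C0 s0 ->; rewrite powRM ?powR_ge0// -powRrM. Qed.

Lemma powRB_nat s a (k : nat) : 0 < s -> s `^ (a - k%:R) = s `^ a / s ^+ k.
Proof.
move=> s0; rewrite powRB; last by rewrite (gt_eqF s0) implybT.
by rewrite powR_mulrn// ltW.
Qed.

Lemma pohozaev_decay d beta U V U1 V1 C r1 : -1 < q ->
  limit_system d beta U V U1 V1 -> 0 < r1 -> 0 <= C ->
  (forall s, r1 <= s -> `|U s| <= C * s `^ (- al)) ->
  (forall s, r1 <= s -> `|V s| <= C * s `^ (- al)) ->
  exists K, forall s, r1 <= s ->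
    pohozaev d beta U V U1 V1 s <= K * s `^ (d%:R - 1 - 2 * al).
Proof.
move=> hq H r10 C0 HU HV.
have al0 : 0 < al by rewrite invr_gt0; lra.
have qN : q + 1 != 0 by lra.
pose K1 := (1 + `|beta|) * C `^ (2 * q + 3).
have Hf (W W' : R -> R) : (forall s, r1 <= s -> `|W s| <= C * s `^ (- al)) ->
    (forall s, r1 <= s -> `|W' s| <= C * s `^ (- al)) ->
    forall s, r1 <= s -> `|f beta (W s) (W' s)| <= K1 * s `^ (- al) / s ^+ 2.
  move=> h1 h2 s rs; have s0 := lt_le_trans r10 rs.
  apply: (le_trans (nonlinearity_bound hq beta (h1 _ rs) (h2 _ rs))).
  rewrite (@powR_decay_scale _ _ _ (- al - 2%:R))//; last by field.
  by rewrite (powRB_nat _ 2 s0) /K1 !mulrA.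
pose C1 := Num.max C K1.
have C10 : 0 <= C1 by rewrite le_max C0.
have HC1 (W : R -> R) : (forall s, r1 <= s -> `|W s| <= C * s `^ (- al)) ->
    forall s, r1 <= s -> `|W s| <= C1 * s `^ (- al).
  move=> h s rs; apply: (le_trans (h _ rs)).
  by rewrite ler_wpM2r ?powR_ge0// le_max lexx.
have HC2 (Z : R -> R) : (forall s, r1 <= s -> `|Z s| <= K1 * s `^ (- al) / s ^+ 2) ->
    forall s, r1 <= s -> `|Z s| <= C1 * s `^ (- al) / s ^+ 2.
  move=> h s rs; have s0 := lt_le_trans r10 rs; apply: (le_trans (h _ rs)).
  rewrite ler_wpM2r ?invr_ge0 ?exprn_ge0 ?(ltW s0)//.
  by rewrite ler_wpM2r ?powR_ge0// le_max lexx orbT.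
have Hp s : r1 <= s -> 0 < s by move=> h; rewrite (lt_le_trans r10).
pose C2 := 2 ^+ d * 3 * C1.
have C20 : 0 <= C2 by rewrite !mulr_ge0 ?exprn_ge0.
have HU1 : forall s, r1 <= s -> `|U1 s| <= C2 * s `^ (- al) / s.
  apply: (@decay_derivative d U U1 (fun s => f beta (U s) (V s))) => //.
  - exact: ltW.
  - by move=> s /Hp /H[].
  - by move=> s /Hp /H[].
  - exact: HC1.
  - by apply: HC2; exact: Hf.
have HV1 : forall s, r1 <= s -> `|V1 s| <= C2 * s `^ (- al) / s.
  apply: (@decay_derivative d V V1 (fun s => f beta (V s) (U s))) => //.
  - exact: ltW.
  - by move=> s /Hp /H[].
  - by move=> s /Hp /H[].
  - exact: HC1.
  - by apply: HC2; exact: Hf.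
pose K2 := (1 + `|beta|) * C `^ (2 * q + 4).
pose c : R := d.+1%:R / (2 * q + 4).
have c0 : 0 <= c by rewrite divr_ge0//; lra.
exists (C2 ^+ 2 + K2 + c * (2 * (C * C2))) => s rs.
have s0 := Hp _ rs.
have E : s `^ (d%:R - 1 - 2 * al) = s ^+ d / s * (s `^ (- al)) ^+ 2.
  rewrite -(@powR_mulrn _ (s `^ (- al)) 2) ?powR_ge0// -powRrM.
  rewrite (_ : - al * 2%:R = - (2 * al)); last by ring.
  rewrite -[s ^+ d]powR_mulrn ?(ltW s0)// -(powR_inv1 (ltW s0)) -!powRD//.
  - by rewrite (gt_eqF s0) implybT.
  - by rewrite (gt_eqF s0) implybT.
rewrite E; set w := s `^ (- al) in HU HV HU1 HV1 E *.
have w0 : 0 <= w by rewrite powR_ge0.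
have sqb (y k : R) : `|y| <= k -> y ^+ 2 <= k ^+ 2.
  move=> h; rewrite -(real_normK (num_real y)) lerXn2r ?nnegrE//.
  by rewrite (le_trans _ h).
have b1 := sqb _ _ (HU1 _ rs); have b2 := sqb _ _ (HV1 _ rs).
have b3 : potential q beta (U s) (V s) <= K2 * (w ^+ 2 / s ^+ 2).
  apply: (le_trans (ler_norm _)).
  apply: (le_trans (potential_bound hq beta (HU _ rs) (HV _ rs))).
  rewrite (@powR_decay_scale _ _ _ (- al * 2%:R - 2%:R))//; last by field.
  rewrite (powRB_nat _ 2 s0) powRrM powR_mulrn ?powR_ge0//.
  by rewrite /K2 !mulrA.
have b4 (Y Y1 : R -> R) : `|Y s| <= C * w -> `|Y1 s| <= C2 * w / s ->
    Y s * Y1 s <= C * C2 * (w ^+ 2 / s).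
  move=> h1 h2; apply: (le_trans (ler_norm _)); rewrite normrM.
  have -> : C * C2 * (w ^+ 2 / s) = (C * w) * (C2 * w / s) by ring.
  exact: ler_pM.
have b5 := lerD (b4 _ _ (HU _ rs) (HU1 _ rs)) (b4 _ _ (HV _ rs) (HV1 _ rs)).
have sd : 0 <= s ^+ d by rewrite exprn_ge0// ltW.
rewrite /pohozaev -/c.
have t1 : s ^+ d.+1 * energy beta U V U1 V1 s <=
    s ^+ d.+1 * ((C2 ^+ 2 + K2) * (w ^+ 2 / s ^+ 2)).
  rewrite ler_wpM2l ?exprn_ge0 ?(ltW s0)// /energy (mulrDl (C2 ^+ 2) K2) lerD//.
  rewrite (_ : C2 ^+ 2 * (w ^+ 2 / s ^+ 2) = (C2 * w / s) ^+ 2).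
    by move: b1 b2; move: (C2 * w / s) => z; lra.
  by field; rewrite gt_eqF.
have t2 : c * (s ^+ d * (U s * U1 s + V s * V1 s)) <=
    c * (s ^+ d * (C * C2 * (w ^+ 2 / s) + C * C2 * (w ^+ 2 / s))).
  by rewrite !ler_wpM2l.
apply: (le_trans (lerD t1 t2)).
rewrite le_eqVlt; apply/orP; left; apply/eqP; rewrite exprS; field.
by rewrite gt_eqF.
Qed.

Lemma powR_decay a C e : 0 < a -> 0 <= C -> 0 < e ->
  exists2 T : R, 0 < T & forall s, T <= s -> C * s `^ (- a) < e.
Proof.
move=> a0 C0 e0.
have ec0 : 0 < e / (C + 1) by rewrite divr_gt0// ltr_wpDl.
have [de de0 dP] := powR_small a0 ec0.
exists (2 * de^-1); first by rewrite mulr_gt0 ?invr_gt0.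
move=> s Ts; have T0 : 0 < de^-1 by rewrite invr_gt0.
have s0 : 0 < s by rewrite (lt_le_trans _ Ts)// mulr_gt0.
have : s^-1 `^ a < e / (C + 1).
  apply: dP; first by rewrite invr_ge0 ltW.
  by rewrite -[ltRHS]invrK ltf_pV2 ?posrE//; lra.
rewrite -powR_inv1 ?ltW// -powRrM mulN1r => h.
have : (C + 1) * s `^ (- a) < e.
  by rewrite mulrC -ltr_pdivlMr// ltr_wpDl.
by apply: le_lt_trans; rewrite ler_wpM2r ?powR_ge0// lerDl.
Qed.

(** A weak form of the initial conditions that makes the Pohozaev function tend
    to 0 at 0: it covers both U'(0) = V'(0) = 0 and, for d = 0, the single
    condition (U U' + V V')(0) = 0. *)
Definition regular_at_zero d (U V U1 V1 : R -> R) := exists C : R,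
  forall s, 0 < s <= 1 ->
    [/\ `|U1 s| <= C, `|V1 s| <= C & `|s ^+ d * (U s * U1 s + V s * V1 s)| <= C * s].

(** The Pohozaev function is nondecreasing, nonnegative by its behaviour at 0
    and nonpositive by its behaviour at infinity. *)
Lemma decaying_solution_eq0 d beta U V U1 V1 C r1 (A : R) :
  -1 < q -> (d%:R - 1) * (q + 1) < 2 ->
  limit_system d beta U V U1 V1 -> regular_at_zero d U V U1 V1 ->
  (forall s, 0 < s -> `|U s| <= A /\ `|V s| <= A) ->
  0 < r1 -> 0 <= C ->
  (forall s, r1 <= s -> `|U s| <= C * s `^ (- al)) ->
  (forall s, r1 <= s -> `|V s| <= C * s `^ (- al)) ->
  forall s, 0 < s -> U s = 0 /\ V s = 0.
Proof.
move=> hq hd H [B HB] HA r10 C0 HU HV.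
have al0 : 0 < al by rewrite invr_gt0; lra.
have [K HK] := pohozaev_decay hq H r10 C0 HU HV.
set P := pohozaev _ _ _ _ _ _ in HK.
have del := pohozaev_const_gt0 hq hd.
have DP := fun s => @is_derive_pohozaev d beta U V U1 V1 s hq H.
have Pm s t : 0 < s -> s <= t -> P s <= P t.
  move=> s0 st; apply: (der_ndecr st (fun x hx => DP x (lt_le_trans s0 (proj1 (andP hx))))).
  move=> x /andP[sx _]; have x0 := lt_trans s0 sx.
  by rewrite mulr_ge0 ?(ltW del)// mulr_ge0 ?exprn_ge0 ?(ltW x0)// addr_ge0 ?sqr_ge0.
have P0 s : 0 < s -> 0 <= P s.
  move=> s0; rewrite leNgt; apply/negP => Ps.
  have B0 : 0 <= B.
    have [h _ _] := HB 1 (introT andP (conj ltr01 (lexx _))).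
    by rewrite (le_trans _ h).
  have A0 : 0 <= A by have [h _] := HA _ s0; rewrite (le_trans _ h).
  pose c : R := d.+1%:R / (2 * q + 4).
  have c0 : 0 <= c by rewrite divr_ge0//; lra.
  pose L := B ^+ 2 + (1 + `|beta|) * A `^ (2 * q + 4) + c * B + 1.
  have L0 : 0 < L.
    have l1 := sqr_ge0 B; have l3 : 0 <= c * B by rewrite mulr_ge0.
    have l2 : 0 <= (1 + `|beta|) * A `^ (2 * q + 4).
      by rewrite mulr_ge0 ?powR_ge0// addr_ge0.
    by rewrite /L; lra.
  (* As |P t| <= L t on (0, 1], a negative value P s is not reached from t. *)
  pose t := Num.min (Num.min s 1) (- P s / (2 * L)).
  have t0 : 0 < t.
    by rewrite !lt_min s0 ltr01 divr_gt0 ?mulr_gt0// oppr_gt0.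
  have ts : t <= s by rewrite !ge_min lexx.
  have t1 : t <= 1 by rewrite !ge_min lexx orbT.
  have tP : t <= - P s / (2 * L) by rewrite !ge_min lexx orbT.
  have [b1 b2 b3] := HB t (introT andP (conj t0 t1)).
  have [a1 a2] := HA _ t0.
  have h : `|P t| <= L * t.
    rewrite /P /pohozaev -/c; apply: (le_trans (ler_normD _ _)).
    rewrite /L 2!(mulrDl _ _ t); rewrite -[leRHS]addrA; apply: lerD; last first.
      rewrite normrM (ger0_norm c0) -(mulrA c) (le_trans (ler_wpM2l c0 b3))//.
      by rewrite lerDl mul1r ltW.
    have tN : 0 <= t by rewrite ltW.
    rewrite normrM mulrC (@ger0_norm _ (t ^+ d.+1)) ?exprn_ge0//; apply: ler_pM => //.
    - by rewrite exprn_ge0.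
    - rewrite /energy; apply: (le_trans (ler_normD _ _)); apply: lerD.
        rewrite ger0_norm ?divr_ge0 ?addr_ge0 ?sqr_ge0//.
        have sqb (y k : R) : `|y| <= k -> y ^+ 2 <= k ^+ 2.
          move=> h; rewrite -(real_normK (num_real y)) lerXn2r ?nnegrE//.
          by rewrite (le_trans _ h).
        by have := sqb _ _ b1; have := sqb _ _ b2; lra.
      exact: potential_bound.
    - by rewrite exprS ler_piMr// exprn_ile1.
  have := Pm _ _ t0 ts.
  have : L * t <= - P s / 2.
    rewrite (_ : - P s / 2 = L * (- P s / (2 * L))); last by field; rewrite gt_eqF.
    by rewrite ler_wpM2l// ltW.
  by move: h; rewrite ler_norml => /andP[h _]; lra.
have Pz s : 0 < s -> P s = 0.
  move=> s0; apply/le_anti; rewrite P0// andbT; rewrite leNgt; apply/negP => Ps.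
  have e0 : 0 < 1 + 2 * al - d%:R.
    have : (d%:R - 1) * (q + 1) / (q + 1) < 2 / (q + 1).
      by rewrite ltr_pM2r ?invr_gt0//; lra.
    by rewrite mulfK; lra.
  have [T T0 HT] := powR_decay e0 (normr_ge0 K) Ps.
  pose t := Num.max (Num.max s r1) T.
  have tr : r1 <= t by rewrite !le_max lexx orbT.
  have ts : s <= t by rewrite !le_max lexx.
  have tT : T <= t by rewrite !le_max lexx orbT.
  have := Pm _ _ s0 ts; have := HK _ tr; have := HT _ tT.
  rewrite (_ : - (1 + 2 * al - d%:R) = d%:R - 1 - 2 * al); last by ring.
  have : K * t `^ (d%:R - 1 - 2 * al) <= `|K| * t `^ (d%:R - 1 - 2 * al).
    by rewrite ler_wpM2r ?powR_ge0// ler_norm.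
  lra.
have UV1 s : 0 < s -> U1 s = 0 /\ V1 s = 0.
  move=> s0.
  have /(der_uniq (DP _ s0)) : is_derive s 1 P 0.
    apply: (der_near _ (derC s 0)); exists s => // t.
    by rewrite ltr_norml => /andP[h _]; rewrite Pz//; lra.
  move=> /eqP; rewrite !mulf_eq0 (gt_eqF del) expf_eq0 (gt_eqF s0) andbF/=.
  by rewrite paddr_eq0 ?sqr_ge0// !sqrf_eq0 => /andP[/eqP ? /eqP ?].
have W0 (W W1 : R -> R) : (forall s, 0 < s -> is_derive s 1 W (W1 s)) ->
    (forall s, 0 < s -> W1 s = 0) ->
    (forall s, r1 <= s -> `|W s| <= C * s `^ (- al)) -> forall s, 0 < s -> W s = 0.
  move=> DW W10 HW s s0; apply/eqP; rewrite -normr_eq0 -[_ == 0]negbK.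
  apply/negP => Wn; have Wp : 0 < `|W s| by rewrite lt_def Wn normr_ge0.
  have [T T0 HT] := powR_decay al0 C0 Wp.
  pose t := Num.max (Num.max s r1) T.
  have tr : r1 <= t by rewrite !le_max lexx orbT.
  have ts : s <= t by rewrite !le_max lexx.
  have tT : T <= t by rewrite !le_max lexx orbT.
  have E : W s = W t.
    apply: der_cst => // x /andP[sx _]; have x0 := lt_le_trans s0 sx.
    by rewrite -(W10 _ x0); exact: DW.
  by have := HW _ tr; have := HT _ tT; rewrite E; lra.
move=> s s0; split.
- by apply: (W0 U U1) => // t t0; [case: (H _ t0)|case: (UV1 _ t0)].
- by apply: (W0 V V1) => // t t0; [case: (H _ t0)|case: (UV1 _ t0)].
Qed.

End Liouville.

(** * The Liouville theorem *)

Section LiouvilleTheorem.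
Variables (R : realType) (q : R).
Implicit Types (beta s r C : R) (U V : R -> R) (d : nat).

Local Notation f := (nonlinearity q).
Local Notation al := ((q + 1)^-1).
Local Notation limit_system := (limit_system q).

(** If h exceeded (pi/r)^2 on [r, 2r], Sturm comparison on that interval, whose
    length is pi / (pi/r), would make Y vanish. *)
Lemma exists_small_potential d (Y Y1 G h : R -> R) r : (d <= 2)%N -> 0 < r ->
  (forall x, r <= x <= 2 * r -> is_derive x 1 Y (Y1 x)) ->
  (forall x, r <= x <= 2 * r -> is_derive x 1 Y1 (- (d%:R / x) * Y1 x - G x)) ->
  (forall x, r <= x <= 2 * r -> 0 <= Y x) ->
  (forall x, r <= x <= 2 * r -> h x * Y x <= G x) ->
  (forall x, r <= x <= 2 * r -> Y x = 0) \/
  exists2 x, r <= x <= 2 * r & h x <= pi ^+ 2 / r ^+ 2.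
Proof.
move=> d2 r0 D1 D2 Y0 HG.
have [[x xr hx]|N] := pselect (exists2 x, r <= x <= 2 * r & h x <= pi ^+ 2 / r ^+ 2).
  by right; exists x.
left; have k0 : 0 < pi / r :> R by rewrite divr_gt0// pi_gt0.
have E (p : R) : 0 < p -> r + p / (p / r) = 2 * r.
  by move=> p0; field; rewrite (gt_eqF r0) (gt_eqF p0).
have := @radial_sturm R d%:R Y Y1 (fun x => - (d%:R / x) * Y1 x - G x) h r _ _ r0 k0.
rewrite (E _ (pi_gt0 R)); apply => //.
- by rewrite ler0n ler_nat.
- move=> x xr; rewrite ltNge; apply/negP => hx; apply: N; exists x => //.
  by rewrite -expr_div_n.
- by move=> x xr; have := HG _ xr; lra.
Qed.

Section Core.
Variables (d : nat) (beta A r0 : R) (U V U1 V1 : R -> R).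
Hypotheses (hq : -1 < q) (d2 : (d <= 2)%N) (r00 : 0 < r0).
Hypothesis H : limit_system d beta U V U1 V1.
Hypothesis HA : forall s, 0 < s -> `|U s| <= A /\ `|V s| <= A.
Hypothesis V0 : forall s, r0 <= s -> 0 <= V s.
Hypothesis VU : forall s, r0 <= s -> V s <= U s.

(** U is superharmonic: since V <= U, the coupling term is dominated by the
    factor min 1 (1 + beta) > 0. *)
Lemma decay_of_gt : -1 < beta -> exists2 C, 0 <= C &
  forall s, r0 <= s -> `|U s| <= C * s `^ (- al) /\ `|V s| <= C * s `^ (- al).
Proof.
move=> b1; have hq' := hq.
have U0 s : r0 <= s -> 0 <= U s by move=> rs; rewrite (le_trans (V0 rs)) ?VU.
pose c := Num.min 1 (1 + beta).
have c0 : 0 < c by rewrite lt_min ltr01; lra.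
pose h s := c * U s `^ (2 * q + 2).
have HG s : r0 <= s -> h s * U s <= f beta (U s) (V s).
  move=> rs; have u0 := U0 _ rs; have v0 := V0 rs; have vu := VU rs.
  rewrite nonlinearityE// /h -mulrA powRS//; last by lra.
  rewrite (_ : 2 * q + 2 + 1 = (q + 1) + (q + 2)); last by ring.
  rewrite powRD; last by apply/implyP => /eqP; lra.
  rewrite mulrCA ler_wpM2l ?powR_ge0//.
  have : V s `^ (q + 2) <= U s `^ (q + 2) by apply: ler_powRl => //; lra.
  have := powR_ge0 (V s) (q + 2).
  move: (U s `^ _) (V s `^ _) => x y y0 yx.
  have : c <= 1 /\ c <= 1 + beta by rewrite /c !ge_min !lexx orbT.
  by case=> c1 c2; have [bp|bn] := leP 0 beta; nra.
have Hr s : r0 <= s -> 0 < s by move=> rs; rewrite (lt_le_trans r00).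
pose C := 2 * (pi ^+ 2 / c) `^ (al / 2).
have C0 : 0 <= C by rewrite mulr_ge0 ?powR_ge0.
exists C => // s rs; have s0 := Hr _ rs.
have HUs : U s <= C * s `^ (- al).
  have [||||Uz|[x /andP[sx x2] hx]] :=
      @exists_small_potential d U U1 (fun s => f beta (U s) (V s)) h s d2 s0.
  - by move=> x /andP[/(le_trans rs) /Hr /H[]].
  - by move=> x /andP[/(le_trans rs) /Hr /H[]].
  - by move=> x /andP[/(le_trans rs) /U0].
  - by move=> x /andP[/(le_trans rs) /HG].
  - rewrite Uz ?mulr_ge0 ?powR_ge0// lexx /=; lra.
  - have ux := U0 _ (le_trans rs sx).
    have : U x <= (pi ^+ 2 / c) `^ (al / 2) * s `^ (- al).
      apply: decay_of_small_potential => //; first by rewrite divr_ge0 ?sqr_ge0// ltW.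
      by rewrite mulrAC ler_pdivlMr// mulrC.
    suff : U s <= 2 * U x by rewrite /C -mulrA; lra.
    have := @radial_superharmonic_doubling R d%:R U U1
      (fun s => - (d%:R / s) * U1 s - f beta (U s) (V s)) r0.
    apply => //.
    + by rewrite ler0n ler_nat.
    + by move=> t /Hr /H[].
    + by move=> t /Hr /H[].
    + move=> t rt; have h0 : 0 <= h t * U t by rewrite !mulr_ge0 ?powR_ge0 ?U0 ?(ltW c0).
      by have := HG _ rt; lra.
    + by rewrite sx.
by rewrite !ger0_norm ?V0 ?U0//; split=> //; apply: le_trans HUs; exact: VU.
Qed.

Lemma eq_of_eq_on r : 0 < r -> (forall x, r <= x <= 2 * r -> U x = V x) ->
  forall s, 0 < s -> U s = V s.
Proof.
move=> rp E s s0; have hq' := hq.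
(* An interior point of [r, 2r], where the derivatives of U and V agree too. *)
pose x0 := 3 / 2 * r.
pose a := Num.min s x0; pose b := Num.max s x0.
have xp : 0 < x0 by rewrite mulr_gt0// divr_gt0.
have a0 : 0 < a by rewrite lt_min s0.
pose K := (2 * q + 3) * A `^ (2 * q + 2) + `|beta| * (A * A) `^ (q + 1).
have K0 : 0 <= K by rewrite addr_ge0// mulr_ge0 ?powR_ge0//; lra.
apply/eqP; rewrite -subr_eq0; apply/eqP.
have tp t : a <= t <= b -> 0 < t by move=> /andP[h _]; rewrite (lt_le_trans a0).
apply: (@radial_ode_unique R d (fun t => U t - V t) (fun t => U1 t - V1 t)
   (fun t => - (d%:R / t) * (U1 t - V1 t)
      - (f beta (U t) (V t) - f beta (V t) (U t))) a b x0 K a0 _ K0).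
- by rewrite ge_min lexx orbT le_max lexx orbT.
- by move=> t /tp /H[? ? ? ?]; exact: derB.
- move=> t /tp /H[D1 D2 D3 D4]; apply: (der_eq (derB D2 D4)); ring.
- move=> t tab; have [h1 h2] := HA (tp _ tab).
  rewrite addrAC mulNr addNr add0r normrN.
  exact: nonlinearity_diff_bound.
- by rewrite E ?subrr// /x0; lra.
- have [D1 _ D3 _] := H xp; apply: (der_uniq (derB D1 D3)).
  apply: (der_near _ (derC _ 0)); exists (r / 4); first by rewrite divr_gt0.
  move=> y; rewrite ltr_norml /x0 => hy; rewrite E ?subrr//; lra.
- by rewrite ge_min lexx le_max lexx.
Qed.

(** For beta <= -1 both terms of f(U,V) - f(V,U) push U - V towards
    superharmonicity, and V is subharmonic.  At a sequence of points s_j with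
    s_(j+1) <= 4 s_j the function U is small; this bounds U - V by the doubling
    property, and V by the maximum principle. *)
Lemma decay_or_eq : beta <= -1 -> (forall s, 0 < s -> U s = V s) \/
  exists C r1, [/\ 0 <= C, 0 < r1 &
  forall s, r1 <= s -> `|U s| <= C * s `^ (- al) /\ `|V s| <= C * s `^ (- al)].
Proof.
move=> b1; have hq' := hq.
have U0 s : r0 <= s -> 0 <= U s by move=> rs; rewrite (le_trans (V0 rs)) ?VU.
have [[s s0 us]|N] := pselect (exists2 r, 0 < r &
  (forall x, r <= x <= 2 * r -> U x = V x)); first by left; exact: (eq_of_eq_on s0).
right.
pose W s := U s - V s; pose W1 s := U1 s - V1 s.
pose G s := f beta (U s) (V s) - f beta (V s) (U s).
pose h s := U s `^ (2 * q + 2).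
have W0 s : r0 <= s -> 0 <= W s by move=> rs; rewrite subr_ge0 VU.
have Hr s : r0 <= s -> 0 < s by move=> rs; rewrite (lt_le_trans r00).
have DW s : 0 < s -> is_derive s 1 W (W1 s).
  by move=> /H[? ? ? ?]; exact: derB.
have DW1 s : 0 < s -> is_derive s 1 W1 (- (d%:R / s) * W1 s - G s).
  by move=> /H[D1 D2 D3 D4]; apply: (der_eq (derB D2 D4)); rewrite /G /W1; ring.
have HG s : r0 <= s -> h s * W s <= G s.
  move=> rs; have u0 := U0 _ rs; have v0 := V0 rs; have vu := VU rs.
  rewrite /G (nonlinearity_diff hq) /gpow !ger0_norm ?mulr_ge0// /h /W.
  have p1 : V s `^ (2 * q + 2) <= U s `^ (2 * q + 2) by apply: ler_powRl => //; lra.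
  have p2 : 0 <= (U s * V s) `^ q * (U s * V s) * (U s - V s).
    by rewrite mulr_ge0 ?mulr_ge0 ?powR_ge0// subr_ge0.
  have p3 : V s `^ (2 * q + 2) * V s <= U s `^ (2 * q + 2) * V s.
    by rewrite ler_wpM2r.
  by rewrite -mulrA; move: p2; set z := _ * (U s - V s); nra.
have pt s : r0 <= s -> exists2 x, s <= x <= 2 * s &
    U x <= (pi ^+ 2) `^ (al / 2) * s `^ (- al).
  move=> rs; have s0 := Hr _ rs.
  have [|||||[x xs hx]] := @exists_small_potential d W W1 G h s d2 s0.
  - by move=> x /andP[/(le_trans rs) /Hr /DW].
  - by move=> x /andP[/(le_trans rs) /Hr /DW1].
  - by move=> x /andP[/(le_trans rs) /W0].
  - by move=> x /andP[/(le_trans rs) /HG].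
  - move=> Wz; exfalso; apply: N; exists s => // x /Wz /eqP.
    by rewrite subr_eq0 => /eqP.
  - exists x => //; apply: decay_of_small_potential => //; last by rewrite sqr_ge0.
    by apply: U0; rewrite (le_trans rs)//; case/andP: xs.
pose C1 := (pi ^+ 2 : R) `^ (al / 2).
have C10 : 0 <= C1 by rewrite powR_ge0.
have HWs s : r0 <= s -> W s <= 2 * C1 * s `^ (- al).
  move=> rs; have [x xs hx] := pt _ rs.
  have xr : r0 <= x by rewrite (le_trans rs)//; case/andP: xs.
  have : W s <= 2 * W x.
    apply: (@radial_superharmonic_doubling R d%:R W W1
      (fun s => - (d%:R / s) * W1 s - G s) r0) => //.
    + by rewrite ler0n ler_nat.
    + by move=> t /Hr /DW.
    + by move=> t /Hr /DW1.
    + move=> t rt; have h0 : 0 <= h t * W t by rewrite mulr_ge0 ?powR_ge0 ?W0.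
      by have := HG _ rt; lra.
  have := V0 xr; rewrite /W -/C1 in hx * => v0 h1.
  by rewrite -mulrA; lra.
have HV s : r0 <= s -> f beta (V s) (U s) <= 0.
  move=> rs; have u0 := U0 _ rs; have v0 := V0 rs; have vu := VU rs.
  rewrite nonlinearityE// mulr_ge0_le0 ?powR_ge0//.
  have p1 : V s `^ (q + 2) <= U s `^ (q + 2) by apply: ler_powRl => //; lra.
  by have := powR_ge0 (U s) (q + 2); nra.
(* V is subharmonic: the flux is nondecreasing, hence the maximum principle. *)
have flux s t : r0 <= s -> s <= t -> s ^+ d * V1 s <= t ^+ d * V1 t.
  move=> rs st; have s0 := Hr _ rs.
  apply: (@der_ndecr R (fun t => t ^+ d * V1 t)
    (fun t => - (t ^+ d * f beta (V t) (U t))) s t st) => x /andP[sx _].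
    have x0 := lt_le_trans s0 sx.
    by apply: is_derive_flux => //; case: (H x0).
  have x0 := lt_trans s0 sx.
  rewrite oppr_ge0 mulr_ge0_le0 ?exprn_ge0 ?(ltW x0)// HV//.
  by rewrite (le_trans rs)// ltW.
have maxp x s y : r0 <= x -> x <= s -> s <= y -> V s <= V x \/ V s <= V y.
  move=> rx xs sy; have [?|lt] := leP (V s) (V x); [by left|right].
  have xs' : x < s.
    by move: xs lt; rewrite le_eqVlt => /predU1P[->|//]; rewrite ltxx.
  have dV t : x <= t -> is_derive t 1 V (V1 t).
    by move=> xt; case: (H (Hr _ (le_trans rx xt))).
  have [z /andP[xz zs] Ez] := mvt xs' (fun t ht => dV t (proj1 (andP ht))).
  have z1 : 0 < V1 z.
    have : 0 < V1 z * (s - x) by rewrite -Ez subr_gt0.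
    by rewrite pmulr_lgt0// subr_gt0.
  have rz := le_trans rx (ltW xz).
  apply: (der_ndecr sy (df := V1)) => t /andP[st _].
    by apply: dV; rewrite (le_trans xs).
  have zt := lt_trans zs st.
  have := flux _ _ rz (ltW zt).
  have zp : 0 < z ^+ d * V1 z by rewrite mulr_gt0// exprn_gt0// Hr.
  have tp : 0 < t ^+ d by rewrite exprn_gt0// (lt_trans (Hr _ rz)).
  by move/(lt_le_trans zp); rewrite pmulr_rgt0// => /ltW.
pose C2 := 2 `^ al * C1.
have C20 : 0 <= C2 by rewrite mulr_ge0// powR_ge0.
exists (2 * C1 + C2), (2 * r0); split; [by rewrite addr_ge0// mulr_ge0|by rewrite mulr_gt0|].
move=> s rs; have rs' : r0 <= s by have := r00; lra.
have s0 := Hr _ rs'.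
have w0 : 0 <= s `^ (- al) by rewrite powR_ge0.
have al0 : 0 < al by rewrite invr_gt0; lra.
have HVs : V s <= C2 * s `^ (- al).
  have rs2 : r0 <= s / 2 by lra.
  have e2 : C1 * (s / 2) `^ (- al) = C2 * s `^ (- al).
    rewrite powRM ?(ltW s0)// -(@powR_inv1 _ 2)// -powRrM mulN1r opprK /C2.
    by ring.
  have e3 : C1 * s `^ (- al) <= C2 * s `^ (- al).
    rewrite ler_wpM2r// /C2 ler_peMl// -[leLHS](powRr0 2) ler_powR ?ler1n//.
    exact: ltW.
  have [x /andP[x1 x2] hx] := pt _ rs2.
  have [y /andP[y1 y2] hy] := pt _ rs'.
  have xr : r0 <= x by lra.
  have yr : r0 <= y by lra.
  have xs : x <= s by lra.
  rewrite -/C1 in hx hy.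
  have [h1|h1] := maxp _ _ _ xr xs y1; apply: (le_trans h1).
    by apply: (le_trans (VU xr)); rewrite (le_trans hx)// e2.
  by apply: (le_trans (VU yr)); rewrite (le_trans hy).
have := HWs _ rs'; rewrite /W !ger0_norm ?V0 ?U0// => h1.
by split; nra.
Qed.

(** With U = V the equation reads V'' + (d/s) V' = b |V|^(2q+2) V, where
    b = - (1 + beta) >= 0.  For b = 0 the flux s^d V' is constant, and it is zero
    because V is bounded.  For b > 0, s^d V V' is nonnegative and grows like
    s^(d+1) as soon as V <> 0, so that V^2 grows like s^2. *)
Lemma eq_solution_const : beta <= -1 -> (forall s, 0 < s -> U s = V s) ->
  regular_at_zero d U V U1 V1 ->
  exists c, (forall s, 0 < s -> V s = c) /\ (c != 0 -> beta = -1).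
Proof.
move=> b1 UV [C HC]; have hq' := hq.
have UV1 s : 0 < s -> U1 s = V1 s.
  move=> s0; have [D1 _ D3 _] := H s0; apply: (der_uniq D1).
  apply: (der_near _ D3); exists s => // t.
  by rewrite ltr_norml => /andP[h _]; rewrite UV//; lra.
pose b := - (1 + beta).
have fE x : f beta x x = - b * `|x| `^ (2 * q + 2) * x.
  rewrite /nonlinearity -(mulrA beta) -powRD; last by apply/implyP => /eqP; lra.
  rewrite (_ : q + 2 + q = 2 * q + 2); last by ring.
  by rewrite /b; ring.
have dV s : 0 < s -> is_derive s 1 V (V1 s) by move=> /H[].
have dV1 s : 0 < s -> is_derive s 1 V1 (- (d%:R / s) * V1 s - f beta (V s) (V s)).
  by move=> s0; have [_ _ _] := H s0; rewrite UV.
have dF s : 0 < s -> is_derive s 1 (fun t => t ^+ d * V1 t)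
    (s ^+ d * (b * `|V s| `^ (2 * q + 2) * V s)).
  move=> s0; apply: (der_eq (is_derive_flux s0 (dV1 _ s0))).
  by rewrite fE; ring.
have bge : 0 <= b by rewrite /b; lra.
move: bge; rewrite le_eqVlt => /predU1P[b0|bp].
  have Fc s : 0 < s -> s ^+ d * V1 s = V1 1.
    have Fm (x y : R) : 0 < x -> x <= y -> x ^+ d * V1 x = y ^+ d * V1 y.
      move=> x0 xy; apply: (@der_cst R (fun t => t ^+ d * V1 t) x y xy) => t /andP[xt _].
      by apply: (der_eq (dF _ (lt_le_trans x0 xt))); rewrite -b0 !mul0r mulr0.
    move=> s0; rewrite -[RHS]mul1r -[X in X * V1 1](expr1n _ d).
    by have [h|/ltW h] := leP s 1; [exact: Fm|rewrite (Fm 1 s)].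
  have V11 : V1 1 = 0.
    apply/eqP; rewrite -normr_eq0 -[_ == 0]negbK; apply/negP => kn.
    have kp : 0 < `|V1 1| by rewrite lt_def kn normr_ge0.
    case: (d) Fc => [Fc|e Fc].
      pose T := 1 + (2 * A + 1) / `|V1 1|.
      have A0 : 0 <= A by have [h _] := HA ltr01; rewrite (le_trans _ h).
      have T1 : 1 < T by rewrite /T ltrDl divr_gt0//; lra.
      have [x /andP[x1 _]] := mvt T1 (fun t ht => dV t (lt_le_trans ltr01 (proj1 (andP ht)))).
      have -> : V1 x = V1 1 by rewrite -(Fc x) ?mul1r// (lt_trans ltr01).
      move=> /(congr1 Num.norm); rewrite normrM [X in _ = _ * X]gtr0_norm ?subr_gt0//.
      rewrite (_ : `|V1 1| * _ = 2 * A + 1); last by rewrite /T; field.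
      move=> E; have := ler_normB (V T) (V 1).
      have [_ h1] := HA ltr01; have [_ h2] := HA (lt_trans ltr01 T1).
      by rewrite E; lra.
    have C0 : 0 <= C.
      have [h _ _] := HC 1 (introT andP (conj ltr01 (lexx _))).
      by rewrite (le_trans _ h).
    pose t := Num.min 1 (`|V1 1| / (2 * (C + 1))).
    have t0 : 0 < t by rewrite lt_min ltr01 divr_gt0// mulr_gt0// ltr_wpDl.
    have t1 : t <= 1 by rewrite ge_min lexx.
    have tk : t <= `|V1 1| / (2 * (C + 1)) by rewrite ge_min lexx orbT.
    have [_ h _] := HC t (introT andP (conj t0 t1)).
    have := congr1 Num.norm (Fc _ t0); rewrite normrM ger0_norm ?exprn_ge0 ?(ltW t0)//.
    have : t ^+ e.+1 * `|V1 t| <= t * C.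
      apply: ler_pM => //; first by rewrite exprn_ge0 ?(ltW t0).
      by rewrite exprS ler_piMr ?(ltW t0)// exprn_ile1// ltW.
    have : t * (C + 1) <= `|V1 1| / 2.
      move: tk; rewrite invfM mulrA ler_pdivlMr//; lra.
    by move=> h1 h2 h3; nra.
  exists (V 1); split=> [s s0|_]; last by move: b0; rewrite /b; lra.
  have V10 t : 0 < t -> V1 t = 0.
    move=> t0; have := Fc _ t0; rewrite V11 => /eqP.
    by rewrite mulf_eq0 expf_eq0 (gt_eqF t0) andbF => /eqP.
  have Vm (x y : R) : 0 < x -> x <= y -> V x = V y.
    move=> x0 xy; apply: der_cst => // t /andP[xt _].
    have t0 := lt_le_trans x0 xt; rewrite -(V10 _ t0); exact: dV.
  by have [h|/ltW h] := leP s 1; [exact: Vm|rewrite (Vm 1 s)].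
exists 0; split=> [s s0|]; last by rewrite eqxx.
apply/eqP; rewrite -normr_eq0 -[_ == 0]negbK; apply/negP => kn.
have kp : 0 < `|V s| by rewrite lt_def kn normr_ge0.
pose S t := t ^+ d * V1 t * V t.
have dS (t : R) : 0 < t -> is_derive t 1 S
    (t ^+ d * (V1 t ^+ 2 + b * `|V t| `^ (2 * q + 4))).
  move=> t0; apply: (der_eq (derM (dF _ t0) (dV _ t0))).
  rewrite (_ : 2 * q + 4 = 2 * q + 2 + 2); last by ring.
  by rewrite (powRS2 _ (s := 2 * q + 2)); [ring|lra].
have S0 (t : R) : 0 < t -> 0 <= S t.
  move=> t0; rewrite leNgt; apply/negP => St.
  have C0 : 0 <= C.
    have [h _ _] := HC 1 (introT andP (conj ltr01 (lexx _))).
    by rewrite (le_trans _ h).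
  pose x := Num.min (Num.min t 1) (- S t / (C + 1)).
  have x0 : 0 < x.
    by rewrite !lt_min t0 ltr01 divr_gt0 ?oppr_gt0// ltr_wpDl.
  have xt : x <= t by rewrite !ge_min lexx.
  have x1 : x <= 1 by rewrite !ge_min lexx orbT.
  have xS : x <= - S t / (C + 1) by rewrite !ge_min lexx orbT.
  have [_ _] := HC x (introT andP (conj x0 x1)).
  rewrite UV1// UV// (_ : x ^+ d * _ = 2 * S x); last by rewrite /S; ring.
  have : S x <= S t.
    apply: (der_ndecr xt (fun y hy => dS y (lt_le_trans x0 (proj1 (andP hy))))).
    move=> y /andP[xy _]; have y0 := lt_trans x0 xy.
    by rewrite mulr_ge0 ?exprn_ge0 ?(ltW y0)// addr_ge0 ?sqr_ge0// mulr_ge0 ?powR_ge0 ?(ltW bp).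
  move: xS; rewrite ler_pdivlMr ?ltr_wpDl// ler_norml => h1 h2 /andP[h3 _].
  by nra.
have Vm (t : R) : s <= t -> `|V s| <= `|V t|.
  move=> st; have : V s ^+ 2 <= V t ^+ 2.
    apply: (der_ndecr st (fun y hy => derX 2 (dV y (lt_le_trans s0 (proj1 (andP hy)))))).
    move=> y /andP[sy _]; have y0 := lt_trans s0 sy.
    have yd : 0 < y ^+ d by rewrite exprn_gt0.
    rewrite /= expr1 -(pmulr_rge0 _ yd).
    rewrite (_ : y ^+ d * _ = 2 * S y); last by rewrite /S; ring.
    by rewrite mulr_ge0// S0.
  by rewrite -(real_normK (num_real (V s))) -(real_normK (num_real (V t)))
    ler_sqr ?nnegrE.
pose m := b * `|V s| `^ (2 * q + 4) / d.+1%:R.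
have m0 : 0 < m by rewrite divr_gt0// mulr_gt0// powR_gt0.
have Sm (t : R) : s <= t -> m * t ^+ d * (t - s) <= S t.
  move=> st; have t0 := lt_le_trans s0 st.
  have : S s - m * s ^+ d.+1 <= S t - m * t ^+ d.+1.
    apply: (der_ndecr st (fun y hy => derB (dS y (lt_le_trans s0 (proj1 (andP hy))))
      (derZ m (is_derive_pow d.+1 (lt_le_trans s0 (proj1 (andP hy))))))).
    move=> y /andP[sy _]; have y0 := lt_trans s0 sy.
    rewrite (_ : m * _ = y ^+ d * (b * `|V s| `^ (2 * q + 4))); last first.
      have : d.+1%:R != 0 :> R by rewrite pnatr_eq0.
      rewrite /m exprS; move: (d.+1%:R : R) => k k0; field.
      by rewrite k0 (gt_eqF y0).
    rewrite -mulrBr mulr_ge0 ?exprn_ge0 ?(ltW y0)//.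
    have : b * `|V s| `^ (2 * q + 4) <= b * `|V y| `^ (2 * q + 4).
      rewrite ler_wpM2l ?(ltW bp)// ler_powRl//; [lra|by rewrite Vm// ltW].
    have := sqr_ge0 (V1 y); lra.
  have : m * s ^+ d.+1 <= m * (t ^+ d * s).
    rewrite ler_wpM2l ?(ltW m0)// exprSr ler_wpM2r ?(ltW s0)//.
    by rewrite lerXn2r ?nnegrE// ltW.
  by have := S0 _ s0; rewrite !exprSr; lra.
have Vg (t : R) : s <= t -> m * (t - s) ^+ 2 <= V t ^+ 2.
  move=> st.
  have D (y : R) : is_derive y 1 (fun t => m * (t - s) ^+ 2) (m * (2 * (y - s))).
    apply: (der_eq (derZ m (derX 2 (derB (derI y) (derC y s))))).
    by rewrite /= expr1; ring.
  have : V s ^+ 2 - m * (s - s) ^+ 2 <= V t ^+ 2 - m * (t - s) ^+ 2.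
    apply: (der_ndecr st (fun y hy => derB
      (derX 2 (dV y (lt_le_trans s0 (proj1 (andP hy))))) (D y))).
    move=> y /andP[sy _]; have y0 := lt_trans s0 sy.
    have yd : 0 < y ^+ d by rewrite exprn_gt0.
    rewrite /= expr1 -(pmulr_rge0 _ yd).
    have := Sm _ (ltW sy); rewrite /S; lra.
  by rewrite subrr expr0n mulr0 subr0; have := sqr_ge0 (V s); lra.
pose T := A ^+ 2 / m + 1.
have T1 : 1 <= T by rewrite /T lerDr divr_ge0 ?sqr_ge0// ltW.
have sT : s <= s + T by rewrite lerDl (le_trans _ T1).
have := Vg _ sT; rewrite addrAC subrr add0r.
have [_ h1] := HA (lt_le_trans s0 sT).
have h2 : V (s + T) ^+ 2 <= A ^+ 2.
  rewrite -(real_normK (num_real (V _))) lerXn2r ?nnegrE//.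
  by rewrite (le_trans _ h1).
have h3 : m * T = A ^+ 2 + m by rewrite /T; field; rewrite gt_eqF.
have h4 : m * T <= m * T ^+ 2.
  by rewrite ler_wpM2l ?(ltW m0)// expr2 ler_peMl// (le_trans _ T1).
lra.
Qed.

End Core.

Definition constant_pair beta U V := exists c sg, [/\ sg = 1 \/ sg = -1,
  forall s, 0 < s -> U s = c /\ V s = sg * c & c != 0 -> beta = -1].

(** The property of the limit functions that is left of the finite zero
    numbers. *)
Definition eventually_signed (W : R -> R) := exists2 r, 0 < r &
  (forall s, r <= s -> 0 <= W s) \/ (forall s, r <= s -> W s <= 0).

Lemma regular_at_zero_swap d U V U1 V1 : regular_at_zero d U V U1 V1 ->
  regular_at_zero d V U V1 U1.
Proof.
by move=> [C HC]; exists C => s /HC[? ? ?]; split=> //; rewrite addrC.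
Qed.

Lemma regular_at_zero_oppl d U V U1 V1 : regular_at_zero d U V U1 V1 ->
  regular_at_zero d (fun s => - U s) V (fun s => - U1 s) V1.
Proof.
by move=> [C HC]; exists C => s /HC[? ? ?]; split; rewrite ?normrN// mulrNN.
Qed.

(** The sign changes U -> - U, V -> - V and the exchange of U and V reduce to
    the case U >= V >= 0 near infinity. *)
Theorem liouville d beta A U V U1 V1 :
  -1 < q -> (d <= 2)%N -> (d%:R - 1) * (q + 1) < 2 ->
  limit_system d beta U V U1 V1 -> regular_at_zero d U V U1 V1 ->
  (forall s, 0 < s -> `|U s| <= A /\ `|V s| <= A) ->
  eventually_signed U -> eventually_signed V ->
  eventually_signed (fun s => U s - V s) ->
  eventually_signed (fun s => U s + V s) ->
  constant_pair beta U V.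
Proof.
move=> hq d2 hd.
have core U' V' U1' V1' r : 0 < r -> limit_system d beta U' V' U1' V1' ->
    regular_at_zero d U' V' U1' V1' ->
    (forall s, 0 < s -> `|U' s| <= A /\ `|V' s| <= A) ->
    (forall s, r <= s -> 0 <= V' s) -> (forall s, r <= s -> V' s <= U' s) ->
    constant_pair beta U' V'.
  move=> r0 H Hreg HA V0 VU.
  have dec C r1 : 0 <= C -> 0 < r1 -> (forall s, r1 <= s ->
      `|U' s| <= C * s `^ (- al) /\ `|V' s| <= C * s `^ (- al)) ->
      constant_pair beta U' V'.
    move=> C0 r10 h; exists 0, 1; split; [by left| |by rewrite eqxx].
    rewrite mulr0; apply: (decaying_solution_eq0 hq hd H Hreg HA r10 C0).
      by move=> s /h[].
    by move=> s /h[].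
  have [b1|b1] := ltP (-1) beta.
    have [C C0 h] := decay_of_gt hq d2 r0 H V0 VU b1.
    exact: (dec C r).
  have [UV|[C [r1 [C0 r10 h]]]] := decay_or_eq hq d2 r0 H HA V0 VU b1.
    have [c [Vc cb]] := eq_solution_const hq H HA b1 UV Hreg.
    exists c, 1; split; [by left| |by []] => s s0.
    by rewrite UV// Vc// mul1r.
  exact: (dec C r1).
have core2 U' V' U1' V1' : limit_system d beta U' V' U1' V1' ->
    regular_at_zero d U' V' U1' V1' ->
    (forall s, 0 < s -> `|U' s| <= A /\ `|V' s| <= A) ->
    (exists2 r, 0 < r & forall s, r <= s -> 0 <= U' s) ->
    (exists2 r, 0 < r & forall s, r <= s -> 0 <= V' s) ->
    eventually_signed (fun s => U' s - V' s) ->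
    constant_pair beta U' V'.
  move=> H Hreg HA [r1 r10 U0] [r2 r20 V0] [r3 r30 h].
  pose r := Num.max (Num.max r1 r2) r3.
  have rr1 s : r <= s -> r1 <= s by rewrite !ge_max => /andP[/andP[]].
  have rr2 s : r <= s -> r2 <= s by rewrite !ge_max => /andP[/andP[]].
  have rr3 s : r <= s -> r3 <= s by rewrite !ge_max => /andP[].
  have r0 : 0 < r by rewrite !lt_max r10.
  case: h => h.
    apply: (core _ _ _ _ r r0 H) => // s rs; first by apply: V0; exact: rr2.
    by rewrite -subr_ge0 h// rr3.
  have [|||c [sg [h1 h2 h3]]] :=
      core _ _ _ _ r r0 (limit_system_swap H) (regular_at_zero_swap Hreg).
  - by move=> s /HA[].
  - by move=> s rs; apply: U0; exact: rr1.
  - by move=> s rs; rewrite -subr_le0 h// rr3.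
  exists (sg * c), sg; split=> //.
    move=> s /h2[-> ->]; split=> //.
    by case: h1 => ->; ring.
  by rewrite mulf_eq0 negb_or => /andP[_].
have core3 U' V' U1' V1' : limit_system d beta U' V' U1' V1' ->
    regular_at_zero d U' V' U1' V1' ->
    (forall s, 0 < s -> `|U' s| <= A /\ `|V' s| <= A) ->
    eventually_signed U' ->
    (exists2 r, 0 < r & forall s, r <= s -> 0 <= V' s) ->
    eventually_signed (fun s => U' s - V' s) ->
    eventually_signed (fun s => U' s + V' s) ->
    constant_pair beta U' V'.
  move=> H Hreg HA [r r0 [U0|U0]] V0 hm hp.
    by apply: (core2 _ _ _ _ H) => //; exists r.
  have [|||c [sg [h1 h2 h3]]] :=
      core2 _ _ _ _ (limit_system_oppl H) (regular_at_zero_oppl Hreg) _ _ V0.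
  - by move=> s /HA[]; rewrite normrN.
  - by exists r => // s /U0; rewrite oppr_ge0.
  - case: hp => r' r'0 h; exists r' => //; case: h => h; [right|left] => s /h; lra.
  exists (- c), (- sg); split.
  - by case: h1 => ->; [right|left; rewrite opprK].
  - by move=> s /h2[h4 ->]; rewrite -h4; split; ring.
  - by rewrite oppr_eq0.
move=> H Hreg HA hU [r r0 [V0|V0]] hm hp.
  by apply: (core3 _ _ _ _ H) => //; exists r.
have Hreg' := regular_at_zero_swap (regular_at_zero_oppl (regular_at_zero_swap Hreg)).
have [||||c [sg [h1 h2 h3]]] :=
    core3 _ _ _ _ (limit_system_oppr H) Hreg' _ hU.
- by move=> s /HA[]; rewrite normrN.
- by exists r => // s /V0; rewrite oppr_ge0.
- by case: hp => r' r'0 h; exists r' => //; case: h => h; [left|right] => s /h; lra.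
- exact: hm.
exists c, (- sg); split=> //.
- by case: h1 => ->; [right|left; rewrite opprK].
- by move=> s /h2[h4 h5]; split=> //; rewrite mulNr -h5 opprK.
Qed.

End LiouvilleTheorem.

(** * Limits along an ultrafilter *)

Lemma ultra_ex (F : set_system nat) (P : set nat) :
  UltraFilter F -> F P -> exists k, P k.
Proof. by move=> FU; exact: filter_ex. Qed.

Lemma ultraI (F : set_system nat) (P Q : set nat) :
  UltraFilter F -> F P -> F Q -> F (P `&` Q).
Proof. by move=> FU; exact: filterI. Qed.

Section UltraLimits.
Variables (R : realType) (F : set_system nat).
Hypothesis FU : UltraFilter F.
Implicit Types (x : nat -> R) (l e s : R).

(** Convergence of a real sequence along F, in epsilon form. *)
Definition ulim x l := forall e, 0 < e -> F [set k | `|x k - l| < e].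

Lemma ulim_exists x (A : R) : F [set k | `|x k| <= A] -> exists l, ulim x l.
Proof.
move=> HA; have FP : ProperFilter (x @ F) by exact: fmap_proper_filter.
have [|p [_ cp]] := @segment_compact R (- A) A (x @ F) FP.
  change (F (x @^-1` [set` `[- A, A]%R])).
  by apply: filterS HA => k /=; rewrite in_itv /= ler_norml.
exists p => e e0.
have [//|N] := in_ultra_setVsetC [set k | `|x k - p| < e] FU.
have [||y [ny /= yp]] := cp (~` [set y | `|y - p| < e]) [set y | `|y - p| < e].
- by [].
- by apply/nbhs_ballP; exists e => //= z; rewrite /ball /= distrC.
- by [].
Qed.

Lemma ulim_le x l (A : R) : ulim x l -> F [set k | x k <= A] -> l <= A.
Proof.
move=> xl HA; apply/ler_addgt0Pr => e e0.
have [k [/= h1 h2]] := ultra_ex FU (ultraI FU HA (xl e e0)).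
by move: h2; rewrite ltr_norml => /andP[h2 _]; lra.
Qed.

Lemma ulim_norm_le x l (A : R) : ulim x l -> F [set k | `|x k| <= A] -> `|l| <= A.
Proof.
move=> xl HA; apply/ler_addgt0Pr => e e0.
have [k [/= h1 h2]] := ultra_ex FU (ultraI FU HA (xl e e0)).
by move: h1 h2; rewrite ltr_norml !ler_norml => /andP[? ?] /andP[? ?];
  apply/andP; split; lra.
Qed.

(** If the derivatives of y_k are close to l near s for most k, the difference
    quotients of y_k at s are close to l by the mean value theorem, and this
    survives pointwise limits. *)
Lemma ulim_derive (y y' : nat -> R -> R) (Y : R -> R) s l d0 : 0 < d0 ->
  (forall t, `|t - s| < d0 -> ulim (fun k => y k t) (Y t)) ->
  (forall e, 0 < e -> exists2 d, 0 < d & F [set k | forall t, `|t - s| < d ->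
     is_derive t 1 (y k) (y' k t) /\ `|y' k t - l| <= e]) ->
  is_derive s 1 Y l.
Proof.
move=> d00 HY H; apply/is_derive1P => e e0.
have [d dp HF] := H e e0.
exists (Num.min d d0); first by rewrite lt_min dp.
move=> h; rewrite lt_min => /andP[hd hd0].
apply/ler_addgt0Pr => z z0; have z2 : 0 < z / 2 by rewrite divr_gt0.
have l1 : ulim (fun k => y k (s + h)) (Y (s + h)) by apply: HY; rewrite addrAC subrr add0r.
have l2 : ulim (fun k => y k s) (Y s) by apply: HY; rewrite subrr normr0.
have [k [/= hk [/= k1 k2]]] := ultra_ex FU (ultraI FU HF (ultraI FU (l1 _ z2) (l2 _ z2))).
have M : `|y k (s + h) - y k s - l * h| <= e * `|h|.
  pose g t := y k t - l * t.
  have Dg t : `|t - s| < d -> is_derive t 1 g (y' k t - l).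
    move=> /hk[D _]; apply: (der_eq (derB D (derZ l (derI t)))).
    by rewrite mulr1.
  have -> : y k (s + h) - y k s - l * h = g (s + h) - g s by rewrite /g; ring.
  have hs : `|s + h - s| = `|h| by rewrite addrAC subrr add0r.
  rewrite -hs; apply: (der_lip_ball (df := fun t => y' k t - l)) => t; rewrite hs => th.
    by apply: Dg; exact: le_lt_trans th hd.
  by have [] := hk _ (le_lt_trans th hd).
move: k1 k2 M; rewrite !ltr_norml !ler_norml => /andP[? ?] /andP[? ?] /andP[? ?].
by apply/andP; split; lra.
Qed.

(** The points sk may tend to s = 0, where nothing is assumed on the limit:
    compare with the value at s + tau and use the Lipschitz bound. *)
Lemma ulim_moving_point (y : nat -> R -> R) (sk : nat -> R) s c (C T : R) :
  0 <= C -> 0 <= s -> s < T ->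
  ulim sk s -> F [set k | 0 <= sk k <= T] ->
  (forall t, 0 < t -> ulim (fun k => y k t) c) ->
  F [set k | forall a b, 0 <= a <= T -> 0 <= b <= T -> `|y k a - y k b| <= C * `|a - b|] ->
  ulim (fun k => y k (sk k)) c.
Proof.
move=> C0 s0 sT Hs HT Hy HL e e0.
pose tau := Num.min ((T - s) / 2) (e / (4 * (C + 1))).
have C1 : 0 < 4 * (C + 1) by rewrite mulr_gt0// ltr_wpDl.
have tau0 : 0 < tau by rewrite lt_min !divr_gt0// subr_gt0.
have t1 : tau <= (T - s) / 2 by rewrite ge_min lexx.
have t2 : tau * (4 * (C + 1)) <= e by rewrite -ler_pdivlMr// ge_min lexx orbT.
have st0 : 0 < s + tau by lra.
have e2 : 0 < e / 4 by rewrite divr_gt0.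
apply: filterS (ultraI FU (ultraI FU (Hs _ tau0) HT) (ultraI FU (Hy _ st0 _ e2) HL)).
move=> k /= [[h1 h2] [h3 h4]].
have h5 : 0 <= s + tau <= T by apply/andP; split; lra.
have := h4 _ _ h2 h5.
have h6 : `|sk k - (s + tau)| <= 2 * tau.
  by move: h1; rewrite ltr_norml ler_norml => /andP[? ?]; apply/andP; split; lra.
have h7 : C * `|sk k - (s + tau)| <= C * (2 * tau) by rewrite ler_wpM2l.
have h8 : C * (2 * tau) <= e / 2 by nra.
move=> h9; have {h7 h8} h9 := le_trans h9 (le_trans h7 h8).
by move: h9 h3; rewrite !ltr_norml ler_norml => /andP[? ?] /andP[? ?];
  apply/andP; split; lra.
Qed.

End UltraLimits.

(** One equation W'' = - a1 W' - g.  The bounds make W' equicontinuous near s,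
    which identifies the limit of W'; then the right-hand side is nearly constant
    near s, which identifies the limit of W''. *)
Lemma limit_of_derivative (R : realType) (F : set_system nat) (FU : UltraFilter F)
    (d : nat) (W W1 a1 g : nat -> R -> R) (Wl W1l : R -> R) (s gl : R) :
  0 < s ->
  (forall t, 0 < t -> ulim F (fun k => W k t) (Wl t)) ->
  (exists C de, [/\ 0 <= C, 0 < de & F [set k | forall t, `|t - s| < de ->
    [/\ is_derive t 1 (W k) (W1 k t), `|W1 k t| <= C,
        is_derive t 1 (W1 k) (- a1 k t * W1 k t - g k t),
        `|a1 k t| <= C & `|g k t| <= C]]]) ->
  (forall t, 0 < t -> ulim F (fun k => W1 k t) (W1l t)) ->
  (forall e, 0 < e -> exists2 de, 0 < de & F [set k | forall t, `|t - s| < de ->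
     `|a1 k t - d%:R / s| <= e]) ->
  (forall e, 0 < e -> exists2 de, 0 < de & F [set k | forall t, `|t - s| < de ->
     `|g k t - gl| <= e]) ->
  is_derive s 1 Wl (W1l s) /\ is_derive s 1 W1l (- (d%:R / s) * W1l s - gl).
Proof.
move=> s0 HW [C [de [C0 de0 HC]]] HW1 Hal Hg.
have HW1s := HW1 _ s0.
have near_pos (t : R) : `|t - s| < s -> 0 < t.
  by rewrite ltr_norml => /andP[? ?]; lra.
pose K := C * C + C.
have K0 : 0 <= K by rewrite addr_ge0// mulr_ge0.
have L e : 0 < e -> exists2 d1, 0 < d1 & F [set k | forall t, `|t - s| < d1 ->
    `|W1 k t - W1l s| <= e].
  move=> e0; have e2 : 0 < e / 2 by rewrite divr_gt0.
  exists (Num.min de (e / (2 * (K + 1)))).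
    by rewrite lt_min de0 divr_gt0// mulr_gt0// ltr_wpDl.
  apply: filterS (ultraI FU HC (HW1s _ e2)) => k /= [hk h1] t.
  rewrite lt_min => /andP[td tK].
  have : `|W1 k t - W1 k s| <= K * `|t - s|.
    apply: (der_lip_ball (df := fun t => - a1 k t * W1 k t - g k t)) => z zt;
      have [_ b1 D b2 b3] := hk _ (le_lt_trans zt td); first exact: D.
    apply: (le_trans (ler_normB _ _)); rewrite normrM normrN lerD//.
    exact: ler_pM.
  have h2 : K * `|t - s| <= e / 2.
    move: tK; rewrite ltr_pdivlMr ?mulr_gt0 ?ltr_wpDl//.
    by have := normr_ge0 (t - s); nra.
  move=> h3; have h4 := ler_distD (W1 k s) (W1 k t) (W1l s).
  by apply: (le_trans h4); clear - h1 h2 h3; rewrite /= in h1; lra.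
split.
  apply: (@ulim_derive R F FU W W1 Wl s (W1l s) s s0) => [t /near_pos/HW//|e e0].
  have [d1 d10 H1] := L e e0.
  exists (Num.min d1 de); first by rewrite lt_min d10.
  apply: filterS (ultraI FU H1 HC) => k /= [k1 k2] t; rewrite lt_min => /andP[t1 t2].
  by split; [case: (k2 _ t2)|exact: k1].
apply: (@ulim_derive R F FU W1 (fun k t => - a1 k t * W1 k t - g k t) W1l s _ s s0)
  => [t /near_pos/HW1//|e e0].
pose al : R := d%:R / s.
pose B := C + `|al| + `|W1l s| + 1.
have B0 : 0 < B by rewrite /B ltr_wpDl// !addr_ge0.
have e1 : 0 < e / (4 * B) by rewrite divr_gt0// mulr_gt0.
have e2 : 0 < e / 2 by rewrite divr_gt0.
have [d1 d10 H1] := L _ e1.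
have [d2 d20 H2] := Hal _ e1.
have [d3 d30 H3] := Hg _ e2.
exists (Num.min (Num.min d1 de) (Num.min d2 d3)).
  by rewrite !lt_min d10 de0 d20.
apply: filterS (ultraI FU (ultraI FU H1 HC) (ultraI FU H2 H3)) => k /= [[k1 k2] [k3 k4]] t.
rewrite !lt_min => /andP[/andP[t1 t2] /andP[t3 t4]].
have [_ b1 D b2 b3] := k2 _ t2.
split=> //; have := k1 _ t1; have := k3 _ t3; have := k4 _ t4.
rewrite -/al => h4 h3 h1.
have -> : - a1 k t * W1 k t - g k t - (- al * W1l s - gl) =
  - ((a1 k t - al) * W1 k t) - al * (W1 k t - W1l s) - (g k t - gl) by ring.
apply: (le_trans (ler_normB _ _)).
have p1 : `|- ((a1 k t - al) * W1 k t) - al * (W1 k t - W1l s)| <=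
   e / (4 * B) * B + B * (e / (4 * B)).
  apply: (le_trans (ler_normB _ _)).
  rewrite normrN (normrM _ (W1 k t)) (normrM al); apply: lerD.
    apply: ler_pM => //; apply: (le_trans b1).
    by have := normr_ge0 al; have := normr_ge0 (W1l s); rewrite /B; clear; lra.
  apply: ler_pM => //.
  by have := normr_ge0 (W1l s); rewrite /B; clear - C0; lra.
have p2 : e / (4 * B) * B + B * (e / (4 * B)) = e / 2 by field; rewrite gt_eqF.
by move: p1; rewrite p2; clear - h4; lra.
Qed.

Theorem ultralimit_solves (R : realType) (F : set_system nat) (FU : UltraFilter F)
    (q lambda gamma A : R) (d : nat) (beta eps : nat -> R)
    (a U V U1 V1 : nat -> R -> R) (beta0 : R) :
  let f := nonlinearity q in
  -1 < q -> ulim F beta beta0 -> ulim F eps 0 ->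
  (forall s, 0 < s -> forall e, 0 < e -> exists2 de : R, 0 < de &
    F [set k | forall t, `|t - s| < de -> `|a k t - d%:R / s| <= e]) ->
  (forall T : R, 0 < T -> exists2 C : R, 0 <= C & F [set k | forall s, 0 < s <= T ->
    [/\ [/\ is_derive s 1 (U k) (U1 k s),
       is_derive s 1 (U1 k) (- a k s * U1 k s - f (beta k) (U k s) (V k s)
          + eps k * (lambda * U k s + gamma * V k s)),
       is_derive s 1 (V k) (V1 k s)
     & is_derive s 1 (V1 k) (- a k s * V1 k s - f (beta k) (V k s) (U k s)
          + eps k * (lambda * V k s + gamma * U k s))],
       `|U k s| <= A /\ `|V k s| <= A & `|U1 k s| <= C /\ `|V1 k s| <= C]]) ->
  (exists2 C : R, 0 <= C & forall s : R, 0 < s <= 1 -> forall e, 0 < e ->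
    F [set k | `|s ^+ d * (U k s * U1 k s + V k s * V1 k s)| <= C * s + e]) ->
  exists Ul Vl U1l V1l : R -> R,
  [/\ forall s, 0 < s -> ulim F (fun k => U k s) (Ul s) /\ ulim F (fun k => V k s) (Vl s),
      limit_system q d beta0 Ul Vl U1l V1l, regular_at_zero d Ul Vl U1l V1l
    & forall s, 0 < s -> `|Ul s| <= A /\ `|Vl s| <= A].
Proof.
move=> f hq Hbeta Heps Ha HT Hreg.
have ex (W : nat -> R -> R) : (forall s, 0 < s -> exists C, F [set k | `|W k s| <= C]) ->
    {Wl : R -> R | forall s, 0 < s -> ulim F (fun k => W k s) (Wl s)}.
  move=> H; have H' s : exists l, 0 < s -> ulim F (fun k => W k s) l.
    have [/H[C hC]|_] := ltP 0 s; last by exists 0.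
    by have [l hl] := ulim_exists FU hC; exists l.
  by exists (fun s => sval (cid (H' s))) => s; exact: (svalP (cid (H' s))).
have one (s : R) : 0 < s -> 0 < s <= s by move=> ->; rewrite lexx.
have [Ul HU] : {Wl : R -> R | forall s, 0 < s -> ulim F (fun k => U k s) (Wl s)}.
  apply: ex => s s0; exists A; have [C _ HC] := HT _ s0.
  by apply: filterS HC => k /= /(_ _ (one _ s0))[_ []].
have [Vl HV] : {Wl : R -> R | forall s, 0 < s -> ulim F (fun k => V k s) (Wl s)}.
  apply: ex => s s0; exists A; have [C _ HC] := HT _ s0.
  by apply: filterS HC => k /= /(_ _ (one _ s0))[_ []].
have [U1l HU1] : {Wl : R -> R | forall s, 0 < s -> ulim F (fun k => U1 k s) (Wl s)}.
  apply: ex => s s0; have [C _ HC] := HT _ s0; exists C.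
  by apply: filterS HC => k /= /(_ _ (one _ s0))[_ _ []].
have [V1l HV1] : {Wl : R -> R | forall s, 0 < s -> ulim F (fun k => V1 k s) (Wl s)}.
  apply: ex => s s0; have [C _ HC] := HT _ s0; exists C.
  by apply: filterS HC => k /= /(_ _ (one _ s0))[_ _ []].
have HA (s : R) : 0 < s -> `|Ul s| <= A /\ `|Vl s| <= A.
  move=> s0; have [C _ HC] := HT _ s0; split.
    apply: (ulim_norm_le FU (HU _ s0)).
    by apply: filterS HC => k /= /(_ _ (one _ s0))[_ []].
  apply: (ulim_norm_le FU (HV _ s0)).
  by apply: filterS HC => k /= /(_ _ (one _ s0))[_ []].
exists Ul, Vl, U1l, V1l; split=> //; first by move=> s s0; split; [exact: HU|exact: HV].
- move=> s s0.
  have s20 : 0 < 2 * s by rewrite mulr_gt0.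
  have [C C0 HC] := HT _ s20.
  have nr (t : R) : `|t - s| < s / 2 -> 0 < t <= 2 * s.
    by rewrite ltr_norml => /andP[? ?]; apply/andP; split; lra.
  have sh : 0 < s / 2 by rewrite divr_gt0.
  have A0 : 0 <= A by have [h _] := HA _ s0; rewrite (le_trans _ h).
  pose B := (1 + (`|beta0| + 1)) * A `^ (2 * q + 3).
  have B0 : 0 <= B by rewrite mulr_ge0 ?powR_ge0// !addr_ge0.
  pose D := (`|lambda| + `|gamma|) * A.
  have D0 : 0 <= D by rewrite mulr_ge0// addr_ge0.
  pose Lin (x y : R) := lambda * x + gamma * y.
  have LinB (x y : R) : `|x| <= A -> `|y| <= A -> `|Lin x y| <= D.
    move=> hx hy; apply: (le_trans (ler_normD _ _)); rewrite !normrM /D mulrDl lerD//.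
      by rewrite ler_wpM2l.
    by rewrite ler_wpM2l.
  pose g (W W' : nat -> R -> R) k t := f (beta k) (W k t) (W' k t) - eps k * Lin (W k t) (W' k t).
  pose C2 := C + (B + D) + (`|d%:R / s| + 1).
  have C20 : 0 <= C2 by rewrite !addr_ge0.
  have [da da0 Hda] := Ha _ s0 _ ltr01.
  have gb (W W' : nat -> R -> R) k (t : R) : `|beta k - beta0| < 1 -> `|eps k - 0| < 1 ->
      `|W k t| <= A -> `|W' k t| <= A -> `|g W W' k t| <= B + D.
    move=> hb he h1 h2; apply: (le_trans (ler_normB _ _)); apply: lerD.
      apply: (le_trans (nonlinearity_bound hq (beta k) h1 h2)).
      rewrite ler_wpM2r ?powR_ge0// lerD2l.
      by have := ler_normD (beta k - beta0) beta0; rewrite subrK; lra.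
    rewrite normrM -[leRHS]mul1r; apply: ler_pM => //; last exact: LinB.
    by move: he; rewrite subr0 => /ltW.
  have gl (W W' : nat -> R -> R) (W1 W1' : nat -> R -> R) (Wl Wl' : R -> R) :
      ulim F (fun k => W k s) (Wl s) -> ulim F (fun k => W' k s) (Wl' s) ->
      F [set k | forall t, 0 < t <= 2 * s -> [/\ is_derive t 1 (W k) (W1 k t),
         is_derive t 1 (W' k) (W1' k t), `|W k t| <= A /\ `|W' k t| <= A &
         `|W1 k t| <= C /\ `|W1' k t| <= C]] ->
      forall e, 0 < e -> exists2 de, 0 < de & F [set k | forall t, `|t - s| < de ->
        `|g W W' k t - f beta0 (Wl s) (Wl' s)| <= e].
    move=> hW hW' hF e e0; have e2 : 0 < e / 2 by rewrite divr_gt0.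
    have [d1 d10 Hd1] := nonlinearity_continuous hq beta0 (Wl s) (Wl' s) e2.
    have d12 : 0 < d1 / 2 by rewrite divr_gt0.
    pose de := Num.min (s / 2) (d1 / (2 * (C + 1))).
    have de0 : 0 < de by rewrite lt_min sh divr_gt0// mulr_gt0// ltr_wpDl.
    exists de => //.
    have ee : 0 < e / (2 * (D + 1)) by rewrite divr_gt0// mulr_gt0// ltr_wpDl.
    apply: filterS (ultraI FU (ultraI FU (hW _ d12) (hW' _ d12))
      (ultraI FU hF (ultraI FU (Hbeta _ d10) (Heps _ ee)))).
    move=> k /= [[k1 k2] [k3 [k4 k5]]] t td.
    have ts2 : `|t - s| < s / 2 by apply: (lt_le_trans td); rewrite ge_min lexx.
    have tC : `|t - s| * (2 * (C + 1)) < d1.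
      rewrite -ltr_pdivlMr ?mulr_gt0 ?ltr_wpDl//.
      by apply: (lt_le_trans td); rewrite ge_min lexx orbT.
    have lip (Z Z1 : R -> R) : (forall t, 0 < t <= 2 * s -> is_derive t 1 Z (Z1 t)) ->
        (forall t, 0 < t <= 2 * s -> `|Z1 t| <= C) -> `|Z t - Z s| <= C * `|t - s|.
      move=> DZ BZ; apply: (der_lip_ball (df := Z1)) => z zt;
        have zs := nr _ (le_lt_trans zt ts2); [exact: DZ|exact: BZ].
    have l1 : `|W k t - W k s| <= C * `|t - s|.
      by apply: (lip _ (W1 k)) => x /k3[? ? ? []].
    have l2 : `|W' k t - W' k s| <= C * `|t - s|.
      by apply: (lip _ (W1' k)) => x /k3[? ? ? []].
    have Cd : C * `|t - s| <= d1 / 2 by have := normr_ge0 (t - s); clear - tC C0; nra.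
    have tri (x y z : R) : `|x - y| <= d1 / 2 -> `|y - z| < d1 / 2 -> `|x - z| < d1.
      move=> h1 h2; apply: (le_lt_trans (ler_distD y x z)); rewrite [ltRHS]splitr.
      exact: ler_ltD.
    have fc := Hd1 _ _ _ k4 (tri _ _ _ (le_trans l1 Cd) k1) (tri _ _ _ (le_trans l2 Cd) k2).
    have [_ _ [b1 b2] _] := k3 _ (nr _ ts2).
    rewrite /g addrAC; apply: (le_trans (ler_normB _ _)).
    suff : `|eps k * Lin (W k t) (W' k t)| <= e / 2 by clear - fc; lra.
    rewrite normrM; apply: (@le_trans _ _ (e / (2 * (D + 1)) * (D + 1))); last first.
      by rewrite le_eqVlt; apply/orP; left; apply/eqP; field; clear - D0; lra.
    apply: ler_pM => //; first by move: k5; rewrite subr0 => /ltW.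
    by rewrite (le_trans (LinB _ _ b1 b2))// lerDl.
  have bnds (W W' W1 : nat -> R -> R) :
      F [set k | forall t, 0 < t <= 2 * s -> [/\ is_derive t 1 (W k) (W1 k t),
         is_derive t 1 (W1 k) (- a k t * W1 k t - g W W' k t),
         `|W k t| <= A /\ `|W' k t| <= A & `|W1 k t| <= C]] ->
      exists C de, [/\ 0 <= C, 0 < de & F [set k | forall t, `|t - s| < de ->
        [/\ is_derive t 1 (W k) (W1 k t), `|W1 k t| <= C,
            is_derive t 1 (W1 k) (- a k t * W1 k t - g W W' k t),
            `|a k t| <= C & `|g W W' k t| <= C]]].
    move=> hF; exists C2, (Num.min (s / 2) da); split=> //; first by rewrite lt_min sh.
    apply: filterS (ultraI FU (ultraI FU hF Hda) (ultraI FU (Hbeta _ ltr01) (Heps _ ltr01))).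
    move=> k /= [[k1 k2] [k3 k4]] t; rewrite lt_min => /andP[t1 t2].
    have [D1 D2 [b1 b2] b3] := k1 _ (nr _ t1).
    have hd := normr_ge0 (d%:R / s : R).
    split=> //.
    - by apply: (le_trans b3); rewrite /C2; clear - B0 D0 hd; lra.
    - have := ler_normD (a k t - d%:R / s) (d%:R / s); rewrite subrK.
      by have := k2 _ t2; rewrite /C2; clear - B0 D0 hd C0; lra.
    - by apply: (le_trans (gb _ _ _ _ k3 k4 b1 b2)); rewrite /C2; clear - hd C0; lra.
  have [D1 D2] : is_derive s 1 Ul (U1l s) /\
      is_derive s 1 U1l (- (d%:R / s) * U1l s - f beta0 (Ul s) (Vl s)).
    apply: (@limit_of_derivative R F FU d U U1 a (g U V) Ul U1l) => //.
    - apply: bnds; apply: filterS HC => k /= h t /h[[E1 E2 _ _] ? [? ?]]; split=> //.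
      by apply: (der_eq E2); rewrite /g /Lin; ring.
    - exact: Ha.
    - apply: (@gl U V U1 V1) => //; [exact: HU|exact: HV|].
      by apply: filterS HC => k /= h t /h[[]].
  have [D3 D4] : is_derive s 1 Vl (V1l s) /\
      is_derive s 1 V1l (- (d%:R / s) * V1l s - f beta0 (Vl s) (Ul s)).
    apply: (@limit_of_derivative R F FU d V V1 a (g V U) Vl V1l) => //.
    - apply: bnds; apply: filterS HC => k /= h t /h[[_ _ E1 E2] [? ?] [? ?]]; split=> //.
      by apply: (der_eq E2); rewrite /g /Lin; ring.
    - exact: Ha.
    - apply: (@gl V U V1 U1) => //; [exact: HV|exact: HU|].
      by apply: filterS HC => k /= h t /h[[? _ ? _] [? ?] [? ?]].
  by split.
- have [C C0 HC] := HT _ ltr01.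
  have [C' C'0 HC'] := Hreg.
  exists (C + C') => s s01; have /andP[s0 s1] := s01.
  have b1 : `|U1l s| <= C.
    by apply: (ulim_norm_le FU (HU1 _ s0)); apply: filterS HC => k /= /(_ _ s01)[_ _ []].
  have b2 : `|V1l s| <= C.
    by apply: (ulim_norm_le FU (HV1 _ s0)); apply: filterS HC => k /= /(_ _ s01)[_ _ []].
  split; [lra|lra|].
  apply: (@le_trans _ _ (C' * s)); last first.
    by rewrite ler_wpM2r ?(ltW s0)// lerDr.
  apply/ler_addgt0Pr => e e0.
  have [hA1 hA2] := HA _ s0.
  pose B := A + C + 1.
  have A0 : 0 <= A by rewrite (le_trans _ hA1).
  have B0 : 0 < B by rewrite /B ltr_wpDl// addr_ge0.
  pose z := e / (8 * B).
  have z0 : 0 < z by rewrite divr_gt0// mulr_gt0.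
  have e2 : 0 < e / 2 by rewrite divr_gt0.
  have [k [[/= k1 k2] [[/= k3 k4] [/= k5 k6]]]] := ultra_ex FU (ultraI FU (ultraI FU (HU _ s0 _ z0) (HV _ s0 _ z0))
      (ultraI FU (ultraI FU (HU1 _ s0 _ z0) (HV1 _ s0 _ z0)) (ultraI FU HC (HC' _ s01 _ e2)))).
  have [_ [c1 c2] [c3 c4]] := k5 _ s01; have HCk := k6.
  have pr (x y x' y' : R) : `|x - x'| < z -> `|y - y'| < z -> `|x'| <= A -> `|y| <= C ->
      `|x * y - x' * y'| <= 2 * B * z.
    move=> h1 h2 h3 h4.
    rewrite (_ : x * y - x' * y' = (x - x') * y + x' * (y - y')); last by ring.
    apply: (le_trans (ler_normD _ _)); rewrite !normrM.
    have g1 : `|x - x'| * `|y| <= z * B.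
      by apply: ler_pM => //; [exact: ltW|rewrite /B; clear - h4 A0; lra].
    have g2 : `|x'| * `|y - y'| <= B * z.
      by apply: ler_pM => //; [rewrite /B; clear - h3 C0; lra|exact: ltW].
    by clear - g1 g2; lra.
  have p1 := pr _ _ _ _ k1 k3 hA1 c3; have p2 := pr _ _ _ _ k2 k4 hA2 c4.
  have zB : B * z = e / 8 by rewrite /z; field; rewrite gt_eqF.
  have sd : `|s ^+ d| <= 1 by rewrite ger0_norm ?exprn_ge0 ?exprn_ile1// ltW.
  pose X := U k s * U1 k s + V k s * V1 k s.
  rewrite (_ : s ^+ d * _ = s ^+ d * X -
     s ^+ d * (U k s * U1 k s - Ul s * U1l s + (V k s * V1 k s - Vl s * V1l s))); last first.
    by rewrite /X; ring.
  apply: (le_trans (ler_normB _ _)).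
  have : `|s ^+ d * (U k s * U1 k s - Ul s * U1l s + (V k s * V1 k s - Vl s * V1l s))| <= e / 2.
    rewrite normrM -[leRHS]mul1r; apply: ler_pM => //.
    by apply: (le_trans (ler_normD _ _)); clear - p1 p2 zB; lra.
  have := HCk; rewrite /X; clear; lra.
Qed.

(** * Zero numbers and oscillation *)

Section ZeroNumber.
Variable R : realType.
Implicit Types (C mu r : R) (J : set R) (w W : R -> R).

Lemma zero_number_ge J w C (j : nat) (y : nat -> R) :
  (zero_number_on J w <= C%:E)%E ->
  (forall i, (i <= j)%N -> J (y i)) -> (forall i, (i < j)%N -> y i < y i.+1) ->
  (forall i, (i < j)%N -> w (y i) * w (y i.+1) < 0) -> j%:R <= C.
Proof.
move=> H h1 h2 h3; rewrite -lee_fin; apply: le_trans H.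
by apply: ereal_sup_ubound; right; exists j => //; exists y.
Qed.

(** The rescaling reverses the order of the points when sigma = -1. *)
Lemma zero_number_ge_scaled J w C (j : nat) (sigma mu x0 : R) (s : nat -> R) :
  sigma = 1 \/ sigma = -1 -> 0 < mu ->
  (zero_number_on J w <= C%:E)%E ->
  (forall i, (i <= j)%N -> J (x0 + sigma * mu * s i)) ->
  (forall i, (i < j)%N -> s i < s i.+1) ->
  (forall i, (i < j)%N ->
    w (x0 + sigma * mu * s i) * w (x0 + sigma * mu * s i.+1) < 0) -> j%:R <= C.
Proof.
move=> hs mu0 H h1 h2 h3; case: hs h1 h3 => ->.
  move=> h1 h3; apply: (zero_number_ge H h1) => // i ij.
  by rewrite ltrD2l mul1r ltr_pM2l// h2.
move=> h1 h3.
apply: (@zero_number_ge J w C j (fun i => x0 + -1 * mu * s (j - i)%N) H).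
- by move=> i ij; apply: h1; exact: leq_subr.
- move=> i ij; rewrite ltrD2l mulN1r !mulNr ltrN2 ltr_pM2l//.
  by rewrite -(subnSK ij) h2// subnSK// leq_subr.
- move=> i ij; rewrite -(subnSK ij) mulrC h3//.
  by rewrite subnSK// leq_subr.
Qed.

(** Points where W > 0 (even rank) and W < 0 (odd rank) are picked in turn,
    each beyond the previous one. *)
Lemma alternating_points W : ~ eventually_signed W -> exists x : nat -> R,
  forall i, [/\ 0 < x i, x i < x i.+1 & W (x i) * W (x i.+1) < 0].
Proof.
move=> N.
have hp r : exists s, r < s /\ (0 < r -> 0 < W s).
  have [r0|r0] := ltP 0 r; last by exists (r + 1); rewrite ltrDl ltr01.
  apply: contrapT => H; apply: N; exists (r + 1); first by rewrite addr_gt0.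
  right => s rs; rewrite leNgt; apply/negP => Ws; apply: H; exists s; split=> //.
  by rewrite (lt_le_trans _ rs)// ltrDl.
have hm r : exists s, r < s /\ (0 < r -> W s < 0).
  have [r0|r0] := ltP 0 r; last by exists (r + 1); rewrite ltrDl ltr01.
  apply: contrapT => H; apply: N; exists (r + 1); first by rewrite addr_gt0.
  left => s rs; rewrite leNgt; apply/negP => Ws; apply: H; exists s; split=> //.
  by rewrite (lt_le_trans _ rs)// ltrDl.
pose p r := sval (cid (hp r)); pose m r := sval (cid (hm r)).
have Hp r : r < p r /\ (0 < r -> 0 < W (p r)) := svalP (cid (hp r)).
have Hm r : r < m r /\ (0 < r -> W (m r) < 0) := svalP (cid (hm r)).
pose x := fix x (i : nat) : R := if i is i'.+1 then
  (if odd i' then p (x i') else m (x i')) else p 1.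
have Hx i : 0 < x i /\ (if odd i then W (x i) < 0 else 0 < W (x i)).
  elim: i => [|i [xi0 IH]] /=.
    have [h1 h2] := Hp 1; split; last exact: h2.
    by rewrite (lt_trans _ h1).
  case: (odd i) IH => /= IH.
    by have [h1 h2] := Hp (x i); split; [rewrite (lt_trans xi0)|exact: h2].
  by have [h1 h2] := Hm (x i); split; [rewrite (lt_trans xi0)|exact: h2].
exists x => i; have [xi0 h] := Hx i; have [_ h'] := Hx i.+1; split=> //.
  by rewrite /=; case: ifP => _; [case: (Hp (x i))|case: (Hm (x i))].
move: h h'; rewrite [odd i.+1]/=; case: (odd i) => /= h h'.
  by rewrite nmulr_rlt0.
by rewrite pmulr_rlt0.
Qed.

End ZeroNumber.

Lemma ultra_forall_leq (F : set_system nat) (P : nat -> set nat) (j : nat) :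
  UltraFilter F -> (forall i, F (P i)) ->
  F [set k | forall i, (i <= j)%N -> P i k].
Proof.
move=> FU H; elim: j => [|j IH].
  by apply: filterS (H 0) => k h i; rewrite leqn0 => /eqP ->.
apply: filterS (ultraI FU IH (H j.+1)) => k [h1 h2] i.
by rewrite leq_eqVlt => /predU1P[->//|]; exact: h1.
Qed.

Section RadialODE.
Variables (R : realType) (q : R).
Local Notation f := (nonlinearity q).
Implicit Types (J : set R) (u v : R -> R) (lambda gamma beta r : R) (d : nat).

(** The profiles of a radial solution, with their first two derivatives.  They
    are differentiable at r = 0 as well, since profiles extend to even
    functions; only the equation needs r > 0. *)
Definition radial_ode d lambda gamma beta J u v (u1 v1 u2 v2 : R -> R) :=
  [/\ forall r, J r -> [/\ is_derive r 1 u (u1 r), is_derive r 1 u1 (u2 r),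
        is_derive r 1 v (v1 r) & is_derive r 1 v1 (v2 r)],
      u1 0 = 0 /\ v1 0 = 0
    & forall r, 0 < r -> J r ->
        u2 r + d%:R / r * u1 r = lambda * u r + gamma * v r - f beta (u r) (v r) /\
        v2 r + d%:R / r * v1 r = lambda * v r + gamma * u r - f beta (v r) (u r)].

Lemma radial_ode_swap d lambda gamma beta J u v u1 v1 u2 v2 :
  radial_ode d lambda gamma beta J u v u1 v1 u2 v2 ->
  radial_ode d lambda gamma beta J v u v1 u1 v2 u2.
Proof.
by move=> [h1 [h2 h3] h4]; split=> // r; [move=> /h1[]|move=> r0 /(h4 _ r0)[]].
Qed.

Lemma radial_ode_oppr d lambda gamma beta J u v u1 v1 u2 v2 :
  radial_ode d lambda gamma beta J u v u1 v1 u2 v2 ->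
  radial_ode d lambda (- gamma) beta J u (fun r => - v r) u1 (fun r => - v1 r)
    u2 (fun r => - v2 r).
Proof.
move=> [h1 [h2 h3] h4]; split=> [r /h1[? ? ? ?]||r r0 /(h4 _ r0)[e1 e2]].
- by split=> //; exact: derN.
- by rewrite h3 oppr0.
- rewrite nonlinearityNr nonlinearityNl e1; split; first by ring.
  have -> : - v2 r + d%:R / r * - v1 r = - (v2 r + d%:R / r * v1 r) by ring.
  by rewrite e2; ring.
Qed.

Definition initial_segment J := forall r s, J r -> 0 <= s <= r -> J s.

(** Uniqueness for the linear equation of u - v propagates from [a, b] to all of
    J; the point r = 0, where d/r is singular, is reached by continuity. *)
Lemma radial_ode_eq d lambda gamma beta J u v u1 v1 u2 v2 a b : -1 < q ->
  radial_ode d lambda gamma beta J u v u1 v1 u2 v2 -> initial_segment J ->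
  0 < a -> a < b -> J b -> (forall r, a <= r <= b -> u r = v r) ->
  forall r, 0 <= r -> J r -> u r = v r.
Proof.
move=> hq [h1 _ h4] HJ a0 ab Jb E.
have pos r : 0 < r -> J r -> u r = v r.
  move=> r0 Jr; pose x0 := (a + b) / 2.
  have x0b : x0 < b by rewrite /x0; lra.
  have ax0 : a < x0 by rewrite /x0; lra.
  have xp : 0 < x0 by rewrite (lt_trans a0).
  pose a' := Num.min r x0; pose b' := Num.max r x0.
  have a'0 : 0 < a' by rewrite lt_min r0.
  have a'b' : a' <= b' by rewrite /a' /b' ge_min le_max lexx.
  have Jx0 : J x0 by apply: (HJ _ _ Jb); rewrite !ltW.
  have Jb' : J b' by rewrite /b'; case: (leP r x0).
  have Jt t : a' <= t <= b' -> J t.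
    by move=> /andP[h h']; apply: (HJ _ _ Jb'); rewrite h' (le_trans _ h)// ltW.
  have tp t : a' <= t <= b' -> 0 < t by move=> /andP[h _]; rewrite (lt_le_trans a'0).
  have [m Hm] : exists m, forall t, a' <= t <= b' -> `|u t| <= m /\ `|v t| <= m.
    pose g t := u t ^+ 2 + v t ^+ 2.
    have Dg t : a' <= t <= b' -> derivable g t 1.
      by move=> /Jt /h1[D1 _ D2 _]; have [] := derD (derX 2 D1) (derX 2 D2).
    have gc : {within `[a', b'], continuous g}.
      by apply: derivable_within_continuous => t; rewrite in_itv /=; exact: Dg.
    have [c _ Hc] := EVT_max a'b' gc; exists (g c + 1) => t tab.
    have := Hc t; rewrite in_itv /= => /(_ tab); rewrite {1}/g => h.
    have bd (z w : R) : z ^+ 2 + w ^+ 2 <= g c -> `|z| <= g c + 1.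
      move=> hz; have := sqr_ge0 w => hw; have := sqr_ge0 (z - 1) => q1.
      have := sqr_ge0 (z + 1) => q2; have := sqr_ge0 z => q3.
      by rewrite ler_norml; apply/andP; split; nra.
    by split; [exact: bd h|apply: (bd _ (u t)); rewrite addrC].
  have m0 : 0 <= m.
    have : a' <= a' <= b' by rewrite lexx.
    by move=> /Hm[h _]; rewrite (le_trans _ h).
  pose K := `|lambda - gamma| + ((2 * q + 3) * m `^ (2 * q + 2) + `|beta| * (m * m) `^ (q + 1)).
  have K0 : 0 <= K by rewrite addr_ge0// addr_ge0// mulr_ge0 ?powR_ge0//; lra.
  apply/eqP; rewrite -subr_eq0; apply/eqP.
  apply: (@radial_ode_unique R d (fun t => u t - v t) (fun t => u1 t - v1 t)
     (fun t => u2 t - v2 t) a' b' x0 K a'0 _ K0).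
  - by rewrite ge_min lexx orbT le_max lexx orbT.
  - by move=> t /Jt /h1[? ? ? ?]; exact: derB.
  - by move=> t /Jt /h1[? ? ? ?]; exact: derB.
  - move=> t tab; have [b1 b2] := Hm _ tab.
    have [e1 e2] := h4 _ (tp _ tab) (Jt _ tab).
    rewrite (_ : u2 t - v2 t + _ = (u2 t + d%:R / t * u1 t) - (v2 t + d%:R / t * v1 t)); last by ring.
    rewrite e1 e2 (_ : _ - _ = (lambda - gamma) * (u t - v t)
      - (f beta (u t) (v t) - f beta (v t) (u t))); last by ring.
    apply: (le_trans (ler_normB _ _)); rewrite normrM /K mulrDl lerD2l.
    exact: nonlinearity_diff_bound.
  - by rewrite E ?subrr// !ltW.
  - have [D1 _ D3 _] := h1 _ Jx0; apply: (der_uniq (derB D1 D3)).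
    apply: (der_near _ (derC _ 0)); exists (Num.min (x0 - a) (b - x0)).
      by rewrite lt_min !subr_gt0 ax0.
    move=> y; rewrite lt_min !ltr_norml => /andP[/andP[? ?] /andP[? ?]].
    by rewrite E ?subrr//; apply/andP; split; lra.
  - by rewrite ge_min lexx le_max lexx.
move=> r; rewrite le_eqVlt => /predU1P[<-|] Jr; last exact: pos.
have J0 : J 0 by apply: (HJ _ _ Jb); rewrite lexx (ltW (lt_trans a0 ab)).
have [D1 _ D2 _] := h1 _ J0.
apply/eqP; rewrite -subr_eq0 -normr_le0; apply/ler_addgt0Pr => e e0; rewrite add0r.
have [de de0 H] := is_derive1_ct (derB D1 D2) e0.
pose t := Num.min (de / 2) b.
have t0 : 0 < t by rewrite lt_min (lt_trans a0 ab) divr_gt0.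
have tb : t <= b by rewrite ge_min lexx orbT.
have td : t < de.
  have : t <= de / 2 by rewrite ge_min lexx.
  by lra.
have Jt : J t by apply: (HJ _ _ Jb); rewrite tb ltW.
have := H t; rewrite subr0 gtr0_norm// => /(_ td).
by rewrite (pos _ t0 Jt) subrr sub0r normrN => /ltW.
Qed.

(** If u - v >= 0 on the interval, it satisfies - Laplacian w >= h w with
    h >= m^(q+1) / 2 - |lambda - gamma|, so Sturm comparison gives w = 0 on the
    interval, hence everywhere. *)
Lemma difference_takes_negative d lambda gamma beta J u v u1 v1 u2 v2 a k m :
  -1 < q -> (d <= 2)%N ->
  radial_ode d lambda gamma beta J u v u1 v1 u2 v2 -> initial_segment J ->
  0 < a -> 0 < k -> 0 <= m -> J (a + pi / k) -> beta <= - 2^-1 ->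
  (forall r, a <= r <= a + pi / k -> m <= u r * v r) ->
  k ^+ 2 + `|lambda - gamma| < m `^ (q + 1) / 2 ->
  (exists2 r, 0 <= r /\ J r & u r != v r) ->
  exists2 r, a <= r <= a + pi / k & u r - v r < 0.
Proof.
move=> hq d2 H HJ a0 k0 m0 Jb hb hm hk [r0 [r00 Jr0] N].
apply: contrapT => C.
have [h1 _ h4] := H.
have ab : a < a + pi / k by rewrite ltrDl divr_gt0// pi_gt0.
have W0 r : a <= r <= a + pi / k -> 0 <= u r - v r.
  by move=> rab; rewrite leNgt; apply/negP => n; apply: C; exists r.
have Jr r : a <= r <= a + pi / k -> J r.
  by move=> /andP[h h']; apply: (HJ _ _ Jb); rewrite h' (le_trans _ h)// ltW.
have rp r : a <= r <= a + pi / k -> 0 < r by move=> /andP[h _]; rewrite (lt_le_trans a0).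
pose h r := - beta * (`|u r * v r| `^ q * (u r * v r)) - (lambda - gamma).
have Z r : a <= r <= a + pi / k -> u r - v r = 0.
  apply: (@radial_sturm R d%:R (fun r => u r - v r) (fun r => u1 r - v1 r)
    (fun r => u2 r - v2 r) h a k _ a0 k0) => //.
  - by rewrite ler0n ler_nat.
  - by move=> t /Jr /h1[? ? ? ?]; exact: derB.
  - by move=> t /Jr /h1[? ? ? ?]; exact: derB.
  - move=> t tab; have mt := hm _ tab.
    have uv0 := le_trans m0 mt.
    rewrite /h (ger0_norm uv0) powRS//.
    have : m `^ (q + 1) <= (u t * v t) `^ (q + 1) by apply: ler_powRl => //; lra.
    have := ler_norm (lambda - gamma).
    have := powR_ge0 m (q + 1).
    by move: hk; move: (m `^ (q + 1)) ((u t * v t) `^ (q + 1)) => x y; nra.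
  - move=> t tab; have t0 := rp _ tab; have [e1 e2] := h4 _ t0 (Jr _ tab).
    rewrite (_ : u2 t - v2 t + _ = (u2 t + d%:R / t * u1 t) - (v2 t + d%:R / t * v1 t)); last by ring.
    rewrite e1 e2.
    have g0 : 0 <= gpow q (u t) - gpow q (v t).
      by rewrite subr_ge0 gpow_mono// -subr_ge0 W0.
    have := nonlinearity_diff hq beta (u t) (v t); rewrite /h.
    by move: g0; set w := (`|u t * v t| `^ q * (u t * v t)); nra.
have E r : a <= r <= a + pi / k -> u r = v r.
  by move=> /Z /eqP; rewrite subr_eq0 => /eqP.
by move: N; rewrite (radial_ode_eq hq H HJ a0 ab Jb E) ?eqxx.
Qed.

(** On each of j + 1 consecutive intervals of rescaled length pi / k0 the
    difference takes both signs. *)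
Lemma oscillation d lambda gamma beta J u v u1 v1 u2 v2
    (sigma mu M x0 k0 m0 C : R) (j : nat) :
  -1 < q -> (d <= 2)%N ->
  radial_ode d lambda gamma beta J u v u1 v1 u2 v2 -> initial_segment J ->
  sigma = 1 \/ sigma = -1 -> 0 < mu -> 0 < M -> 0 < k0 -> 0 < m0 ->
  mu ^+ 2 * M `^ (2 * q + 2) = 1 -> beta <= - 2^-1 ->
  k0 ^+ 2 + `|lambda - gamma| * mu ^+ 2 < m0 `^ (q + 1) / 2 ->
  (forall s, 1 <= s <= 1 + (j.+1)%:R * (pi / k0) ->
    [/\ J (x0 + sigma * mu * s), 0 < x0 + sigma * mu * s &
     M ^+ 2 * m0 <= u (x0 + sigma * mu * s) * v (x0 + sigma * mu * s)]) ->
  (exists2 r, 0 <= r /\ J r & u r != v r) ->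
  (zero_number_on J (fun r => u r - v r)%R <= C%:E)%E -> j%:R <= C.
Proof.
move=> hq d2 H HJ hs mu0 M0 k00 m00 hM hb hk Hs N Z.
pose L : R := pi / k0.
have L0 : 0 < L by rewrite divr_gt0// pi_gt0.
pose y s := x0 + sigma * mu * s.
pose m := M ^+ 2 * m0.
have mm0 : 0 < m by rewrite mulr_gt0// exprn_gt0.
have kk0 : 0 < k0 / mu by rewrite divr_gt0.
have hk' : (k0 / mu) ^+ 2 + `|lambda - gamma| < m `^ (q + 1) / 2.
  have mu20 : 0 < mu ^+ 2 by rewrite exprn_gt0.
  rewrite -(ltr_pM2r mu20); rewrite (_ : _ * mu ^+ 2 = k0 ^+ 2 + `|lambda - gamma| * mu ^+ 2).
    rewrite /m powRM ?(ltW m00) ?exprn_ge0 ?(ltW M0)// -(powR_mulrn 2 (ltW M0)) -powRrM.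
    rewrite (_ : 2%:R * (q + 1) = 2 * q + 2); last by ring.
    rewrite (_ : M `^ (2 * q + 2) * m0 `^ (q + 1) / 2 * mu ^+ 2 = mu ^+ 2 * M `^ (2 * q + 2) * (m0 `^ (q + 1) / 2)); last by ring.
    by rewrite hM mul1r.
  by field; rewrite gt_eqF.
have int (i : nat) : (i <= j)%N -> exists a, [/\ 0 < a, J (a + pi / (k0 / mu)) &
    forall r, a <= r <= a + pi / (k0 / mu) -> exists2 s, 1 + i%:R * L <= s <= 1 + i.+1%:R * L &
      r = y s].
  move=> ij; have piE : pi / (k0 / mu) = mu * L.
    by rewrite /L; move: (pi : R) => p; field; rewrite !gt_eqF.
  have iL : i.+1%:R * L = i%:R * L + L by rewrite -natr1; ring.
  have iL0 : 0 <= i%:R * L by rewrite mulr_ge0// ltW.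
  have ijL : i.+1%:R * L <= j.+1%:R * L by rewrite ler_pM2r// ler_nat.
  have s1 : 1 <= 1 + i%:R * L <= 1 + j.+1%:R * L by apply/andP; split; lra.
  have s2 : 1 <= 1 + i.+1%:R * L <= 1 + j.+1%:R * L by apply/andP; split; lra.
  have [J1 p1 _] := Hs _ s1; have [J2 p2 _] := Hs _ s2.
  rewrite piE; case: hs => sE.
    exists (y (1 + i%:R * L)); split=> //.
      by move: J2; rewrite /y iL sE; congr J; ring.
    move=> r /andP[r1 r2]; exists ((r - x0) / mu).
      rewrite ler_pdivlMr// ler_pdivrMr//; move: r1 r2; rewrite /y sE iL => r1 r2.
      by apply/andP; split; lra.
    by rewrite /y sE; field; rewrite gt_eqF.
  exists (y (1 + i.+1%:R * L)); split=> //.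
    by move: J1; rewrite /y iL sE; congr J; ring.
  move=> r /andP[r1 r2]; exists ((x0 - r) / mu).
    rewrite ler_pdivlMr// ler_pdivrMr//; move: r1 r2; rewrite /y sE iL => r1 r2.
    by apply/andP; split; lra.
  by rewrite /y sE; field; rewrite gt_eqF.
pose w r := u r - v r.
have sub (i : nat) s : (i <= j)%N -> 1 + i%:R * L <= s <= 1 + i.+1%:R * L ->
    1 <= s <= 1 + j.+1%:R * L.
  move=> ij /andP[h h'].
  have iL0 : 0 <= i%:R * L by rewrite mulr_ge0// ltW.
  have ijL : i.+1%:R * L <= j.+1%:R * L by rewrite ler_pM2r// ler_nat.
  by apply/andP; split; lra.
have pts (i : nat) : exists s, (i <= j)%N -> 1 + i%:R * L <= s <= 1 + i.+1%:R * L /\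
    (if odd i then w (y s) < 0 else 0 < w (y s)).
  have [ij|] := boolP (i <= j)%N; last by exists 0.
  have [a [a0 Ja Ha]] := int i ij.
  have uvm r : a <= r <= a + pi / (k0 / mu) -> m <= u r * v r.
    by move=> /Ha[s sL ->]; have [] := Hs _ (sub _ _ ij sL).
  case: (odd i).
    have [r rab wr] := difference_takes_negative hq d2 H HJ a0 kk0 (ltW mm0) Ja hb uvm hk' N.
    by have [s sL E] := Ha _ rab; exists s => _; rewrite -E.
  have N' : exists2 r, 0 <= r /\ J r & v r != u r by move: N => [r ? ?]; exists r; rewrite 1?eq_sym.
  have vum r : a <= r <= a + pi / (k0 / mu) -> m <= v r * u r by move=> /uvm; rewrite mulrC.
  have [r rab wr] := difference_takes_negative hq d2 (radial_ode_swap H) HJ a0 kk0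
    (ltW mm0) Ja hb vum hk' N'.
  have [s sL E] := Ha _ rab; exists s => _; split=> //.
  by rewrite -E /w -oppr_lt0 opprB.
have [s Hsi] := choice pts.
have alt (i : nat) : (i < j)%N -> w (y (s i)) * w (y (s i.+1)) < 0.
  move=> ij; have [_ h1] := Hsi _ (ltnW ij); have [_ h2] := Hsi _ ij.
  move: h1 h2; rewrite [odd i.+1]/=; case: (odd i) => /= h1 h2.
    by rewrite nmulr_rlt0.
  by rewrite pmulr_rlt0.
apply: (zero_number_ge_scaled hs mu0 Z (s := s) (x0 := x0)) => i ij.
- have [sL _] := Hsi _ ij.
  by have [] := Hs _ (sub _ _ ij sL).
- rewrite lt_def; apply/andP; split.
    apply/eqP => E; have := alt _ ij; rewrite E.
    by rewrite ltNge -expr2 sqr_ge0.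
  have [/andP[_ h1] _] := Hsi _ (ltnW ij); have [/andP[h2 _] _] := Hsi _ ij.
  exact: le_trans h1 h2.
- exact: alt.
Qed.

End RadialODE.

(** * Contradiction from a blow-up limit *)

Lemma mul_near_constant (R : realType) (a b c : R) :
  `|a - c| < `|c| / 4 -> `|b - c| < `|c| / 4 -> c ^+ 2 / 4 <= a * b.
Proof.
by have [cpos|cneg] := leP 0 c; [rewrite (ger0_norm cpos)|rewrite (ltr0_norm cneg)];
  rewrite !ltr_norml => /andP[? ?] /andP[? ?]; nra.
Qed.

(** This section treats the two regimes together: r = x0 + sigma mu s, with
    x0 = 0, sigma = 1 and limit dimension D = d, or with x0 the blow-up point,
    sigma = -1 and D = 0. *)
Section BlowUp.
Variables (R : realType) (F : set_system nat) (q lambda gamma A : R) (d D : nat).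
Hypothesis FU : UltraFilter F.
Hypothesis hq : -1 < q.
Hypothesis d2 : (d <= 2)%N.
Hypothesis D2 : (D <= 2)%N.
Hypothesis hD : (D%:R - 1) * (q + 1) < 2.
Local Notation f := (nonlinearity q).
Local Notation ulim := (@ulim R F).
Implicit Types (s t r e T C : R) (k i j : nat).

Variables (J : set R) (beta : nat -> R) (u v u1 v1 u2 v2 : nat -> R -> R).
Variables (beta0 sigma C1 C2 C3 C4 : R) (x0 mu M sk : nat -> R) (s0 T0 : R).
Local Notation y := (fun k s => x0 k + sigma * mu k * s).

Hypothesis Hode : forall k,
  radial_ode q d lambda gamma (beta k) J (u k) (v k) (u1 k) (v1 k) (u2 k) (v2 k).
Hypothesis HJ : initial_segment J.
Hypothesis Hbeta : ulim beta beta0.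
Hypothesis hsigma : sigma = 1 \/ sigma = -1.
Hypothesis mu0 : forall k, 0 < mu k.
Hypothesis M0 : forall k, 0 < M k.
Hypothesis hM : forall k, mu k ^+ 2 * M k `^ (2 * q + 2) = 1.
Hypothesis Hmu : ulim mu 0.
Hypothesis Hdom : forall T, 0 < T -> F [set k | forall s, 0 <= s <= T ->
  [/\ J (y k s), 0 < s -> 0 < y k s, `|u k (y k s)| <= A * M k & `|v k (y k s)| <= A * M k]].
Hypothesis Hder : forall T, 0 < T -> exists2 C, 0 <= C &
  F [set k | forall s, 0 <= s <= T ->
    mu k / M k * `|u1 k (y k s)| <= C /\ mu k / M k * `|v1 k (y k s)| <= C].
Hypothesis Ha : forall s, 0 < s -> forall e, 0 < e -> exists2 de, 0 < de &
  F [set k | forall t, `|t - s| < de -> `|d%:R * (sigma * mu k / y k t) - D%:R / s| <= e].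
Hypothesis Hreg : exists2 C, 0 <= C & forall s, 0 < s <= 1 -> forall e, 0 < e ->
  F [set k | s ^+ D * (mu k / M k ^+ 2) *
     `|u k (y k s) * u1 k (y k s) + v k (y k s) * v1 k (y k s)| <= C * s + e].
Hypothesis Hz : forall k, [/\ (zero_number_on J (u k) <= C1%:E)%E,
  (zero_number_on J (v k) <= C2%:E)%E,
  (zero_number_on J (fun r => u k r - v k r)%R <= C3%:E)%E &
  (zero_number_on J (fun r => u k r + v k r)%R <= C4%:E)%E].
Hypothesis Hsk : ulim sk s0.
Hypothesis Hs0 : 0 <= s0.
Hypothesis HsT : s0 < T0.
Hypothesis Hsk_bounded : F [set k | 0 <= sk k <= T0].
Hypothesis Hnorm : forall k, u k (y k (sk k)) ^+ 2 + v k (y k (sk k)) ^+ 2 = M k ^+ 2.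
Hypothesis Hstar : beta0 = -1 -> F [set k |
  (exists2 r, 0 <= r /\ J r & u k r != v k r) /\
  (exists2 r, 0 <= r /\ J r & u k r != - v k r)].

Let sigma2 : sigma ^+ 2 = 1.
Proof. by case: hsigma => ->; rewrite ?sqrrN expr1n. Qed.

Let nsigma : `|sigma| = 1.
Proof. by case: hsigma => ->; rewrite ?normrN normr1. Qed.

Let T00 : 0 < T0.
Proof. exact: le_lt_trans Hs0 HsT. Qed.

Definition scaled (w : nat -> R -> R) k s := w k (y k s) / M k.
(** The derivative of [scaled w] when w1 is that of w. *)
Definition scaled1 (w1 : nat -> R -> R) k s := sigma * mu k / M k * w1 k (y k s).

Let der_y k s : is_derive s 1 (y k) (sigma * mu k).
Proof.
apply: (der_eq (derD (derC s (x0 k)) (derZ (sigma * mu k) (derI s)))).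
by rewrite add0r mulr1.
Qed.

Let der_scaled (w w1 : nat -> R -> R) k s : is_derive (y k s) 1 (w k) (w1 k (y k s)) ->
  is_derive s 1 (scaled w k) (scaled1 w1 k s).
Proof.
move=> H; have := derZ (M k)^-1 (der_comp (der_y k s) H).
rewrite /scaled (_ : (fun t => (M k)^-1 * w k (y k t)) = (fun t => w k (y k t) / M k)).
  by move/der_eq; apply; rewrite /scaled1; ring.
by apply/funext => t; rewrite mulrC.
Qed.

Let der_scaled1 (w1 w2 : nat -> R -> R) k s : is_derive (y k s) 1 (w1 k) (w2 k (y k s)) ->
  is_derive s 1 (scaled1 w1 k) (mu k ^+ 2 / M k * w2 k (y k s)).
Proof.
move=> H; apply: (der_eq (derZ (sigma * mu k / M k) (der_comp (der_y k s) H))).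
rewrite (_ : sigma * mu k / M k * _ = sigma ^+ 2 * (mu k ^+ 2 / M k * w2 k (y k s))).
  by rewrite sigma2 mul1r.
by ring.
Qed.

Let scaled_eq (w z w1 w2 : nat -> R -> R) k s : y k s != 0 ->
  w2 k (y k s) + d%:R / y k s * w1 k (y k s) =
    lambda * w k (y k s) + gamma * z k (y k s) - f (beta k) (w k (y k s)) (z k (y k s)) ->
  mu k ^+ 2 / M k * w2 k (y k s) =
  - (d%:R * (sigma * mu k / y k s)) * scaled1 w1 k s
  - f (beta k) (scaled w k s) (scaled z k s)
  + mu k ^+ 2 * (lambda * scaled w k s + gamma * scaled z k s).
Proof.
move=> y0 E.
have Mn : M k != 0 by rewrite gt_eqF.
have wE (x : nat -> R -> R) : x k (y k s) = M k * scaled x k s.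
  by rewrite /scaled; field.
have -> : f (beta k) (scaled w k s) (scaled z k s) =
    mu k ^+ 2 / M k * f (beta k) (w k (y k s)) (z k (y k s)).
  rewrite (wE w) (wE z) nonlinearity_homog//.
  have E1 (a b : R) : mu k ^+ 2 / M k * (a * M k * b) = mu k ^+ 2 * a * b by field.
  by rewrite E1 hM mul1r.
have -> : w2 k (y k s) = lambda * w k (y k s) + gamma * z k (y k s)
   - f (beta k) (w k (y k s)) (z k (y k s)) - d%:R / y k s * w1 k (y k s).
  by rewrite -E; ring.
rewrite /scaled1 /scaled.
rewrite (_ : - (d%:R * (sigma * mu k / y k s)) * (sigma * mu k / M k * w1 k (y k s)) =
   - (sigma ^+ 2 * (d%:R * (mu k / y k s) * (mu k / M k * w1 k (y k s))))); last by ring.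
rewrite sigma2 mul1r.
by move: y0; move: (y k s) => Y Y0; field; rewrite Mn.
Qed.

Let scaled_bound (w : nat -> R -> R) k s :
  `|w k (y k s)| <= A * M k -> `|scaled w k s| <= A.
Proof.
move=> H; rewrite /scaled normrM normfV (gtr0_norm (M0 k)).
by rewrite ler_pdivrMr.
Qed.

Let scaled1_norm (w1 : nat -> R -> R) k s :
  `|scaled1 w1 k s| = mu k / M k * `|w1 k (y k s)|.
Proof.
rewrite /scaled1 !normrM nsigma mul1r normfV (gtr0_norm (M0 k)).
by rewrite (gtr0_norm (mu0 k)).
Qed.

Let limits : exists Ul Vl U1l V1l : R -> R,
  [/\ forall s, 0 < s -> ulim (fun k => scaled u k s) (Ul s) /\
        ulim (fun k => scaled v k s) (Vl s),
      limit_system q D beta0 Ul Vl U1l V1l, regular_at_zero D Ul Vl U1l V1l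
    & forall s, 0 < s -> `|Ul s| <= A /\ `|Vl s| <= A].
Proof.
apply: (@ultralimit_solves R F FU q lambda gamma A D beta (fun k => mu k ^+ 2)
  (fun k s => d%:R * (sigma * mu k / y k s)) (scaled u) (scaled v)
  (scaled1 u1) (scaled1 v1) beta0 hq Hbeta).
- move=> e e0; have m : 0 < Num.min e 1 by rewrite lt_min e0 ltr01.
  apply: filterS (Hmu m) => k /=; rewrite !subr0 normrX lt_min => /andP[h1 h2].
  by rewrite expr2; have := normr_ge0 (mu k); nra.
- exact: Ha.
- move=> T T0'; have [C CC HC] := Hder T0'; exists C => //.
  apply: filterS (ultraI FU HC (Hdom T0')) => k /= [h1 h2] s /andP[sp sT].
  have sT' : 0 <= s <= T by rewrite ltW.
  have [Jy y0 bu bv] := h2 _ sT'; have [b1 b2] := h1 _ sT'.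
  have [e1 _ e3] := Hode k.
  have [E1 E2 E3 E4] := e1 _ Jy.
  have yn : y k s != 0 by rewrite gt_eqF// y0.
  have [E5 E6] := e3 _ (y0 sp) Jy.
  split.
  + split.
    * exact: der_scaled.
    * by apply: (der_eq (der_scaled1 E2)); exact: scaled_eq.
    * exact: der_scaled.
    * by apply: (der_eq (der_scaled1 E4)); exact: scaled_eq.
  + by split; exact: scaled_bound.
  + by rewrite !scaled1_norm.
- have [C CC HC] := Hreg; exists C => // s s01 e e0.
  apply: filterS (HC _ s01 _ e0) => k /=; apply: le_trans.
  have E (a b c z : R) : s ^+ D * (a / M k * (sigma * mu k / M k * b)
      + c / M k * (sigma * mu k / M k * z)) =
      s ^+ D * (mu k / M k ^+ 2) * (sigma * (a * b + c * z)).
    by field; rewrite gt_eqF.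
  rewrite /scaled /scaled1 E.
  have s00 : 0 <= s by have /andP[/ltW] := s01.
  rewrite normrM (normrM sigma) nsigma mul1r ger0_norm//.
  by rewrite mulr_ge0 ?exprn_ge0// divr_ge0 ?exprn_ge0// ltW.
Qed.

Let signed (w : nat -> R -> R) (Wl : R -> R) C :
  (forall s, 0 < s -> ulim (fun k => scaled w k s) (Wl s)) ->
  (forall k, (zero_number_on J (w k) <= C%:E)%E) -> eventually_signed Wl.
Proof.
move=> HW Hzn; apply: contrapT => /alternating_points[x Hx].
pose j := (Num.truncn `|C|).+1.
have jC : C < j%:R by apply: (le_lt_trans (ler_norm _)); rewrite truncnS_gt.
have xi0 i : 0 < x i by have [] := Hx i.
have Wn i : Wl (x i) != 0.
  by have [_ _] := Hx i; apply: contraTneq => ->; rewrite mul0r ltxx.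
have same i : F [set k | 0 < scaled w k (x i) * Wl (x i)].
  have Wp : 0 < `|Wl (x i)| by rewrite normr_gt0.
  apply: filterS (HW _ (xi0 i) _ Wp) => k /=.
  move: (scaled w k (x i)) (Wl (x i)) Wp => a b; rewrite ltr_norml => b0 /andP[h1 h2].
  have [bp|bn] := leP 0 b.
    by move: b0 h1 h2; rewrite (ger0_norm bp); nra.
  by move: b0 h1 h2; rewrite (ltr0_norm bn); nra.
have xm i i' : (i <= i')%N -> x i <= x i'.
  apply: (@homo_leq _ x (fun a b => a <= b)) => // [a b c|n]; first exact: le_trans.
  by have [_ /ltW] := Hx n.
have [k [/= h1 h2]] := ultra_ex FU (ultraI FU (ultra_forall_leq j FU same) (Hdom (xi0 j))).
have Jx i : (i <= j)%N -> J (y k (x i)).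
  by move=> ij; have [] // := h2 (x i); rewrite xm// ltW.
suff : j%:R <= C by rewrite leNgt jC.
apply: (zero_number_ge_scaled hsigma (mu0 k) (Hzn k) (s := x) (x0 := x0 k)) => //.
- by move=> i _; have [] := Hx i.
- move=> i ij; have p1 := h1 _ (ltnW ij); have p2 := h1 _ ij; have [_ _ p3] := Hx i.
  have mp (a b : R) : (0 < a / M k * b) = (0 < a * b).
    by rewrite mulrAC pmulr_lgt0// invr_gt0.
  move: p1 p2 p3; rewrite /scaled !mp.
  move: (w k (y k (x i))) (w k (y k (x i.+1))) (Wl (x i)) (Wl (x i.+1)) => a b c e p1 p2 p3.
  have : 0 < (a * c) * (b * e) by rewrite mulr_gt0.
  rewrite (_ : a * c * (b * e) = (a * b) * (c * e)); last by ring.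
  by rewrite nmulr_lgt0.
Qed.

Let scaled_lip (w w1 : nat -> R -> R) T :
  (forall k r, J r -> is_derive r 1 (w k) (w1 k r)) -> 0 < T ->
  (exists2 C, 0 <= C & F [set k | forall s, 0 <= s <= T -> mu k / M k * `|w1 k (y k s)| <= C]) ->
  exists2 C, 0 <= C & F [set k | forall a b, 0 <= a <= T -> 0 <= b <= T ->
     `|scaled w k a - scaled w k b| <= C * `|a - b|].
Proof.
move=> Dw Tp [C CC HC]; exists C => //.
apply: filterS (ultraI FU HC (Hdom Tp)) => k /= [h1 h2] a b aT bT.
apply: (der_lip_itv (df := scaled1 w1 k) _ _ aT bT) => t tT.
  by apply: der_scaled; apply: Dw; have [] := h2 _ tT.
by rewrite scaled1_norm h1.
Qed.

Let lip_u T : 0 < T -> exists2 C, 0 <= C & F [set k | forall a b, 0 <= a <= T -> 0 <= b <= T ->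
     `|scaled u k a - scaled u k b| <= C * `|a - b|].
Proof.
move=> Tp; apply: (@scaled_lip u u1) => //.
  by move=> k r Jr; have [h _ _] := Hode k; case: (h _ Jr).
by have [C CC HC] := Hder Tp; exists C => //; apply: filterS HC => k /= h s /h[].
Qed.

Let lip_v T : 0 < T -> exists2 C, 0 <= C & F [set k | forall a b, 0 <= a <= T -> 0 <= b <= T ->
     `|scaled v k a - scaled v k b| <= C * `|a - b|].
Proof.
move=> Tp; apply: (@scaled_lip v v1) => //.
  by move=> k r Jr; have [h _ _] := Hode k; case: (h _ Jr).
by have [C CC HC] := Hder Tp; exists C => //; apply: filterS HC => k /= h s /h[].
Qed.

(* Pointwise convergence to a constant is locally uniform for equi-Lipschitz
   functions: otherwise evaluate at bad points, which converge along F. *)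
Let uniform (w : nat -> R -> R) c T e : 1 < T -> 0 < e ->
  (forall s, 0 < s -> ulim (fun k => scaled w k s) c) ->
  (exists2 C, 0 <= C & F [set k | forall a b, 0 <= a <= T + 1 -> 0 <= b <= T + 1 ->
     `|scaled w k a - scaled w k b| <= C * `|a - b|]) ->
  F [set k | forall s, 1 <= s <= T -> `|scaled w k s - c| < e].
Proof.
move=> T1 e0 Hw [C CC HC].
have [//|N] := in_ultra_setVsetC
  [set k | forall s, 1 <= s <= T -> `|scaled w k s - c| < e] FU.
have H k : exists s, 1 <= s <= T /\
    ((~` [set k | forall s, 1 <= s <= T -> `|scaled w k s - c| < e]) k ->
     e <= `|scaled w k s - c|).
  have [h|h] := pselect ((~` [set k | forall s, 1 <= s <= T -> `|scaled w k s - c| < e]) k).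
    apply: contrapT => h'; apply: h => s sT; rewrite ltNge; apply/negP => h2.
    by apply: h'; exists s.
  by exists 1; split=> //; rewrite lexx ltW.
have [ts Hts] := choice H.
have tb k : `|ts k| <= T.
  by have [/andP[h1 h2] _] := Hts k; rewrite ger0_norm//; lra.
have [l Hl] := ulim_exists FU (filterS (fun k _ => tb k) (filterT : F setT)).
have l1 : 0 <= l.
  rewrite -oppr_le0; apply: (@ulim_le R F FU (fun k => - ts k)).
    by move=> z z0; apply: filterS (Hl _ z0) => k /=; rewrite -normrN !opprB addrC opprK.
  by apply: filterS filterT => k _ /=; have [/andP[h1 h2] _] := Hts k; lra.
have lT : l <= T.
  apply: (ulim_le FU Hl); apply: filterS filterT => k _ /=.
  by have [/andP[h1 h2] _] := Hts k.
have lT1 : l < T + 1 by lra.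
have HtT : F [set k | 0 <= ts k <= T + 1].
  by apply: filterS filterT => k _ /=; have [/andP[h1 h2] _] := Hts k; apply/andP; split; lra.
have /(_ e e0) Hc := ulim_moving_point FU CC l1 lT1 Hl HtT Hw HC.
have [k [/= h1 h2]] := ultra_ex FU (ultraI FU N Hc).
by have [_ /(_ h1)] := Hts k; rewrite leNgt h2.
Qed.

(** The Liouville theorem leaves only beta0 = -1 and constants (c, +-c) with
    c <> 0; these are excluded by the oscillation of u -+ v. *)
Theorem blow_up_impossible : False.
Proof.
have hq' := hq.
have [Ul [Vl [U1l [V1l [HUV Hsys Hr HA]]]]] := limits.
have HU s : 0 < s -> ulim (fun k => scaled u k s) (Ul s) by move=> /HUV[].
have HV s : 0 < s -> ulim (fun k => scaled v k s) (Vl s) by move=> /HUV[].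
have sU : eventually_signed Ul by apply: (@signed u Ul C1) => // k; have [] := Hz k.
have sV : eventually_signed Vl by apply: (@signed v Vl C2) => // k; have [] := Hz k.
have half e : 0 < e -> 0 < e / 2 by move=> h; rewrite divr_gt0.
have sB : eventually_signed (fun s => Ul s - Vl s).
  apply: (@signed (fun k r => u k r - v k r) _ C3) => [s sp e e0|k]; last by have [] := Hz k.
  apply: filterS (ultraI FU (HU _ sp _ (half _ e0)) (HV _ sp _ (half _ e0))) => k /= [].
  rewrite /scaled mulrBl !ltr_norml => /andP[? ?] /andP[? ?].
  by apply/andP; split; lra.
have sD : eventually_signed (fun s => Ul s + Vl s).
  apply: (@signed (fun k r => u k r + v k r) _ C4) => [s sp e e0|k]; last by have [] := Hz k.
  apply: filterS (ultraI FU (HU _ sp _ (half _ e0)) (HV _ sp _ (half _ e0))) => k /= [].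
  rewrite /scaled mulrDl !ltr_norml => /andP[? ?] /andP[? ?].
  by apply/andP; split; lra.
have [c [sg [hsg Hc hb]]] := liouville hq D2 hD Hsys Hr HA sU sV sB sD.
have Uc s : 0 < s -> ulim (fun k => scaled u k s) c.
  by move=> sp; have := HU _ sp; have [->] := Hc _ sp.
have Vc s : 0 < s -> ulim (fun k => scaled v k s) (sg * c).
  by move=> sp; have := HV _ sp; have [_ ->] := Hc _ sp.
have sg2 : sg ^+ 2 = 1 by case: hsg => ->; rewrite ?sqrrN expr1n.
have cn : c != 0.
  apply/eqP => cz.
  have [B1 B10 HB1] := lip_u T00; have [B2 B20 HB2] := lip_v T00.
  have h2 : 0 < 2^-1 :> R by rewrite invr_gt0.
  have := ulim_moving_point FU B10 Hs0 HsT Hsk Hsk_bounded Uc HB1 => /(_ _ h2) p1.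
  have := ulim_moving_point FU B20 Hs0 HsT Hsk Hsk_bounded Vc HB2 => /(_ _ h2) p2.
  have [k [/=]] := ultra_ex FU (ultraI FU p1 p2).
  rewrite cz mulr0 !subr0 => k1 k2.
  have E : scaled u k (sk k) ^+ 2 + scaled v k (sk k) ^+ 2 = 1.
    by rewrite /scaled !exprMn -mulrDl Hnorm exprVn divff// expf_neq0// gt_eqF.
  have b (z : R) : `|z| < 2^-1 -> z ^+ 2 < 2^-1.
    by rewrite ltr_norml => /andP[? ?]; nra.
  by have := b _ k1; have := b _ k2; lra.
have b0 := hb cn.
have cp : 0 < `|c| by rewrite normr_gt0.
pose m0 := c ^+ 2 / 4.
have m00 : 0 < m0 by rewrite divr_gt0// -(real_normK (num_real c)) exprn_gt0.
pose P := m0 `^ (q + 1).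
have P0 : 0 < P by rewrite powR_gt0.
(* Before rescaling the potential of u -+ v is at least P / (2 mu^2); the margin
   absorbs lambda -+ gamma. *)
pose k0 := Num.sqrt (P / 8).
have k00 : 0 < k0 by rewrite sqrtr_gt0 divr_gt0.
have k02 : k0 ^+ 2 = P / 8 by rewrite sqr_sqrtr// divr_ge0// ltW.
pose j := (Num.truncn (`|C3| + `|C4|)).+1.
have jC : `|C3| + `|C4| < j%:R by rewrite truncnS_gt.
pose T := 1 + j.+1%:R * (pi / k0).
have T1 : 1 < T by rewrite /T ltrDl mulr_gt0// divr_gt0// pi_gt0.
have Tp : 0 < T by lra.
have T1p : 0 < T + 1 by lra.
have c40 : 0 < `|c| / 4 by rewrite divr_gt0.
have un := uniform T1 c40 Uc (lip_u T1p).
have vn := uniform T1 c40 Vc (lip_v T1p).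
pose N := `|lambda| + `|gamma| + 1.
have N0 : 0 < N by rewrite ltr_wpDl// addr_ge0.
have zz : 0 < Num.min 1 (P / (8 * N)) by rewrite lt_min ltr01 divr_gt0// mulr_gt0.
have h2 : 0 < 2^-1 :> R by rewrite invr_gt0.
(* One index k for which all approximations are good enough. *)
have [k [[/= k1 k2] [[/= [k3 k3'] k4] [/= k5 k6]]]] := ultra_ex FU
  (ultraI FU (ultraI FU un vn) (ultraI FU (ultraI FU (Hstar b0) (Hdom Tp))
    (ultraI FU (Hbeta h2) (Hmu zz)))).
have Mk := M0 k; have muk := mu0 k.
have bk : beta k <= - 2^-1.
  by move: k5; rewrite b0 ltr_norml => /andP[_ h]; lra.
have mu2 : N * mu k ^+ 2 <= P / 8.
  move: k6; rewrite subr0 (gtr0_norm muk) lt_min => /andP[h3].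
  rewrite ltr_pdivlMr ?mulr_gt0// => h4.
  have h5 : mu k ^+ 2 <= mu k by rewrite expr2 ler_piMr// ltW.
  have := ler_wpM2l (ltW N0) h5; lra.
have kl (g : R) : `|g| <= `|gamma| -> k0 ^+ 2 + `|lambda - g| * mu k ^+ 2 < m0 `^ (q + 1) / 2.
  move=> hg; rewrite k02 -/P.
  have h3 : `|lambda - g| <= N by have := ler_normB lambda g; rewrite /N; lra.
  have h4 : 0 <= mu k ^+ 2 by rewrite exprn_ge0// ltW.
  have := ler_wpM2r h4 h3; lra.
have prod s : 1 <= s <= T ->
  M k ^+ 2 * m0 <= sg * (u k (y k s) * v k (y k s)).
  move=> sT; have := k1 _ sT; have := k2 _ sT.
  have -> : u k (y k s) = M k * scaled u k s by rewrite /scaled; field; rewrite gt_eqF.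
  have -> : v k (y k s) = M k * scaled v k s by rewrite /scaled; field; rewrite gt_eqF.
  move: (scaled u k s) (scaled v k s) => a b hb' ha.
  rewrite (_ : sg * _ = M k ^+ 2 * (a * (sg * b))); last by ring.
  rewrite ler_pM2l ?exprn_gt0//.
  have {}hb' : `|sg * b - c| < `|c| / 4.
    suff <- : `|b - sg * c| = `|sg * b - c| by [].
    by case: hsg => ->; rewrite ?mul1r// !mulN1r opprK -normrN opprD.
  exact: mul_near_constant ha hb'.
have dom s : 1 <= s <= T -> J (y k s) /\ 0 < y k s.
  move=> /andP[s1 sT].
  have [|h3 h4 _ _] := k4 s; first by rewrite sT andbT; lra.
  by split=> //; apply: h4; lra.
case: hsg => sE.
- have : j%:R <= C3.
    apply: (@oscillation R q d lambda gamma (beta k) J (u k) (v k) (u1 k) (v1 k) (u2 k) (v2 k)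
      sigma (mu k) (M k) (x0 k) k0 m0 C3 j) => //.
    + exact: kl.
    + move=> s sT; have [h3 h4] := dom _ sT; split=> //.
      by have := prod _ sT; rewrite sE mul1r.
    + by have [] := Hz k.
  by have := ler_norm C3; have := normr_ge0 C4; lra.
- have : j%:R <= C4.
    apply: (@oscillation R q d lambda (- gamma) (beta k) J (u k) (fun r => - v k r) (u1 k)
      (fun r => - v1 k r) (u2 k) (fun r => - v2 k r)
      sigma (mu k) (M k) (x0 k) k0 m0 C4 j) => //.
    + exact: radial_ode_oppr.
    + by apply: kl; rewrite normrN.
    + move=> s sT; have [h3 h4] := dom _ sT; split=> //.
      by have := prod _ sT; rewrite sE mulN1r mulrN.
    + by under eq_fun do rewrite opprK; have [] := Hz k.
  by have := ler_norm C4; have := normr_ge0 C3; lra.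
Qed.

End BlowUp.

(** * The two blow-up regimes *)

(** r^d w1 vanishes at 0 and its derivative r^d (w2 + d/r w1) is bounded by
    G r^d. *)
Lemma flux_bound (R : realType) (d : nat) (w1 w2 : R -> R) (G b : R) :
  (forall r, 0 <= r <= b -> is_derive r 1 w1 (w2 r)) -> w1 0 = 0 ->
  (forall r, 0 < r <= b -> `|w2 r + d%:R / r * w1 r| <= G) ->
  forall r, 0 <= r <= b -> `|w1 r| <= G * r.
Proof.
move=> D0 w0 H r /andP[]; rewrite le_eqVlt => /predU1P[<- _|r0 rb].
  by rewrite w0 normr0 mulr0.
pose g t := t ^+ d * w1 t.
have Dg (t : R) : 0 <= t <= r ->
    is_derive t 1 g (d%:R * t ^+ d.-1 * 1 * w1 t + t ^+ d * w2 t).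
  move=> /andP[t0 tr]; apply: (derM (derX d (derI t)) (D0 t _)).
  by rewrite t0 (le_trans tr).
have Dp (t : R) : is_derive t 1 (fun t => G * t ^+ d.+1) (G * (d.+1%:R * t ^+ d * 1)).
  exact: (derZ G (derX d.+1 (derI t))).
have g0 : g 0 = 0 by rewrite /g w0 mulr0.
have bd (t : R) : 0 < t < r -> `|d%:R * t ^+ d.-1 * 1 * w1 t + t ^+ d * w2 t| <=
    G * (d.+1%:R * t ^+ d * 1).
  move=> /andP[t0 tr].
  have trb : 0 < t <= b by rewrite t0 (le_trans (ltW tr)).
  have td : 0 < t ^+ d by rewrite exprn_gt0.
  rewrite (_ : _ + _ = t ^+ d * (w2 t + d%:R / t * w1 t)); last first.
    case: (d) => [|e]; first by rewrite /=; ring.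
    by rewrite /= exprS; field; rewrite gt_eqF.
  rewrite normrM (gtr0_norm td) mulr1.
  apply: (@le_trans _ _ (t ^+ d * G)).
    by rewrite ler_pM2l// H.
  have G0 : 0 <= G by rewrite (le_trans _ (H _ trb)).
  rewrite (_ : G * (_ * _) = d.+1%:R * (t ^+ d * G)); last by ring.
  rewrite ler_peMl// ?ler1n//.
  by rewrite mulr_ge0// ltW.
have h1 : G * 0 ^+ d.+1 + g 0 <= G * r ^+ d.+1 + g r.
  apply: (der_ndecr (ltW r0) (fun t ht => derD (Dp t) (Dg t ht))) => t ht.
  by have := bd _ ht; rewrite ler_norml => /andP[h _]; lra.
have h2 : G * 0 ^+ d.+1 - g 0 <= G * r ^+ d.+1 - g r.
  apply: (der_ndecr (ltW r0) (fun t ht => derB (Dp t) (Dg t ht))) => t ht.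
  by have := bd _ ht; rewrite ler_norml => /andP[_ h]; lra.
move: h1 h2; rewrite g0 expr0n mulr0 addr0 subr0 => h1 h2.
have rd : 0 < r ^+ d by rewrite exprn_gt0.
rewrite -(ler_pM2l rd) -{1}(gtr0_norm rd) -normrM.
rewrite (_ : r ^+ d * (G * r) = G * r ^+ d.+1); last by rewrite exprSr; ring.
by rewrite ler_norml; apply/andP; split; rewrite -/(g r); lra.
Qed.

(** The mean value theorem on [x - mu, x] gives one point with
    mu |w1| <= 2 B, and the flux r^d w1 varies little over the interval, where
    r^d changes by a factor at most 2^d <= 4. *)
Lemma derivative_bound_far (R : realType) (d : nat) (w w1 w2 : R -> R) (x mu T B G : R) :
  (d <= 2)%N -> 0 < mu -> 1 <= T -> 2 * (mu * T) < x -> 0 <= G ->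
  (forall r, x - mu * T <= r <= x -> is_derive r 1 w (w1 r)) ->
  (forall r, x - mu * T <= r <= x -> is_derive r 1 w1 (w2 r)) ->
  (forall r, x - mu * T <= r <= x -> `|w r| <= B) ->
  (forall r, x - mu * T <= r <= x -> `|w2 r + d%:R / r * w1 r| <= G) ->
  forall r, x - mu * T <= r <= x -> mu * `|w1 r| <= 4 * (2 * B + mu ^+ 2 * G * T).
Proof.
move=> d2 mu0 T1 xT G0 Dw Dw1 Bw Hw y yb.
have mT : 0 < mu * T by rewrite mulr_gt0//; lra.
have mmT : mu <= mu * T by rewrite ler_peMr// ltW.
have xp : 0 < x by lra.
have xm : x - mu < x by rewrite gtrDl oppr_lt0.
have half r : x - mu * T <= r <= x -> x / 2 <= r /\ 0 < r.
  by move=> /andP[h _]; split; lra.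
have sub r : x - mu <= r <= x -> x - mu * T <= r <= x.
  by move=> /andP[h ->]; rewrite andbT; lra.
have [z /andP[z1 z2] Ez] := mvt xm (fun r hr => Dw r (sub r hr)).
have zb : x - mu * T <= z <= x by apply: sub; rewrite !ltW.
have w1z : mu * `|w1 z| <= 2 * B.
  have E : w x - w (x - mu) = w1 z * mu by rewrite Ez; ring.
  rewrite mulrC -{1}(gtr0_norm mu0) -normrM -E mulr2n mulrDl mul1r.
  apply: (le_trans (ler_normB _ _)); apply: lerD; apply: Bw; apply: sub.
    by rewrite lexx ltW.
  by rewrite lexx ltW.
pose g t := t ^+ d * w1 t.
have gyz : `|g y - g z| <= x ^+ d * G * `|y - z|.
  apply: (@der_lip_itv R g (fun t => t ^+ d * (w2 t + d%:R / t * w1 t))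
    (x - mu * T) x) => // t tb; have [_ t0] := half _ tb.
    apply: (der_eq (derM (is_derive_pow d t0) (Dw1 _ tb))).
    by field; rewrite gt_eqF.
  rewrite normrM; apply: ler_pM => //; last exact: Hw.
  rewrite ger0_norm ?exprn_ge0 ?(ltW t0)// lerXn2r ?nnegrE ?(ltW t0) ?(ltW xp)//.
  by case/andP: tb.
have yz : `|y - z| <= mu * T.
  by case/andP: yb => ? ?; case/andP: zb => ? ?; rewrite ler_norml; apply/andP; split; lra.
have xd : 0 < x ^+ d by rewrite exprn_gt0.
have [yh y0] := half _ yb; have [_ z0] := half _ zb.
have gz : `|g z| <= x ^+ d * `|w1 z|.
  rewrite /g normrM ler_wpM2r// ger0_norm ?exprn_ge0 ?(ltW z0)//.
  by rewrite lerXn2r ?nnegrE ?(ltW z0) ?(ltW xp)// ltW.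
have gy : (x / 2) ^+ d * `|w1 y| <= `|g y|.
  rewrite /g normrM ler_wpM2r// (@ger0_norm _ (y ^+ d)) ?exprn_ge0 ?(ltW y0)//.
  by rewrite lerXn2r ?nnegrE ?(ltW y0)// divr_ge0// ltW.
have two : (2 : R) ^+ d <= 4.
  rewrite (_ : (4 : R) = 2 ^+ 2); last by rewrite expr2 -natrM.
  by rewrite ler_weXn2l// ler1n.
have S0 : 0 <= `|w1 z| + G * (mu * T) by rewrite addr_ge0// mulr_ge0// ltW.
have wy : `|w1 y| <= 4 * (`|w1 z| + G * (mu * T)).
  have h1 : (x / 2) ^+ d * `|w1 y| <= x ^+ d * (`|w1 z| + G * (mu * T)).
    apply: (le_trans gy); rewrite -(subrK (g z) (g y)) (le_trans (ler_normD _ _))//.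
    rewrite mulrDr addrC lerD// (le_trans gyz)// -mulrA ler_wpM2l ?(ltW xd)//.
    by rewrite ler_wpM2l.
  apply: (@le_trans _ _ (2 ^+ d * (`|w1 z| + G * (mu * T)))); last by rewrite ler_wpM2r.
  rewrite -(ler_pM2l xd) mulrCA; apply: (le_trans _ (ler_wpM2l _ h1)).
    by rewrite expr_div_n mulrA (mulrC (2 ^+ d)) divfK// expf_neq0.
  by rewrite exprn_ge0.
apply: (le_trans (ler_wpM2l (ltW mu0) wy)).
rewrite (_ : mu * (4 * _) = 4 * (mu * `|w1 z| + mu ^+ 2 * G * T)); last by ring.
by rewrite ler_pM2l// lerD2r.
Qed.

Section BlowUpSequence.
Variables (R : realType) (F : set_system nat) (q lambda gamma A : R) (d : nat).
Hypothesis FU : UltraFilter F.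
Hypothesis hq : -1 < q.
Hypothesis d2 : (d <= 2)%N.
Hypothesis hd : (d%:R - 1) * (q + 1) < 2.
Local Notation f := (nonlinearity q).
Local Notation ulim := (@ulim R F).
Implicit Types (s t r e T C : R) (k i j : nat).

Variables (J : set R) (beta : nat -> R) (u v u1 v1 u2 v2 : nat -> R -> R).
Variables (beta0 C1 C2 C3 C4 rho : R) (x M K : nat -> R).
Local Notation mu := (fun k => M k `^ (- (q + 1))).

Hypothesis Hode : forall k,
  radial_ode q d lambda gamma (beta k) J (u k) (v k) (u1 k) (v1 k) (u2 k) (v2 k).
Hypothesis HJ : initial_segment J.
Hypothesis rho0 : 0 < rho.
Hypothesis Jrho : J rho.
Hypothesis Hbeta : ulim beta beta0.
Hypothesis M0 : forall k, 0 < M k.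
Hypothesis HM : forall C, F [set k | C <= M k].
Hypothesis HK : forall C, F [set k | C <= K k].
Hypothesis A0 : 0 <= A.
Hypothesis x0 : forall k, 0 <= x k.
Hypothesis Jx : forall k, J (x k).
Hypothesis Hnorm : forall k, u k (x k) ^+ 2 + v k (x k) ^+ 2 = M k ^+ 2.
Hypothesis Hbd : forall k r, J r -> 0 <= r -> `|r - x k| <= K k * mu k ->
  `|u k r| <= A * M k /\ `|v k r| <= A * M k.
Hypothesis HQ : forall e, 0 < e -> F [set k | 0 < x k ->
  mu k / M k ^+ 2 * `|u k (x k) * u1 k (x k) + v k (x k) * v1 k (x k)| <= e].
Hypothesis Hz : forall k, [/\ (zero_number_on J (u k) <= C1%:E)%E,
  (zero_number_on J (v k) <= C2%:E)%E,
  (zero_number_on J (fun r => u k r - v k r)%R <= C3%:E)%E &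
  (zero_number_on J (fun r => u k r + v k r)%R <= C4%:E)%E].
Hypothesis Hstar : beta0 = -1 -> F [set k |
  (exists2 r, 0 <= r /\ J r & u k r != v k r) /\
  (exists2 r, 0 <= r /\ J r & u k r != - v k r)].

Let mu0 k : 0 < mu k.
Proof. exact: powR_gt0. Qed.

Let hM k : mu k ^+ 2 * M k `^ (2 * q + 2) = 1.
Proof.
rewrite -powR_mulrn ?powR_ge0// -powRrM -powRD; last by rewrite (gt_eqF (M0 k)) implybT.
by rewrite (_ : - (q + 1) * 2%:R + (2 * q + 2) = 0) ?powRr0//; ring.
Qed.

Let Hmu : ulim mu 0.
Proof.
move=> e e0; have q1 : 0 < q + 1 by have := hq; lra.
have [T T0 HT] := powR_decay q1 ler01 e0.
apply: filterS (HM T) => k /= h; rewrite subr0 ger0_norm ?powR_ge0//.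
by have := HT _ h; rewrite mul1r.
Qed.


Let B0 := (`|lambda| + `|gamma|) * A + (2 + `|beta0|) * A `^ (2 * q + 3).

Let B00 : 0 <= B0.
Proof. by rewrite addr_ge0// mulr_ge0 ?powR_ge0// addr_ge0. Qed.

Let gk k := (`|lambda| + `|gamma|) * (A * M k)
  + (1 + `|beta k|) * (A * M k) `^ (2 * q + 3).

Let gk_bound : F [set k | mu k ^+ 2 / M k * gk k <= B0].
Proof.
apply: filterS (ultraI FU (Hbeta ltr01) (Hmu ltr01)) => k /= [h1 h2].
have Mk := M0 k; have muk := mu0 k.
have m1 : mu k <= 1 by move: h2; rewrite subr0 gtr0_norm// => /ltW.
have m2 : mu k ^+ 2 <= 1 by rewrite expr2 mulr_ile1// ltW.
rewrite /gk powRM ?(ltW Mk)//.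
have E : M k `^ (2 * q + 3) = M k `^ (2 * q + 2) * M k.
  rewrite powRS ?(ltW Mk)//; last by have := hq; lra.
  by congr (_ `^ _); ring.
have E1 (a b : R) : mu k ^+ 2 / M k * (a * (A * M k) +
    b * (A `^ (2 * q + 3) * M k `^ (2 * q + 3))) = mu k ^+ 2 * (a * A)
    + (mu k ^+ 2 * M k `^ (2 * q + 2)) * (b * A `^ (2 * q + 3)).
  by rewrite E; move: (M k `^ _) (A `^ _) => z w; field; rewrite gt_eqF.
rewrite E1 hM mul1r /B0; apply: lerD.
  by rewrite ler_piMl// mulr_ge0// addr_ge0.
rewrite ler_wpM2r ?powR_ge0//.
by have := ler_normD (beta k - beta0) beta0; rewrite subrK; lra.
Qed.

Let rhs_bound k r : 0 < r -> J r -> `|r - x k| <= K k * mu k ->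
  `|u2 k r + d%:R / r * u1 k r| <= gk k /\ `|v2 k r + d%:R / r * v1 k r| <= gk k.
Proof.
move=> r0 Jr rb; have [_ _ e3] := Hode k; have [E1 E2] := e3 _ r0 Jr.
have [bu bv] := Hbd Jr (ltW r0) rb.
have lin (a b : R) : `|a| <= A * M k -> `|b| <= A * M k ->
    `|lambda * a + gamma * b| <= (`|lambda| + `|gamma|) * (A * M k).
  move=> h1 h2; apply: (le_trans (ler_normD _ _)); rewrite !normrM mulrDl lerD//.
    by rewrite ler_wpM2l.
  by rewrite ler_wpM2l.
rewrite E1 E2 /gk; split; apply: (le_trans (ler_normB _ _)); apply: lerD.
- exact: lin.
- exact: nonlinearity_bound.
- exact: lin.
- exact: nonlinearity_bound.
Qed.

(* Here mu r ranges over a fixed neighbourhood of 0, so the initial condition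
   u'(0) = v'(0) = 0 controls the derivatives. *)
Let case_origin S : F [set k | x k / mu k <= S] -> False.
Proof.
move=> HS.
have hq' := hq.
have S0 : 0 <= S.
  have [k /= h] := ultra_ex FU HS.
  by rewrite (le_trans _ h)// divr_ge0 ?x0// ltW// mu0.
have HSn : F [set k | `|x k / mu k| <= S].
  apply: filterS HS => k /=; rewrite ger0_norm// divr_ge0 ?x0// ltW// mu0.
have [s0 Hs0] := ulim_exists FU HSn.
have s00 : 0 <= s0.
  rewrite -oppr_le0; apply: (@ulim_le R F FU (fun k => - (x k / mu k))).
    by move=> z z0; apply: filterS (Hs0 _ z0) => k /=; rewrite -normrN !opprB addrC opprK.
  by apply: filterS filterT => k _ /=; rewrite oppr_le0 divr_ge0 ?x0// ltW// mu0.
have s0S : s0 < S + 1 by have := ulim_le FU Hs0 HS; lra.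
have dom T : 0 < T -> F [set k | forall s, 0 <= s <= T -> [/\ 0 <= mu k * s, mu k * s <= rho,
    `|mu k * s - x k| <= K k * mu k & J (mu k * s)]].
  move=> T0; have z : 0 < rho / T by rewrite divr_gt0.
  apply: filterS (ultraI FU (Hmu z) (ultraI FU (HK (T + S)) HS)) => k /= [h1 [h2 h3]] s /andP[sp sT].
  have muk := mu0 k.
  have m1 : mu k * T < rho by move: h1; rewrite subr0 gtr0_norm// ltr_pdivlMr.
  have m2 : mu k * s <= mu k * T by rewrite ler_pM2l.
  have m3 : 0 <= mu k * s by rewrite mulr_ge0// ltW.
  split=> //; first by rewrite (le_trans m2)// ltW.
    have m4 : mu k * (T + S) <= K k * mu k by rewrite mulrC ler_pM2r.
    have m5 : x k <= mu k * S by move: h3; rewrite ler_pdivrMr// mulrC.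
    have m6 : 0 <= mu k * T by rewrite mulr_ge0// ltW.
    have m7 : 0 <= mu k * S by rewrite mulr_ge0// ltW.
    have := x0 k; rewrite mulrDr in m4 => xk.
    by rewrite ler_norml; apply/andP; split; lra.
  by apply: (HJ Jrho); rewrite m3 (le_trans m2)// ltW.
have der T : 0 < T -> F [set k | forall s, 0 <= s <= T ->
    mu k / M k * `|u1 k (mu k * s)| <= B0 * s /\ mu k / M k * `|v1 k (mu k * s)| <= B0 * s].
  move=> T0; apply: filterS (ultraI FU (dom _ T0) gk_bound) => k /= [h1 h2] s sT.
  have muk := mu0 k; have Mk := M0 k.
  have [e1 [e2 e2'] _] := Hode k.
  have in_b r : 0 <= r <= mu k * T -> J r /\ `|r - x k| <= K k * mu k.
    move=> /andP[r0 rT]; have [|_ _ h3 h4] := h1 (r / mu k).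
      by rewrite divr_ge0 ?ler_pdivrMr ?(ltW muk)// mulrC.
    by move: h3 h4; rewrite mulrC divfK ?gt_eqF.
  have sTm : 0 <= mu k * s <= mu k * T.
    by case/andP: sT => ? ?; rewrite mulr_ge0 ?(ltW muk)//= ler_pM2l.
  have key (w1 w2 : R -> R) : (forall r, J r -> is_derive r 1 w1 (w2 r)) -> w1 0 = 0 ->
      (forall r, 0 < r -> J r -> `|r - x k| <= K k * mu k -> `|w2 r + d%:R / r * w1 r| <= gk k) ->
      mu k / M k * `|w1 (mu k * s)| <= B0 * s.
    move=> Dw w0 Hw.
    have := @flux_bound R d w1 w2 (gk k) (mu k * T) _ w0 _ _ sTm.
    move=> fb; have {}fb : `|w1 (mu k * s)| <= gk k * (mu k * s).
      apply: fb => r rT; first by apply: Dw; case: (in_b _ rT).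
      have [r0 rT'] := andP rT.
      by have [h3 h4] := in_b r (introT andP (conj (ltW r0) rT')); exact: Hw.
    have mM : 0 <= mu k / M k by rewrite divr_ge0// ltW.
    apply: (le_trans (ler_wpM2l mM fb)).
    rewrite (_ : mu k / M k * (gk k * (mu k * s)) = mu k ^+ 2 / M k * gk k * s); last by ring.
    by apply: ler_wpM2r => //; case/andP: sT.
  split.
    apply: (key _ (u2 k)) => // [r /e1[]//|r r0 Jr rb].
    by have [] := rhs_bound r0 Jr rb.
  apply: (key _ (v2 k)) => // [r /e1[]//|r r0 Jr rb].
  by have [] := rhs_bound r0 Jr rb.
have yE k s : 0 + 1 * mu k * s = mu k * s by ring.
apply: (@blow_up_impossible R F q lambda gamma A d d FU hq d2 d2 hd J beta u v u1 v1 u2 v2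
  beta0 1 C1 C2 C3 C4 (fun=> 0) mu M (fun k => x k / mu k) s0 (S + 1)) => //.
- by left.
- move=> T T0; apply: filterS (dom _ T0) => k /= h s sT; rewrite yE.
  have [h1 h2 h3 h4] := h _ sT; have [b1 b2] := Hbd h4 h1 h3.
  by split=> // sp; rewrite mulr_gt0// mu0.
- move=> T T0; exists (B0 * T); first by rewrite mulr_ge0// ltW.
  apply: filterS (der _ T0) => k /= h s sT; rewrite yE; have [h1 h2] := h _ sT.
  have BT : B0 * s <= B0 * T by rewrite ler_wpM2l//; case/andP: sT.
  by split; [exact: le_trans h1 BT|exact: le_trans h2 BT].
- move=> s sp e e0.
  have d1 : 0 < d%:R + 1 :> R by rewrite ltr_wpDl.
  exists (Num.min (s / 2) (e * s ^+ 2 / (2 * (d%:R + 1)))).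
    by rewrite lt_min !divr_gt0// ?mulr_gt0// exprn_gt0.
  apply: filterS filterT => k _ /= t; rewrite lt_min => /andP[t1 t2]; rewrite yE.
  have ts : s / 2 < t by move: t1; rewrite ltr_norml => /andP[? ?]; lra.
  have tp : 0 < t by lra.
  have muk := mu0 k.
  have E1 : d%:R * (1 * mu k / (mu k * t)) - d%:R / s = d%:R / (t * s) * (s - t).
    by move: muk; move: (mu k) => m m00; field; rewrite !gt_eqF.
  rewrite E1 normrM ger0_norm ?divr_ge0 ?mulr_ge0 ?(ltW tp) ?(ltW sp)// distrC.
  rewrite mulrAC ler_pdivrMr ?mulr_gt0//.
  move: t2; rewrite ltr_pdivlMr ?mulr_gt0// => t2.
  have h3 : e * (s * s) <= e * (2 * t * s).
    by rewrite ler_pM2l// ler_pM2r//; lra.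
  have := normr_ge0 (t - s); rewrite expr2 in t2; nra.
- exists (2 * A * B0); first by rewrite !mulr_ge0.
  move=> s s01 e e0; have sT : 0 <= s <= 1 by case/andP: s01 => /ltW ->.
  apply: filterS (ultraI FU (der _ ltr01) (dom _ ltr01)) => k /= [h h'].
  rewrite yE; have [b1 b2] := h _ sT; have [h1 h2 h3 h4] := h' _ sT.
  have [c1 c2] := Hbd h4 h1 h3.
  have Mk := M0 k; have muk := mu0 k; have /andP[sp s1] := s01.
  have sd : 0 <= s ^+ d <= 1 by rewrite exprn_ge0 ?exprn_ile1 ?(ltW sp).
  pose X := `|u k (mu k * s) * u1 k (mu k * s) + v k (mu k * s) * v1 k (mu k * s)|.
  have X1 : mu k / M k ^+ 2 * X <= 2 * A * B0 * s.
    have q1 (a b : R) : `|a| <= A * M k -> mu k / M k * `|b| <= B0 * s ->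
        mu k / M k ^+ 2 * (`|a| * `|b|) <= A * B0 * s.
      move=> ha hb; rewrite (_ : mu k / M k ^+ 2 * (`|a| * `|b|) = (`|a| / M k) * (mu k / M k * `|b|)); last first.
        by field; rewrite gt_eqF.
      rewrite -[leRHS]mulrA; apply: ler_pM => //.
      - by rewrite divr_ge0// ltW.
      - by rewrite mulr_ge0// divr_ge0// ltW.
      - by rewrite ler_pdivrMr.
    have := q1 _ _ c1 b1; have := q1 _ _ c2 b2.
    have : mu k / M k ^+ 2 * X <= mu k / M k ^+ 2 *
      (`|u k (mu k * s)| * `|u1 k (mu k * s)| + `|v k (mu k * s)| * `|v1 k (mu k * s)|).
      rewrite ler_wpM2l ?divr_ge0 ?exprn_ge0 ?(ltW Mk) ?(ltW muk)// -!normrM.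
      exact: ler_normD.
    by rewrite mulrDr; lra.
  rewrite -mulrA -/X.
  have X0 : 0 <= mu k / M k ^+ 2 * X.
    by rewrite mulr_ge0 ?normr_ge0// divr_ge0 ?exprn_ge0 ?(ltW Mk) ?(ltW muk).
  have : s ^+ d * (mu k / M k ^+ 2 * X) <= mu k / M k ^+ 2 * X.
    by rewrite ler_piMl//; case/andP: sd.
  lra.
- apply: filterS HS => k /= h; rewrite divr_ge0 ?x0 ?(ltW (mu0 k))//=; lra.
- move=> k; rewrite (_ : 0 + 1 * mu k * (x k / mu k) = x k) ?Hnorm//.
  by have := mu0 k; move: (mu k) => m m00; field; rewrite gt_eqF.
Qed.

(* The term with d/r disappears after rescaling, and the first order condition at
   x becomes (U U' + V V')(0) = 0. *)
Let case_interior : (forall S, F [set k | S < x k / mu k]) -> False.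
Proof.
move=> HS; have hq' := hq.
pose T1 T := Num.max T 1.
have der T : 1 <= T -> F [set k | forall s, 0 <= s <= T ->
    mu k / M k * `|u1 k (x k - mu k * s)| <= 4 * (2 * A + B0 * T) /\
    mu k / M k * `|v1 k (x k - mu k * s)| <= 4 * (2 * A + B0 * T)].
  move=> T1'; apply: filterS (ultraI FU (ultraI FU gk_bound (HS (2 * T))) (HK T)).
  move=> k /= [[gb xT] Kk] s sT.
  have muk := mu0 k; have Mk := M0 k.
  have xT' : 2 * (mu k * T) < x k by move: xT; rewrite ltr_pdivlMr//; lra.
  have Tp : 0 < T by lra.
  have mT : 0 < mu k * T by rewrite mulr_gt0.
  have [e1 _ _] := Hode k.
  have in_b r : x k - mu k * T <= r <= x k ->
      [/\ x k / 2 <= r, 0 < r, J r & `|r - x k| <= K k * mu k].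
    move=> /andP[h1 h2]; split; [lra|lra| |].
      by apply: (HJ (Jx k)); rewrite h2 andbT; lra.
    have : mu k * T <= K k * mu k by rewrite mulrC ler_pM2r.
    by rewrite ler_norml => ?; apply/andP; split; lra.
  have sm : 0 <= mu k * s <= mu k * T.
    by case/andP: sT => ? ?; rewrite mulr_ge0 ?(ltW muk)//= ler_pM2l.
  have key (w w1 w2 : R -> R) : (forall r, J r -> is_derive r 1 w (w1 r)) ->
      (forall r, J r -> is_derive r 1 w1 (w2 r)) ->
      (forall r, J r -> 0 <= r -> `|r - x k| <= K k * mu k -> `|w r| <= A * M k) ->
      (forall r, 0 < r -> J r -> `|r - x k| <= K k * mu k -> `|w2 r + d%:R / r * w1 r| <= gk k) ->
      mu k / M k * `|w1 (x k - mu k * s)| <= 4 * (2 * A + B0 * T).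
    move=> Dw Dw1 bw Hw.
    have G0 : 0 <= gk k.
      by rewrite /gk addr_ge0// mulr_ge0 ?powR_ge0 ?mulr_ge0 ?addr_ge0// ltW.
    have yb : x k - mu k * T <= x k - mu k * s <= x k.
      by case/andP: sm => ? ?; rewrite lerD2l lerN2 gerBl; apply/andP.
    have h : mu k * `|w1 (x k - mu k * s)| <= 4 * (2 * (A * M k) + mu k ^+ 2 * gk k * T).
      apply: (@derivative_bound_far R d w w1 w2 (x k)) => // [r|r|r|r] /in_b[_ r0 Jr rb].
      - exact: Dw.
      - exact: Dw1.
      - by apply: bw => //; exact: ltW.
      - exact: Hw.
    rewrite mulrAC ler_pdivrMr// (le_trans h)// -[leRHS]mulrA ler_pM2l// (mulrDl (2 * A)).
    rewrite (mulrA 2 A) lerD2l -ler_pdivrMr// (_ : _ / M k = mu k ^+ 2 / M k * gk k * T); last by ring.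
    by rewrite ler_wpM2r// ltW.
  split.
    apply: (key (u k) _ (u2 k)) => [r /e1[]//|r /e1[]//|r Jr r0 rb|r r0 Jr rb].
      by have [] := Hbd Jr r0 rb.
    by have [] := rhs_bound r0 Jr rb.
  apply: (key (v k) _ (v2 k)) => [r /e1[]//|r /e1[]//|r Jr r0 rb|r r0 Jr rb].
    by have [] := Hbd Jr r0 rb.
  by have [] := rhs_bound r0 Jr rb.
have yE k s : x k + -1 * mu k * s = x k - mu k * s by ring.
have dom T : 0 < T -> F [set k | forall s, 0 <= s <= T ->
    [/\ J (x k - mu k * s), 0 < x k - mu k * s & `|x k - mu k * s - x k| <= K k * mu k]].
  move=> T0; apply: filterS (ultraI FU (HS T) (HK T)) => k /= [h1 h2] s /andP[sp sT].
  have muk := mu0 k.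
  have m1 : mu k * T < x k by move: h1; rewrite ltr_pdivlMr// mulrC.
  have m2 : mu k * s <= mu k * T by rewrite ler_pM2l.
  have m3 : 0 <= mu k * s by rewrite mulr_ge0// ltW.
  have m4 : mu k * T <= K k * mu k by rewrite mulrC ler_pM2r.
  split; [apply: (HJ (Jx k)); apply/andP; split|..|rewrite ler_norml; apply/andP; split]; lra.
have D2 : (0 <= 2)%N by [].
have hD : ((0 : nat)%:R - 1) * (q + 1) < 2 by lra.
apply: (@blow_up_impossible R F q lambda gamma A d 0 FU hq d2 D2 hD J beta u v u1 v1 u2 v2
  beta0 (-1) C1 C2 C3 C4 x mu M (fun=> 0) 0 1) => //.
- by right.
- move=> T T0; apply: filterS (dom _ T0) => k /= h s sT; rewrite yE.
  have [h1 h2 h3] := h _ sT; have [b1 b2] := Hbd h1 (ltW h2) h3.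
  by split.
- move=> T T0; exists (4 * (2 * A + B0 * T1 T)).
    by rewrite mulr_ge0// addr_ge0 ?mulr_ge0// le_max ltW.
  have T11 : 1 <= T1 T by rewrite le_max lexx orbT.
  apply: filterS (der _ T11) => k /= h s /andP[sp sT]; rewrite yE; apply: h.
  by rewrite sp /T1 le_max sT.
- move=> s sp e e0; exists 1 => //.
  have de : 0 <= d%:R / e :> R by rewrite divr_ge0// ltW.
  apply: filterS (HS (s + 1 + (d%:R / e + 1))) => k /= h t ts; rewrite yE.
  have muk := mu0 k.
  have tl : t < s + 1 by move: ts; rewrite ltr_norml => /andP[? ?]; lra.
  have E1 : d%:R * (-1 * mu k / (x k - mu k * t)) - 0 / s = - (d%:R / (x k / mu k - t)).
    have E0 (m X : R) : m != 0 -> X - t != 0 ->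
        d%:R * (-1 * m / (m * X - m * t)) - 0 / s = - (d%:R / (X - t)).
      move=> m00 X0; rewrite -mulrBr; move: (X - t) X0 => Z Z0; field.
      by rewrite (gt_eqF sp) m00 Z0.
    rewrite -(E0 (mu k) (x k / mu k)) ?gt_eqF//; last by rewrite subr_gt0; lra.
    by rewrite [mu k * (x k / mu k)]mulrC divfK// gt_eqF.
  have xt : d%:R / e + 1 < x k / mu k - t by lra.
  have xt0 : 0 < x k / mu k - t by lra.
  rewrite E1 normrN ger0_norm ?divr_ge0 ?(ltW xt0)// ler_pdivrMr//.
  have : d%:R = e * (d%:R / e) :> R by field; rewrite gt_eqF.
  by move=> ->; rewrite ler_pM2l//; lra.
- have B1 := der 1 (lexx _).
  pose c := 4 * (2 * A + B0 * 1).
  have c0 : 0 <= c by rewrite mulr_ge0// addr_ge0// mulr_ge0.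
  exists (2 * (c * c + A * (c + B0))).
    by rewrite mulr_ge0// addr_ge0// mulr_ge0// addr_ge0.
  move=> s s01 e e0.
  apply: filterS (ultraI FU (ultraI FU B1 (dom _ ltr01))
    (ultraI FU (ultraI FU (HQ e0) gk_bound) (HS 4))) => k /= [[h1 h2] [[h3 h4] h5]].
  rewrite yE expr0 mul1r.
  have Mk := M0 k; have muk := mu0 k; have /andP[sp s1] := s01.
  have x4 : 4 * mu k < x k by move: h5; rewrite ltr_pdivlMr.
  have xp : 0 < x k by lra.
  pose Q t := u k t * u1 k t + v k t * v1 k t.
  have [e1 _ _] := Hode k.
  pose N := M k ^+ 2 / mu k.
  have N0 : 0 < N by rewrite divr_gt0// exprn_gt0.
  have ms : mu k * s <= mu k by rewrite ler_piMr// ltW.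
  have ms0 : 0 < mu k * s by rewrite mulr_gt0.
  have inn (t : R) : x k - mu k * s <= t <= x k -> exists2 s', 0 <= s' <= 1 & t = x k - mu k * s'.
    move=> /andP[t1 t2]; exists ((x k - t) / mu k).
      by rewrite divr_ge0 ?ler_pdivrMr ?subr_ge0 ?(ltW muk)//; lra.
    by field; rewrite gt_eqF.
  have Dlip : `|Q (x k) - Q (x k - mu k * s)| <=
      (M k / mu k) ^+ 2 * (2 * (c * c + A * (c + B0))) * (x k - (x k - mu k * s)).
    have xs : x k - mu k * s <= x k by lra.
    apply: (@der_lip R Q (fun t => u1 k t * u1 k t + u k t * u2 k t
      + (v1 k t * v1 k t + v k t * v2 k t)) _ _ _ xs) => t tb.
      have [s' s'1 E] := inn _ tb; have [Jt _ _] := h2 _ s'1.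
      rewrite -E in Jt; have [d1 d2' d3 d4] := e1 _ Jt.
      exact: (derD (derM d1 d2') (derM d3 d4)).
    have tb' : x k - mu k * s <= t <= x k by case/andP: tb => ? ?; rewrite !ltW.
    have [s' s'1 E] := inn _ tb'.
    have [Jt t0 tK] := h2 _ s'1; have [b1 b2] := h1 _ s'1.
    rewrite -E in Jt t0 tK b1 b2.
    have [g1 g2] := rhs_bound t0 Jt tK.
    have [a1 a2] := Hbd Jt (ltW t0) tK.
    have t3 : 2 * mu k <= t by case/andP: tb'; lra.
    have key (w w1 w2 : R) : `|w| <= A * M k -> mu k / M k * `|w1| <= c ->
        `|w2 + d%:R / t * w1| <= gk k ->
        `|w1 * w1 + w * w2| <= (M k / mu k) ^+ 2 * (c * c + A * (c + B0)).
      move=> hw hw1 hw2.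
      have w1b : `|w1| <= c * (M k / mu k).
        move: hw1; rewrite -ler_pdivlMl ?divr_gt0// invf_div mulrC.
        by [].
      have gkb : gk k <= B0 * (M k / mu k ^+ 2).
        move: h4; rewrite -ler_pdivlMl ?divr_gt0 ?exprn_gt0// invf_div mulrC.
        by [].
      have dt : d%:R / t <= (mu k)^-1.
        rewrite ler_pdivrMr// mulrC ler_pdivlMr//.
        apply: (le_trans _ t3); rewrite ler_pM2r//.
        by rewrite ler_nat.
      have w2b : `|w2| <= (M k / mu k ^+ 2) * (c + B0).
        rewrite (_ : w2 = (w2 + d%:R / t * w1) - d%:R / t * w1); last by ring.
        apply: (le_trans (ler_normB _ _)).
        have : `|d%:R / t * w1| <= (mu k)^-1 * (c * (M k / mu k)).
          rewrite normrM; apply: ler_pM => //.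
          by rewrite ger0_norm// divr_ge0// ltW.
        rewrite (_ : (mu k)^-1 * _ = (M k / mu k ^+ 2) * c); last by field; rewrite gt_eqF.
        by rewrite (mulrDr (M k / mu k ^+ 2)) (mulrC _ B0); lra.
      apply: (le_trans (ler_normD _ _)); rewrite !normrM mulrDr; apply: lerD.
        rewrite (_ : _ * (c * c) = (c * (M k / mu k)) * (c * (M k / mu k))); last by ring.
        exact: ler_pM.
      rewrite (_ : _ * (A * (c + B0)) = (A * M k) * ((M k / mu k ^+ 2) * (c + B0))); last first.
        by field; rewrite gt_eqF.
      exact: ler_pM.
    apply: (le_trans (ler_normD _ _)).
    have := key _ _ _ a1 b1 g1; have := key _ _ _ a2 b2 g2; lra.
  have Qx := h3 xp.
  rewrite -/(Q (x k - mu k * s)).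
  rewrite -/(Q (x k)) in Qx.
  have nu : 0 < mu k / M k ^+ 2 by rewrite divr_gt0// exprn_gt0.
  apply: (@le_trans _ _ (mu k / M k ^+ 2 * (`|Q (x k) - Q (x k - mu k * s)| + `|Q (x k)|))).
    rewrite ler_pM2l//.
    by have := ler_normB (Q (x k)) (Q (x k) - Q (x k - mu k * s)); rewrite subKr; lra.
  rewrite mulrDr; apply: lerD => //.
  move: Dlip; rewrite subKr => Dlip.
  apply: (le_trans (ler_wpM2l (ltW nu) Dlip)).
  by rewrite le_eqVlt; apply/orP; left; apply/eqP; field; rewrite !gt_eqF.
- by move=> e e0; apply: filterS filterT => k _ /=; rewrite subrr normr0.
- by apply: filterS filterT => k _ /=; rewrite lexx ler01.
- by move=> k; rewrite mulr0 addr0 Hnorm.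
Qed.

Theorem no_blow_up_sequence : False.
Proof.
have [[S HS]|N] := pselect (exists S, F [set k | x k / mu k <= S]).
  exact: case_origin HS.
apply: case_interior => S.
have [h|h] := in_ultra_setVsetC [set k | x k / mu k <= S] FU.
  by exfalso; apply: N; exists S.
by apply: filterS h => k /= /negP; rewrite -ltNge.
Qed.

End BlowUpSequence.

(** * Choice of the blow-up point and the bound for radial profiles *)

Section WindowMaximum.
Variable R : realType.
Implicit Types (N : R -> R) (a b r m e : R).

(** The weight is smooth, so that a maximum of the weighted function satisfies a
    first order condition. *)
Definition window r0 r : R := 1 - (r - r0) ^+ 2.

Lemma is_derive_window r0 r : is_derive r 1 (window r0) (- (2 * (r - r0))).
Proof.
apply: (der_eq (derB (derC r 1) (derX 2 (derB (derI r) (derC r r0))))).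
by rewrite /= expr1 subr0 mulr1 sub0r.
Qed.

(** The derivative of the window is at most 2 in absolute value near r0, so over
    the distance window / 4 it loses at most half of its value. *)
Lemma window_half r0 x r : 0 < window r0 x -> `|r - x| <= window r0 x / 4 ->
  window r0 x / 2 <= window r0 r.
Proof.
rewrite /window (_ : r - r0 = (r - x) + (x - r0)); last by ring.
move: (r - x) (x - r0) => t s s1; rewrite ler_norml => /andP[t1 t2].
have s0 : 0 <= s ^+ 2 by rewrite sqr_ge0.
have [h1 h2] : s < 1 /\ -1 < s by split; nra.
by have [tp|tn] := leP 0 t; have [sp|sn] := leP 0 s; nra.
Qed.

(** The maximum of window^2 N^e is interior or at 0.  The first order condition
    at an interior maximum bounds the logarithmic derivative of N by
    4 / (e window). *)
Lemma window_maximum (N N1 : R -> R) r0 b m e : 0 < e -> 1 <= m ->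
  let a := Num.max 0 (r0 - 1) in
  0 <= r0 -> r0 < b -> b <= r0 + 1 ->
  {within `[a, b], continuous N} ->
  (forall r, a <= r <= b -> 0 <= N r) -> b = r0 + 1 \/ N b = 0 -> m <= N r0 ->
  (forall r, a < r < b -> is_derive r 1 N (N1 r)) ->
  exists x, [/\ a <= x < b, 0 < window r0 x,
    m <= N x /\ m `^ e <= window r0 x ^+ 2 * N x `^ e,
    forall r, a <= r <= b -> window r0 r ^+ 2 * N r `^ e <= window r0 x ^+ 2 * N x `^ e
  & 0 < x -> `|N1 x| <= 4 * N x / (e * window r0 x)].
Proof.
move=> e0 m1 a r00 r0b br1 cN N0 hb mN DN.
pose phi r := window r0 r ^+ 2 * `|N r| `^ e.
have ab : a < b by rewrite /a gt_max; apply/andP; split; lra.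
have ar0 : a <= r0 by rewrite /a ge_max r00 /=; lra.
have ra r : a <= r -> 0 <= r /\ r0 - 1 <= r by rewrite /a ge_max => /andP[].
have r0i : a <= r0 <= b by rewrite ar0 ltW.
have cphi : {within `[a, b], continuous phi}.
  move=> z; apply: (@cvgM _ _ (nbhs z)).
    apply: (@continuous_subspaceT _ _ `[a, b] (fun r => window r0 r ^+ 2)) => w.
    exact: (is_derive1_continuous (derX 2 (is_derive_window r0 w))).
  exact: (continuous_comp (cN z) (continuous_normpow e0 (x := N z))).
have [x xab Hx] := EVT_max (ltW ab) cphi.
have {}xab : a <= x <= b by move: xab; rewrite in_itv.
have phiE r : a <= r <= b -> phi r = window r0 r ^+ 2 * N r `^ e.
  by move=> rab; rewrite /phi ger0_norm ?N0.
have {}Hx r : a <= r <= b -> window r0 r ^+ 2 * N r `^ e <= window r0 x ^+ 2 * N x `^ e.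
  by move=> rab; rewrite -!phiE//; apply: Hx; rewrite in_itv.
have w1 : window r0 r0 = 1 by rewrite /window subrr expr0n subr0.
have m0 : 0 < m by lra.
have me : m `^ e <= window r0 x ^+ 2 * N x `^ e.
  apply: (le_trans _ (Hx _ r0i)); rewrite w1 expr1n mul1r.
  by apply: ler_powRl => //; exact: ltW.
have mep : 0 < window r0 x ^+ 2 * N x `^ e by rewrite (lt_le_trans _ me)// powR_gt0.
have xa := andP xab.
have w0 : 0 <= window r0 x.
  by have [h1 h2] := ra _ (proj1 xa); have h3 := proj2 xa; rewrite /window subr_ge0; nra.
have wp : 0 < window r0 x.
  by rewrite lt_def w0 andbT; apply: contraTneq mep => ->; rewrite expr0n mul0r ltxx.
have Nxp : 0 < N x.
  rewrite lt_def N0// andbT; apply: contraTneq mep => ->.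
  by rewrite powR0 ?mulr0 ?ltxx// gt_eqF.
have xb : x < b.
  rewrite lt_def (proj2 xa) andbT; apply/eqP => E.
  case: hb => hb; last by move: Nxp; rewrite -E hb ltxx.
  by move: wp; rewrite -E hb /window addrAC subrr add0r expr1n subrr ltxx.
have wle : window r0 x <= 1 by rewrite /window gerBl sqr_ge0.
exists x; split=> //.
- by rewrite (proj1 xa).
- split=> //; have : m `^ e <= N x `^ e.
    apply: (le_trans me); rewrite ler_piMl ?powR_ge0// expr2.
    by rewrite mulr_ile1.
  by rewrite leNgt => h; rewrite leNgt; apply: contra h => h; apply: ltr_powRl => //; rewrite ltW.
move=> x0.
have ax : a < x.
  rewrite lt_def (proj1 xa) andbT; apply/eqP => E.
  move: wp; rewrite /window; case: (leP 0 (r0 - 1)) => h.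
    by rewrite E /a (max_r h) addrAC subrr add0r sqrrN expr1n subrr ltxx.
  by move: x0; rewrite E /a (max_l (ltW h)) ltxx.
have Dphi r : a < r < b -> 0 < N r ->
    derivable (fun r => window r0 r ^+ 2 * N r `^ e) r 1.
  move=> rab Np.
  have [D _] := derM (derX 2 (is_derive_window r0 r)) (der_comp (DN _ rab) (is_derive1_powR e Np)).
  exact: D.
have xab' : a < x < b by rewrite ax.
have [de de0 Hde] := is_derive1_ct (DN _ xab') Nxp.
pose z := Num.min de (Num.min (x - a) (b - x)).
have z0 : 0 < z by rewrite !lt_min de0 !subr_gt0 ax.
have zin r : x - z < r < x + z -> a < r < b /\ 0 < N r.
  move=> rz; have : `|r - x| < z by rewrite ltr_norml; case/andP: rz => ? ?; apply/andP; split; lra.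
  rewrite !lt_min => /andP[/Hde h /andP[h1 h2]].
  move: h h1 h2; rewrite !ltr_norml => /andP[? ?] /andP[? ?] /andP[? ?].
  by split; [apply/andP; split|]; lra.
have zz : x - z <= x + z by lra.
have F0 : is_derive x 1 (fun r => window r0 r ^+ 2 * N r `^ e) 0.
  apply: (@derive1_at_max _ _ (x - z) (x + z) x zz).
  - by move=> t; rewrite in_itv /= => /zin[tab Nt]; exact: (Dphi _ tab Nt).
  - by rewrite in_itv /=; apply/andP; split; lra.
  - move=> t; rewrite in_itv /= => /zin[/andP[h1 h2] _].
    by apply: Hx; rewrite !ltW.
have := der_uniq F0 (derM (derX 2 (is_derive_window r0 x))
  (der_comp (DN _ xab') (is_derive1_powR e Nxp))).
rewrite /= expr1 -(@mulr_powRB1 _ (N x) e)//; last exact: ltW.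
set w := window r0 x in w0 wp wle *; set P := N x `^ (e - 1).
have P0 : 0 < P by rewrite powR_gt0.
move=> E; have {}E : e * w * N1 x = 4 * (x - r0) * N x.
  have wP : w * P != 0 by rewrite mulf_neq0// gt_eqF.
  by apply: (mulfI wP); rewrite -[RHS]addr0 {1}E; ring.
have xr : `|x - r0| <= 1.
  have : (x - r0) ^+ 2 <= 1 by move: wp; rewrite /w /window; lra.
  by rewrite -real_normK ?num_real// expr_le1.
rewrite ler_pdivlMr ?mulr_gt0// mulrC -{1}(gtr0_norm (mulr_gt0 e0 wp)) -normrM E.
rewrite !normrM normr_nat (gtr0_norm Nxp) ler_wpM2r ?(ltW Nxp)//.
by rewrite ler_piMr.
Qed.

End WindowMaximum.

Section RadialBound.
Variables (R : realType) (q : R).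
Implicit Types (J : set R) (u v : R -> R) (lambda gamma beta r : R) (d : nat).

(* The domain is exhausted within distance one of r0, or the functions vanish
   at its edge. *)
Definition vanishes_at_edge J u v := forall r0, 0 <= r0 -> J r0 -> exists b,
  [/\ r0 < b <= r0 + 1,
      {within `[0, b], continuous u} /\ {within `[0, b], continuous v},
      forall r, 0 <= r < b -> J r,
      forall r, J r -> r <= r0 + 1 -> r <= b
    & b = r0 + 1 \/ u b = 0 /\ v b = 0].

(** With K = window / (4 mu), the window loses at most half of its value on
    |r - x| <= K mu, which bounds the solution there by 2^(1/(q+1)) M; and
    K^2 = window^2 N^(q+1) / 16 is large at the maximum. *)
Lemma blow_up_center d lambda gamma beta J u v u1 v1 u2 v2 r0 m : -1 < q ->
  radial_ode q d lambda gamma beta J u v u1 v1 u2 v2 -> vanishes_at_edge J u v ->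
  0 <= r0 -> J r0 -> 1 <= m -> m <= u r0 ^+ 2 + v r0 ^+ 2 ->
  exists p : R * R * R, let: (x, M, K) := p in let mu := M `^ (- (q + 1)) in
  [/\ [/\ 0 <= x, J x, 0 < M & u x ^+ 2 + v x ^+ 2 = M ^+ 2],
      m <= M ^+ 2, 0 < K /\ m `^ (q + 1) <= 16 * K ^+ 2,
      forall r, J r -> 0 <= r -> `|r - x| <= K * mu ->
        `|u r| <= 2 `^ ((q + 1)^-1) * M /\ `|v r| <= 2 `^ ((q + 1)^-1) * M
    & 0 < x -> mu / M ^+ 2 * `|u x * u1 x + v x * v1 x| <= (2 * (q + 1) * K)^-1].
Proof.
move=> hq [e1 _ _] Hedge r00 Jr0 m1 mN.
have e0 : 0 < q + 1 by lra.
have [b [/andP[r0b b1] [cu cv] Jb bJ hb]] := Hedge _ r00 Jr0.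
pose N r := u r ^+ 2 + v r ^+ 2.
pose N1 r := 2 * (u r * u1 r + v r * v1 r).
pose a := Num.max 0 (r0 - 1).
have a0 : 0 <= a by rewrite le_max lexx.
have N0 r : 0 <= N r by rewrite addr_ge0 ?sqr_ge0.
have sub : `[a, b] `<=` `[0, b].
  by move=> z /=; rewrite !in_itv /= => /andP[h ->]; rewrite (le_trans a0).
have cN : {within `[a, b], continuous N}.
  have cu' := continuous_subspaceW sub cu; have cv' := continuous_subspaceW sub cv.
  by move=> z; apply: cvgD; (apply: (@cvgM _ _ (nbhs z)); [exact: cu' || exact: cv'|exact: cu' || exact: cv']).
have DN r : J r -> is_derive r 1 N (N1 r).
  move=> /e1[Du _ Dv _]; apply: (der_eq (derD (derX 2 Du) (derX 2 Dv))).
  by rewrite /= !expr1 /N1; ring.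
have [|||x [/andP[ax xb] wp [mx mex] Hx HQ]] := @window_maximum R N N1 r0 b m (q + 1) e0 m1 r00 r0b b1 cN
  (fun r _ => N0 r).
- by case: hb => [->|[ub vb]]; [left|right; rewrite /N ub vb expr0n addr0].
- exact: mN.
- by move=> r /andP[ar rb]; apply: DN; apply: Jb; rewrite rb (le_trans a0)// ltW.
have x0 : 0 <= x by rewrite (le_trans a0).
pose M := Num.sqrt (N x).
have Nxp : 0 < N x by lra.
have Mp : 0 < M by rewrite sqrtr_gt0.
have M2 : M ^+ 2 = N x by rewrite sqr_sqrtr.
pose mu := M `^ (- (q + 1)).
have mup : 0 < mu by rewrite powR_gt0.
have mu2 : mu ^+ 2 * N x `^ (q + 1) = 1.
  rewrite -M2 -(powR_mulrn 2 (ltW Mp)) -powRrM -powR_mulrn ?(ltW mup)// /mu -powRrM -powRD.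
    by rewrite (_ : _ + _ = 0) ?powRr0//; ring.
  by rewrite (gt_eqF Mp) implybT.
pose K := window r0 x / (4 * mu).
have Kp : 0 < K by rewrite divr_gt0// mulr_gt0.
have Kmu : K * mu = window r0 x / 4 by rewrite /K; field; rewrite gt_eqF.
exists (x, M, K); split.
- by split=> //; apply: Jb; rewrite x0.
- by rewrite M2.
- split=> //; apply: (le_trans mex).
  rewrite -{1}(mul1r (window r0 x ^+ 2)) -mulrA mulrC.
  rewrite (_ : 16 * K ^+ 2 = window r0 x ^+ 2 * (mu ^+ 2)^-1); last first.
    by rewrite /K; field; rewrite gt_eqF.
  rewrite mulr1 ler_wpM2l ?sqr_ge0//.
  by rewrite -[leRHS]mulr1 -{2}mu2 mulrA mulVf ?mul1r// expf_neq0// gt_eqF.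
- rewrite -/mu Kmu => r Jr r0' rx.
  have wr := window_half wp rx.
  have rwin : `|r - r0| <= 1.
    have : (r - r0) ^+ 2 <= 1 by move: wr wp; rewrite /window; lra.
    by rewrite -real_normK ?num_real// expr_le1.
  have rab : a <= r <= b.
    move: rwin; rewrite ler_norml => /andP[h1 h2].
    rewrite /a ge_max r0' /=; apply/andP; split; first by lra.
    by apply: bJ => //; lra.
  have := Hx _ rab.
  have wr2 : window r0 x ^+ 2 / 4 <= window r0 r ^+ 2.
    rewrite (_ : window r0 x ^+ 2 / 4 = (window r0 x / 2) ^+ 2); last by field.
    rewrite lerXn2r ?nnegrE//; first by rewrite divr_ge0// ltW.
    by rewrite (le_trans _ wr)// divr_ge0// ltW.
  have P0 := powR_ge0 (N r) (q + 1).
  move=> h; have {}h : N r `^ (q + 1) <= 4 * N x `^ (q + 1).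
    have wp2 : 0 < window r0 x ^+ 2 by rewrite exprn_gt0.
    rewrite -(ler_pM2l wp2); have := ler_wpM2r P0 wr2; lra.
  have ei : 0 <= (q + 1)^-1 by rewrite invr_ge0 ltW.
  have Nr : N r <= (2 `^ (q + 1)^-1 * M) ^+ 2.
    have : (N r `^ (q + 1)) `^ (q + 1)^-1 <= (4 * N x `^ (q + 1)) `^ (q + 1)^-1.
      exact: ler_powRl.
    rewrite powRM ?powR_ge0// -!powRrM mulfV ?gt_eqF// !powRr1 ?N0//.
    rewrite exprMn M2; congr (_ <= _ * _).
    rewrite -(powR_mulrn 2) ?powR_ge0// -powRrM mulrC powRrM.
    by rewrite (powR_mulrn 2)// expr2 -natrM.
  have sq (y z : R) : y ^+ 2 + z ^+ 2 <= (2 `^ (q + 1)^-1 * M) ^+ 2 ->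
      `|y| <= 2 `^ (q + 1)^-1 * M.
    move=> hy; have b0 : 0 <= 2 `^ (q + 1)^-1 * M by rewrite mulr_ge0 ?powR_ge0// ltW.
    rewrite -(@ler_sqr _ `|y|) ?nnegrE// real_normK ?num_real//; have := sqr_ge0 z; lra.
  by split; [exact: (sq _ _ Nr)|apply: (sq _ (u r)); rewrite addrC].
- rewrite -/mu => xp; have := HQ xp; rewrite /N1 normrM normr_nat => h.
  rewrite M2.
  have {}h : `|u x * u1 x + v x * v1 x| <= 2 * N x / ((q + 1) * window r0 x).
    move: h; have -> : 4 * N x / ((q + 1) * window r0 x) =
        2 * (2 * N x / ((q + 1) * window r0 x)) by ring.
    by rewrite ler_pM2l.
  have nu : 0 < mu / N x by rewrite divr_gt0.
  apply: (le_trans (ler_wpM2l (ltW nu) h)).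
  rewrite le_eqVlt; apply/orP; left; apply/eqP; rewrite /K; field.
  by rewrite !gt_eqF.
Qed.

(** A sequence of solutions whose sizes exceed k + 1 would produce a blow-up
    sequence along any ultrafilter containing the cofinite sets. *)
Theorem radial_a_priori_bound d lambda gamma J (B Bstar : set R) (C1 C2 C3 C4 rho : R) :
  -1 < q -> (d <= 2)%N -> (d%:R - 1) * (q + 1) < 2 -> initial_segment J ->
  0 < rho -> J rho -> compact B -> B `<=` ~` [set -1] -> compact Bstar ->
  exists C : R, forall beta u v u1 v1 u2 v2 r0,
    radial_ode q d lambda gamma beta J u v u1 v1 u2 v2 -> vanishes_at_edge J u v ->
    [/\ (zero_number_on J u <= C1%:E)%E, (zero_number_on J v <= C2%:E)%E,
      (zero_number_on J (fun r => u r - v r)%R <= C3%:E)%E &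
      (zero_number_on J (fun r => u r + v r)%R <= C4%:E)%E] ->
    B beta \/ (Bstar beta /\ ((exists2 r, 0 <= r /\ J r & u r != v r) /\
      (exists2 r, 0 <= r /\ J r & u r != - v r))) ->
    0 <= r0 -> J r0 -> u r0 ^+ 2 + v r0 ^+ 2 <= C.
Proof.
move=> hq d2 hd HJ rho0 Jrho cB B1 cBs.
apply: contrapT => NC.
pose good (k : nat) (z : R * ((R -> R) * (R -> R)) * ((R -> R) * (R -> R))
     * ((R -> R) * (R -> R)) * (R * R * R)) :=
  let: (beta, (u, v), (u1, v1), (u2, v2), (x, M, K)) := z in
  let mu := M `^ (- (q + 1)) in
  [/\ radial_ode q d lambda gamma beta J u v u1 v1 u2 v2,
    [/\ (zero_number_on J u <= C1%:E)%E, (zero_number_on J v <= C2%:E)%E,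
      (zero_number_on J (fun r => u r - v r)%R <= C3%:E)%E &
      (zero_number_on J (fun r => u r + v r)%R <= C4%:E)%E],
    B beta \/ (Bstar beta /\ ((exists2 r, 0 <= r /\ J r & u r != v r) /\
      (exists2 r, 0 <= r /\ J r & u r != - v r))),
    [/\ 0 <= x, J x, 0 < M & u x ^+ 2 + v x ^+ 2 = M ^+ 2] &
    [/\ k.+1%:R <= M ^+ 2, 0 < K /\ k.+1%:R `^ (q + 1) <= 16 * K ^+ 2,
      forall r, J r -> 0 <= r -> `|r - x| <= K * mu ->
        `|u r| <= 2 `^ ((q + 1)^-1) * M /\ `|v r| <= 2 `^ ((q + 1)^-1) * M
    & 0 < x -> mu / M ^+ 2 * `|u x * u1 x + v x * v1 x| <= (2 * (q + 1) * K)^-1]].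
have ex k : exists z, good k z.
  apply: contrapT => N; apply: NC; exists k.+1%:R.
  move=> beta u v u1 v1 u2 v2 r0 Ho He Hz Hc r00 Jr0.
  rewrite leNgt; apply/negP => /ltW big.
  have m1 : 1 <= k.+1%:R :> R by rewrite ler1n.
  have [[[x M] K] [h1 h2 h3 h4 h5]] := blow_up_center hq Ho He r00 Jr0 m1 big.
  by apply: N; exists (beta, (u, v), (u1, v1), (u2, v2), (x, M, K)).
have [zs Hzs] := choice ex.
have [F [FU Foo]] := ultraFilterLemma (eventually_filter).
pose beta k := (zs k).1.1.1.1.
pose u k := (zs k).1.1.1.2.1; pose v k := (zs k).1.1.1.2.2.
pose u1 k := (zs k).1.1.2.1; pose v1 k := (zs k).1.1.2.2.
pose u2 k := (zs k).1.2.1; pose v2 k := (zs k).1.2.2.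
pose x k := (zs k).2.1.1; pose M k := (zs k).2.1.2; pose K k := (zs k).2.2.
have G k : good k (beta k, (u k, v k), (u1 k, v1 k), (u2 k, v2 k), (x k, M k, K k)).
  have := Hzs k; rewrite /beta /u /v /u1 /v1 /u2 /v2 /x /M /K.
  by case: (zs k) => [[[[? [? ?]] [? ?]] [? ?]] [[? ?] ?]].
have big (C : R) : F [set k | C <= k.+1%:R].
  apply: Foo; exists (Num.truncn `|C|).+1 => // k /= hk.
  apply: (le_trans (ler_norm C)); apply: (le_trans (ltW (truncnS_gt _))).
  by rewrite ler_nat ltnW.
have bdd (S : set R) : compact S -> exists b : R, forall z, S z -> `|z| <= b.
  move=> /compact_bounded[b [_ hb]]; exists (b + 1) => z Sz.
  by apply: (hb (b + 1)) => //; rewrite ltrDl.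
have [bB HB] := bdd _ cB; have [bBs HBs] := bdd _ cBs.
have bb k : `|beta k| <= Num.max bB bBs.
  have [_ _ h _ _] := G k; rewrite le_max.
  by case: h => [/HB ->//|[/HBs ->]]; rewrite orbT.
have [beta0 Hb0] := ulim_exists FU (filterS (fun k _ => bb k) (filterT : F setT)).
have e0 : 0 < q + 1 by lra.
have K0 k : 0 < K k by have [_ _ _ _ [_ [h _] _ _]] := G k.
have M0 k : 0 < M k by have [_ _ _ [_ _ h _] _] := G k.
have HK (C : R) : F [set k | C <= K k].
  pose z := ((16 * (`|C| + 1) ^+ 2) `^ (q + 1)^-1).
  apply: filterS (big z) => k /= hk.
  have [_ _ _ _ [_ [_ h] _ _]] := G k.
  have z0 : 0 <= 16 * (`|C| + 1) ^+ 2 by rewrite mulr_ge0// sqr_ge0.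
  have : z `^ (q + 1) <= k.+1%:R `^ (q + 1).
    by apply: ler_powRl; rewrite ?powR_ge0// ltW.
  rewrite /z -powRrM mulVf ?gt_eqF// powRr1// => h'.
  have : (`|C| + 1) ^+ 2 <= K k ^+ 2 by lra.
  rewrite ler_sqr ?nnegrE ?(ltW (K0 k)) ?addr_ge0// => h2.
  by have := ler_norm C; lra.
have HM (C : R) : F [set k | C <= M k].
  apply: filterS (big ((`|C| + 1) ^+ 2)) => k /= hk.
  have [_ _ _ _ [h _ _ _]] := G k.
  have := le_trans hk h; rewrite ler_sqr ?nnegrE ?(ltW (M0 k)) ?addr_ge0// => h2.
  by have := ler_norm C; lra.
apply: (@no_blow_up_sequence R F q lambda gamma (2 `^ ((q + 1)^-1)) d FU hq d2 hd J beta
  u v u1 v1 u2 v2 beta0 C1 C2 C3 C4 rho x M K) => //.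
- by move=> k; have [] := G k.
- by move=> k; have [_ _ _ [] ] := G k.
- by move=> k; have [_ _ _ [] ] := G k.
- by move=> k; have [_ _ _ [] ] := G k.
- by move=> k; have [_ _ _ _ []] := G k.
- move=> e ep; apply: filterS (HK (2 * (q + 1) * e)^-1) => k /= hk xp.
  have [_ _ _ _ [_ _ _ h]] := G k; apply: (le_trans (h xp)).
  have p : 0 < 2 * (q + 1) * e by rewrite !mulr_gt0.
  rewrite -[leRHS]invrK lef_pV2 ?posrE ?invr_gt0 ?mulr_gt0//.
  have := ler_wpM2l (ltW (mulr_gt0 (ltr0n R 2) e0 : 0 < 2 * (q + 1))) hk.
  apply: le_trans; rewrite le_eqVlt; apply/orP; left; apply/eqP; field.
  by rewrite !gt_eqF.
- by move=> k; have [_ h _ _ _] := G k.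
- move=> b0.
  have [hS|hS] := in_ultra_setVsetC [set k | B (beta k)] FU; last first.
    by apply: filterS hS => k /= hk; have [_ _ [//|[_ h]] _ _] := G k.
  exfalso; apply: (B1 beta0); last by rewrite /= b0.
  have clB : closed B by apply: compact_closed => //; exact: Rhausdorff.
  apply: clB => A /nbhs_ballP[e /= ep eA].
  have [k [/= h1 h2]] := ultra_ex FU (ultraI FU hS (Hb0 _ ep)).
  by exists (beta k); split=> //; apply: eA; rewrite /ball /= distrC.
Qed.

End RadialBound.

(** * Radial functions of several variables *)

Section RadialFunctions.
Variables (R : realType) (n : nat).
Local Notation E := 'rV[R]_n.+1.
Implicit Types (x y : E) (i : 'I_n.+1) (r t : R) (w : E -> R) (D : domain R).

Definition axis_point r : E := \row_(i < n.+1) if (i == 0 :> nat) then r else 0.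

Lemma axis_pointE r : axis_point r = 0 + r *: delta_mx ord0 ord0.
Proof.
apply/rowP => i; rewrite !mxE /= add0r.
by rewrite -val_eqE /=; case: eqP => _; rewrite ?mulr1 ?mulr0.
Qed.

Lemma enorm_axis_point r : enorm (axis_point r) = `|r|.
Proof.
rewrite /enorm big_ord_recl big1 => [|i _]; last by rewrite mxE /= expr0n.
by rewrite addr0 mxE /= sqrtr_sqr.
Qed.

Lemma enorm_orthogonal r t i : i != ord0 ->
  enorm (axis_point r + t *: delta_mx ord0 i) = Num.sqrt (r ^+ 2 + t ^+ 2).
Proof.
move=> i0.
have nz (j : 'I_n.+1) : j != ord0 -> (j == 0 :> nat) = false by move/negbTE.
have comp j : (axis_point r + t *: delta_mx ord0 i) ord0 j =
    (if j == 0 :> nat then r else 0) + t * (j == i)%:R.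
  by rewrite !mxE eqxx.
rewrite /enorm (bigD1 ord0)//= (bigD1 i)//= big1 => [|j /andP[j0 ji]].
  rewrite addr0 !comp eqxx (nz i)// eqxx (_ : (ord0 == i) = false).
    by rewrite mulr0 addr0 mulr1 add0r.
  by rewrite eq_sym (negbTE i0).
by rewrite comp nz// (negbTE ji) mulr0 addr0 expr0n.
Qed.

Lemma enorm_ge0 x : 0 <= enorm x.
Proof. exact: sqrtr_ge0. Qed.

Lemma domain_setE D x : domain_set D x <-> domain_radii D (enorm x).
Proof.
case: D => [|rho] //=; first by rewrite enorm_ge0.
by rewrite enorm_ge0.
Qed.

Lemma line_derive w x v t : derivable w (x + t *: v) v ->
  is_derive t 1 (fun s => w (x + s *: v)) ('D_v w (x + t *: v)).
Proof.
move=> H.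
have E : (fun h : R => h^-1 *: (((fun s => w (x + s *: v)) \o shift t) (h *: 1) - w (x + t *: v)))
   = (fun h => h^-1 *: ((w \o shift (x + t *: v)) (h *: v) - w (x + t *: v))).
  apply/funext => h /=; congr (_ *: (w _ - _)).
  have -> : h *: (1 : R) = h by rewrite /GRing.scale /= mulr1.
  by rewrite scalerDl addrCA.
by split; rewrite /derivable /derive E.
Qed.

Section Profile.
Variables (D : domain R) (w : E -> R).
Local Notation Omega := (@domain_set R n.+1 D).
Local Notation J := (domain_radii D).
Hypothesis Hw : is_Ck 2 Omega w.
Hypothesis Hsym : radially_symmetric Omega w.

(** The derivative of the profile of z, taken from the partial derivatives. *)
Definition axis_derivative (z : E -> R) r := partial_derivative ord0 z (axis_point r).

Let axis_in r : J `|r| -> Omega (axis_point r).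
Proof. by move=> H; apply/domain_setE; rewrite enorm_axis_point. Qed.

Let J_norm r : J r -> J `|r|.
Proof.
case: D => [|rho] /=; first by move=> _; exact: normr_ge0.
by move=> /andP[r0 rr]; rewrite normr_ge0 ger0_norm.
Qed.

Lemma derive_profile r : J `|r| ->
  is_derive r 1 (radial_profile w) (axis_derivative w r) /\
  is_derive r 1 (axis_derivative w) (axis_derivative (partial_derivative ord0 w) r).
Proof.
move=> /axis_in Or; case: Hw => _ /(_ ord0)[d1 [_ /(_ ord0)[d2 _]]].
split.
  have -> : radial_profile w = (fun s => w (0 + s *: delta_mx ord0 ord0)).
    by apply/funext => s; rewrite -axis_pointE.
  rewrite /axis_derivative axis_pointE; apply: line_derive.
  by rewrite -axis_pointE; exact: d1.
have -> : axis_derivative w = (fun s => partial_derivative ord0 w (0 + s *: delta_mx ord0 ord0)).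
  by apply/funext => s; rewrite -axis_pointE.
rewrite /axis_derivative axis_pointE; apply: line_derive.
by rewrite -axis_pointE; exact: d2.
Qed.

Lemma J_right r : J r -> exists2 e, 0 < e & forall s, 0 <= s -> s < r + e -> J s.
Proof.
case: D => [|rho] /=; first by move=> _; exists 1.
move=> /andP[r0 rr]; exists (rho - r); first by rewrite subr_gt0.
by move=> s s0; rewrite subrKC => ->; rewrite s0.
Qed.

Lemma J_ge0 r : J r -> 0 <= r.
Proof. by case: D => [|rho] //= /andP[]. Qed.

Lemma initial_segment_radii : initial_segment J.
Proof.
move=> r s; case: D => [|rho] /=; first by move=> _ /andP[].
by move=> /andP[r0 rr] /andP[-> sr]; rewrite (le_lt_trans sr).
Qed.

(** The profile is even. *)
Lemma axis_derivative0 : J 0 -> axis_derivative w 0 = 0.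
Proof.
move=> J0; have [e e0 He] := J_right J0.
have [] := derive_profile (J_norm J0); set l := axis_derivative w 0 => Dw _.
have DN : is_derive (0 : R) 1 (fun r => radial_profile w (- r)) (- l).
  have := der_comp (derN (derI (0 : R))) (_ : is_derive (- 0 : R) 1 (radial_profile w) l).
  rewrite oppr0 => /(_ Dw) H; apply: (der_eq H); ring.
have : is_derive (0 : R) 1 (fun r => radial_profile w (- r)) l.
  apply: (der_near _ Dw); exists e => // r; rewrite subr0 => re.
  have Jr : J `|r| by apply: He => //; rewrite add0r.
  apply: Hsym; rewrite ?enorm_axis_point ?normrN//; apply/domain_setE;
    by rewrite enorm_axis_point ?normrN.
by move=> /(der_uniq DN); lra.
Qed.

(** Along t -> r e_0 + t e_i the function is the profile at
    rho = sqrt (r^2 + t^2), so its i-th partial derivative is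
    (profile'(rho) / rho) t, which has derivative profile'(r) / r at t = 0. *)
Lemma transverse_second_derivative r i : 0 < r -> J r -> i != ord0 ->
  partial_derivative i (partial_derivative i w) (axis_point r) = axis_derivative w r / r.
Proof.
move=> r0 Jr i0; have [e e0 He] := J_right Jr.
pose rho t := Num.sqrt (r ^+ 2 + t ^+ 2).
have r2 t : 0 < r ^+ 2 + t ^+ 2 by rewrite ltr_wpDr ?sqr_ge0// exprn_gt0.
have rho0 t : 0 < rho t by rewrite sqrtr_gt0.
have rhoE : rho 0 = r by rewrite /rho expr0n addr0 sqrtr_sqr gtr0_norm.
have Drho t : is_derive t 1 rho (t / rho t).
  apply: (der_eq (der_comp (derD (derC t (r ^+ 2)) (derX 2 (derI t))) (is_derive1_sqrt (r2 t)))).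
  by rewrite /= expr1 -/(rho t); field; rewrite gt_eqF.
have [z z0 Hz] := is_derive1_ct (Drho 0) e0.
have Jrho t : `|t| < z -> J (rho t).
  move=> tz; apply: He; first exact: ltW.
  by have := Hz t; rewrite subr0 rhoE => /(_ tz); rewrite ltr_norml => /andP[]; lra.
pose y t := axis_point r + t *: delta_mx ord0 i.
have Oy t : `|t| < z -> Omega (y t).
  by move=> tz; apply/domain_setE; rewrite enorm_orthogonal//; exact: Jrho.
have wE t : `|t| < z -> w (y t) = radial_profile w (rho t).
  move=> tz; apply: Hsym; first exact: Oy.
    by apply: axis_in; rewrite gtr0_norm//; exact: Jrho.
  by rewrite enorm_orthogonal// enorm_axis_point gtr0_norm.
have [_ /(_ i)[d1 [_ /(_ i)[d2 _]]]] := Hw.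
have dE t : `|t| < z -> partial_derivative i w (y t) = axis_derivative w (rho t) / rho t * t.
  move=> tz.
  have D1 : is_derive t 1 (fun s => w (y s)) (partial_derivative i w (y t)).
    by apply: line_derive; apply: d1; exact: Oy.
  have Jn : J `|rho t| by rewrite gtr0_norm//; exact: Jrho.
  have D2 : is_derive t 1 (fun s => w (y s)) (axis_derivative w (rho t) * (t / rho t)).
    have [D3 _] := derive_profile Jn.
    apply: (der_near _ (der_comp (Drho t) D3)).
    exists (z - `|t|); first by rewrite subr_gt0.
    move=> s st; rewrite wE//.
    by have := ler_normD (s - t) t; rewrite subrK; lra.
  by rewrite (der_uniq D1 D2); ring.
have y0 : y 0 = axis_point r by rewrite /y scale0r addr0.
have D1 : is_derive (0 : R) 1 (fun t => partial_derivative i w (y t))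
    (partial_derivative i (partial_derivative i w) (y 0)).
  by apply: line_derive; apply: d2; apply: Oy; rewrite normr0.
have Jn : J `|rho 0| by rewrite gtr0_norm// rhoE.
have [_ D3] := derive_profile Jn.
have Di : is_derive (0 : R) 1 (fun t => (rho t)^-1) (- (rho 0) ^- 2 * (0 / rho 0)).
  exact: (der_eq (is_deriveV (lt0r_neq0 (rho0 0)) (Drho 0))) _.
have D2 := derM (derM (der_comp (Drho 0) D3) Di) (derI 0).
have := der_uniq D1 (der_near _ D2); rewrite y0 => ->.
  by rewrite mulr0 add0r mulr1 rhoE.
by exists z => // t; rewrite subr0 => tz; rewrite dE.
Qed.

Lemma laplacian_axis r : 0 < r -> J r -> laplacian w (axis_point r) =
  axis_derivative (partial_derivative ord0 w) r + n%:R / r * axis_derivative w r.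
Proof.
move=> r0 Jr; rewrite /laplacian big_ord_recl; congr (_ + _).
rewrite (eq_bigr (fun=> axis_derivative w r / r)) => [|i _]; last first.
  by rewrite transverse_second_derivative.
by rewrite sumr_const card_ord -mulr_natl; ring.
Qed.

Lemma profile_enorm x : Omega x -> w x = radial_profile w (enorm x).
Proof.
move=> Ox; apply: Hsym => //.
  by apply: axis_in; rewrite ger0_norm ?enorm_ge0//; apply/domain_setE.
by rewrite enorm_axis_point ger0_norm// enorm_ge0.
Qed.

End Profile.


End RadialFunctions.

(** * From the elliptic system to the radial equations *)

Section FromPDE.
Variables (R : realType) (n : nat).
Local Notation E := 'rV[R]_n.+1.
Implicit Types (r : R) (u v w : E -> R) (D : domain R).

Lemma classical_radial_ode D lambda gamma q beta u v : valid_domain D ->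
  classical_radial_solution D lambda gamma q beta u v ->
  radial_ode q n lambda gamma beta (domain_radii D)
    (radial_profile u) (radial_profile v) (axis_derivative u) (axis_derivative v)
    (axis_derivative (partial_derivative ord0 u)) (axis_derivative (partial_derivative ord0 v)).
Proof.
move=> hD [[[Cu Cv] _ Eu Ev _] Su Sv].
have J0 : domain_radii D 0 by case: D hD {Cu Cv Eu Ev Su Sv} => [|rho] //= ->; rewrite lexx.
split.
- move=> r Jr; have Jn : domain_radii D `|r| by rewrite ger0_norm// (J_ge0 Jr).
  have [? ?] := derive_profile Cu Jn; have [? ?] := derive_profile Cv Jn.
  by split.
- by split; [exact: axis_derivative0 Cu Su J0|exact: axis_derivative0 Cv Sv J0].
- move=> r r0 Jr.
  have Or : domain_set D (axis_point n r).
    by apply/domain_setE; rewrite enorm_axis_point gtr0_norm.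
  have := Eu _ Or; have := Ev _ Or.
  rewrite (laplacian_axis Cu Su r0 Jr) (laplacian_axis Cv Sv r0 Jr).
  by rewrite /radial_profile -/(axis_point n r) => <- <-; split; ring.
Qed.

Lemma closure_ball_axis (rho r : R) : 0 < rho -> 0 <= r <= rho ->
  closure (@domain_set R n.+1 (Ball rho)) (axis_point n r).
Proof.
move=> rho0 /andP[r0]; rewrite le_eqVlt => /predU1P[->|rr]; last first.
  apply: (@subset_closure _ (@domain_set R n.+1 (Ball rho))); apply/(domain_setE (Ball rho)).
  by rewrite enorm_axis_point ger0_norm//= r0.
move=> A /nbhs_ballP[e /= e0 eA].
pose s := Num.max 0 (rho - e / 2).
have s0 : 0 <= s by rewrite le_max lexx.
have sr : s < rho by rewrite gt_max rho0 /=; lra.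
have se : rho - e / 2 <= s by rewrite le_max lexx orbT.
exists (axis_point n s); split.
  by apply/(domain_setE (Ball rho)); rewrite enorm_axis_point ger0_norm//= s0.
apply: eA; split=> // i j; rewrite /ball /= !mxE.
case: eqP => _; last by rewrite subrr normr0.
by rewrite ltr_norml; apply/andP; split; lra.
Qed.

Lemma continuous_axis_point : continuous (axis_point n : R -> E).
Proof.
move=> r A /nbhs_ballP[e /= e0 eA]; apply/nbhs_ballP; exists e => //= s rs.
apply: eA; split=> // i j; rewrite !mxE.
by case: eqP => _; [exact: rs|exact: ballxx].
Qed.

Lemma continuous_profile_ball (rho : R) w : 0 < rho ->
  {within closure (@domain_set R n.+1 (Ball rho)), continuous w} ->
  {within `[0, rho], continuous (radial_profile w)}.
Proof.
move=> rho0 /subspace_continuousP cw; apply/subspace_continuousP => r.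
rewrite /= in_itv /= => r01.
have Cr := closure_ball_axis rho0 r01.
apply: (@cvg_comp _ _ _ (axis_point n) w _ _ _ _ (cw _ Cr)).
move=> A /= HA; have := @continuous_axis_point r _ HA.
rewrite !nbhs_simpl /= /within /= => H.
apply: (@filterS _ _ _ _ _ _ H) => s /= h; rewrite in_itv /= => s01.
by apply: h; exact: closure_ball_axis.
Qed.

Lemma classical_vanishes_at_edge D lambda gamma q beta u v : valid_domain D ->
  classical_radial_solution D lambda gamma q beta u v ->
  vanishes_at_edge (domain_radii D) (radial_profile u) (radial_profile v).
Proof.
move=> hD H r0 r00 Jr0.
have [h1 _ _] := classical_radial_ode hD H.
have cont (b : R) : (forall r, 0 <= r <= b -> domain_radii D r) ->
    {within `[0, b], continuous (radial_profile u)} /\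
    {within `[0, b], continuous (radial_profile v)}.
  move=> Jb; split; apply: derivable_within_continuous => r; rewrite in_itv /= => /Jb /h1.
    by move=> [[]].
  by move=> [_ _ []].
move: H hD h1 cont Jr0; case: D => [|rho] H hD h1 cont Jr0.
  exists (r0 + 1); split.
  - by rewrite ltrDl ltr01 lexx.
  - by apply: cont => r /andP[].
  - by move=> r /andP[].
  - by [].
  - by left.
have [r0rho|] := ltP (r0 + 1) rho.
  exists (r0 + 1); split.
  - by rewrite ltrDl ltr01 lexx.
  - by apply: cont => r /andP[r1 r2] /=; rewrite r1 (le_lt_trans r2).
  - by move=> r /andP[r1 r2] /=; rewrite r1 (lt_trans r2).
  - by [].
  - by left.
move: Jr0 => /= /andP[_ rr] rho1.
have [[_ [cu cv] _ _ bd] _ _] := H.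
exists rho; split.
- by rewrite rr.
- by split; exact: continuous_profile_ball.
- by move=> r.
- by move=> r /= /andP[_ /ltW].
- right; apply: (bd (axis_point n rho)); split.
    by apply: closure_ball_axis => //; rewrite lexx ltW.
  move=> /interior_subset /(domain_setE (Ball rho)) /=; rewrite enorm_axis_point gtr0_norm//.
  by rewrite ltxx andbF.
Qed.

End FromPDE.

Theorem theorem2 (R : realType) (n : nat) (hn : (1 <= n <= 3)%N)
    (D : domain R) (hD : valid_domain D)
    (lambda gamma q : R)
    (hp1 : 1 < 2 * q + 3)
    (hpS : ((2 * q + 3)%:E < critical_exponent R n)%E)
    (C1 C2 C3 C4 : R)
    (hC1 : 0 <= C1) (hC2 : 0 <= C2) (hC3 : 0 <= C3) (hC4 : 0 <= C4)
    (B : set R) (hB : compact B) (hB1 : B `<=` ~` [set -1])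
    (Bstar : set R) (hBstar : compact Bstar) :
  exists C : R,
    (forall (beta : R) (u v : 'rV[R]_n -> R), B beta ->
       classical_radial_solution D lambda gamma q beta u v ->
       class_K D C1 C2 C3 C4 u v ->
       (pair_sup_norm (domain_set D) u v <= C%:E)%E) /\
    (forall (beta : R) (u v : 'rV[R]_n -> R), Bstar beta ->
       classical_radial_solution D lambda gamma q beta u v ->
       class_Kstar D C1 C2 C3 C4 u v ->
       (pair_sup_norm (domain_set D) u v <= C%:E)%E).
Proof.
case: n hn hpS => [//|n] /= n3 hpS.
have hq : -1 < q by lra.
have hd : (n%:R - 1) * (q + 1) < 2.
  case: n n3 hpS => [|[|[|//]]] _ hpS; [lra|lra|].
  move: hpS; rewrite /critical_exponent /= lte_fin.
  rewrite (_ : (3%:R + 2) / (3%:R - 2) = 5 :> R); last by field; lra.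
  by lra.
have [rho [rho0 Jrho]] : exists rho, 0 < rho /\ domain_radii D rho.
  case: D hD => [|r] /= hD; first by exists 1; split; rewrite ?ltr01 ?ler01.
  by exists (r / 2); split; [rewrite divr_gt0|apply/andP; split; lra].
have [C HC] := @radial_a_priori_bound R q n lambda gamma (domain_radii D) B Bstar
  C1 C2 C3 C4 rho hq n3 hd (@initial_segment_radii R D) rho0 Jrho hB hB1 hBstar.
exists (C + 1).
have key beta (u v : 'rV[R]_n.+1 -> R) :
    classical_radial_solution D lambda gamma q beta u v -> class_K D C1 C2 C3 C4 u v ->
    B beta \/ (Bstar beta /\
      ((exists2 r, 0 <= r /\ domain_radii D r & radial_profile u r != radial_profile v r) /\
      (exists2 r, 0 <= r /\ domain_radii D r & radial_profile u r != - radial_profile v r))) ->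
    (pair_sup_norm (domain_set D) u v <= (C + 1)%:E)%E.
  move=> Hs [z1 z2 z3 z4] Hb.
  have bound x : domain_set D x -> u x ^+ 2 + v x ^+ 2 <= C.
    move=> Ox; have [_ Su Sv] := Hs.
    rewrite (profile_enorm Su Ox) (profile_enorm Sv Ox).
    apply: (HC _ _ _ _ _ _ _ _ (classical_radial_ode hD Hs)
      (classical_vanishes_at_edge hD Hs)) => //; last exact/domain_setE.
    exact: enorm_ge0.
  have sq (a b : R) : a ^+ 2 + b ^+ 2 <= C -> `|a| <= C + 1.
    move=> h; have := sqr_ge0 b => hb; have := sqr_ge0 (a - 1) => h1.
    have := sqr_ge0 (a + 1) => h2; have := sqr_ge0 a => h3.
    by rewrite ler_norml; apply/andP; split; nra.
  rewrite /pair_sup_norm ge_max; apply/andP; split; apply: ge_ereal_sup => _ [x Ox <-];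
    rewrite lee_fin.
    exact: sq (bound _ Ox).
  by apply: (sq _ (u x)); rewrite addrC bound.
split=> beta u v Bb Hs; first by move=> HK; apply: (key beta) => //; left.
move=> [HK N1 N2]; apply: (key beta) => //; right; split=> //.
have [_ Su Sv] := Hs.
have nontriv (w : 'rV[R]_n.+1 -> R) :
    radially_symmetric (domain_set D) w -> ~ (forall x, domain_set D x -> u x = w x) ->
    exists2 r, 0 <= r /\ domain_radii D r & radial_profile u r != radial_profile w r.
  move=> Sw Nw; apply: contrapT => N; apply: Nw => x Ox.
  rewrite (profile_enorm Su Ox) (profile_enorm Sw Ox).
  apply/eqP; rewrite -[_ == _]negbK; apply/negP => h; apply: N.
  by exists (enorm x) => //; split; [exact: enorm_ge0|exact/domain_setE].
split; first exact: nontriv Sv N1.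
apply: (nontriv (fun x => - v x)) => // x y Ox Oy xy.
by rewrite (Sv x y).
Qed.
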